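(* Let $(\mathcal V,1)$ be a matrix order unit space, and let $\mathcal L=(L_n)$ be a matrix Lip-norm on $(\mathcal V,1)$ which is closed. Let $\tilde{\mathcal V}=\mathcal V/\mathbb C1$ with quotient seminorms $\tilde{\mathcal L}=(\tilde L_n)$, put $K_n=\{\tilde a\in M_n(\tilde{\mathcal V}):\tilde L_n(\tilde a)\le1\}$ and $\mathbf K=(K_n)$. Then $(\tilde{\mathcal V},\tilde{\mathcal L})$ is naturally completely isometrically isomorphic to the dual operator space of $A_0(\mathbf K)$.
   Context: All vector spaces are complex; $M_{m,n}$ denotes the complex $m\times n$ matrices with the operator norm, $M_n=M_{n,n}$, $1_n$ the identity. $M_n(V)$ is the space of $n\times n$ matrices over $V$; $v\oplus w$ is the block-diagonal sum, $\alpha v\beta$ the product with scalar matrices; on a $*$-vector space $[v_{ij}]^*=[v_{ji}^*]$. A $*$-vector space $V$ is matrix ordered if each $M_n(V)$ is partially ordered (cone $M_n(V)^+$) and $\gamma^*M_n(V)^+\gamma\subseteq M_m(V)^+$ for $\gamma\in M_{n,m}$. A matrix order unit space $(\mathcal V,1)$ is a matrix ordered space with a distinguished order unit $1$ such that $\mathcal V^+$ is a proper cone with order unit $1$ and each $M_n(\mathcal V)^+$ is Archimedean (equivalently, an operator system; completeness not assumed). $M_n(\mathcal V)$ carries the norm $\|v\|_n=\inf\{t:\begin{bmatrix} t1&v\\ v^*&t1\end{bmatrix}\ge0\}$. $\overline{\mathcal V}$ is its completion. A matrix Lipschitz seminorm $\mathcal L=(L_n)$ on $(\mathcal V,1)$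 is a sequence of seminorms $L_n:M_n(\mathcal V)\to[0,+\infty)$ with: null space of $L_n$ equal to $M_n(\mathbb C1)$; $L_{m+n}(v\oplus w)=\max\{L_m(v),L_n(w)\}$; $L_n(\alpha v\beta)\le\|\alpha\|L_m(v)\|\beta\|$; $L_m(v^* )=L_m(v)$ (for $v\in M_m(\mathcal V)$, $w\in M_n(\mathcal V)$, $\alpha\in M_{n,m}$, $\beta\in M_{m,n}$). $CS_n(\mathcal V)$ is the set of completely positive maps $\varphi:\mathcal V\to M_n$ with $\varphi(1)=1_n$; $\ll\varphi,a\gg=[\varphi_{kl}(a_{ij})]$; $D_{L_n}(\varphi,\psi)=\sup\{\|\ll\varphi,a\gg-\ll\psi,a\gg\|:a\in M_r(\mathcal V),L_r(a)\le1,r\in\mathbb N\}$. $\mathcal L$ is a matrix Lip-norm if for every $n$ the topology on $CS_n(\mathcal V)$ given by $D_{L_n}$ is the BW-topology (point-norm topology). Let $\widehat{L_n^1}$ be the norm closure in $M_n(\overline{\mathcal V})$ of $\{a\in M_n(\mathcal V):L_n(a)\le1\}$ and $L_n^-(v)=\inf\{\lambda>0:v\in\lambda\widehat{L_n^1}\}$ for $v\in M_n(\overline{\mathcal V})$. $\mathcal L$ is closed if $\mathcal L=\mathcal L^-$ on the subspace where $\mathcal L^-=(L_n^-)$ is finite (i.e. $L_n^-(b)<\infty$ implies $b\in M_n(\mathcal V)$ and $L_n(b)=L_n^-(b)$). On $\tilde{\mathcal V}=\mathcal V/\mathbb C1$, $M_n(\tilde{\mathcal V})\cong M_n(\mathcal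 V)/M_n(\mathbb C1)$, $\tilde L_n(\tilde a)=L_n(a)$ is a matrix norm; $\tilde{\mathcal V}$ also has the quotient matrix norm $\|\cdot\|^\sim$ of $\|\cdot\|$ and the quotient involution. $\mathbf K$ is compact for $\|\cdot\|^\sim$. Let $G_n=\{\tilde a\in K_n:\tilde a^*=\tilde a\}$, $\mathbf G=(G_n)$, also compact matrix convex. For a compact matrix convex set $\mathbf S=(S_n)$ (closed under $\sum_i\gamma_i^*v_i\gamma_i$ with $\sum_i\gamma_i^*\gamma_i=1_n$), $A(\mathbf S,M_r)$ is the space of sequences $\mathbf F=(F_n)$, $F_n:S_n\to M_n(M_r)$, with $F_n(\sum_i\gamma_i^*v_i\gamma_i)=\sum_i(\gamma_i\otimes1_r)^*F_{n_i}(v_i)(\gamma_i\otimes1_r)$ whenever $v_i\in S_{n_i}$, $\gamma_i\in M_{n_i,n}$, $\sum_i\gamma_i^*\gamma_i=1_n$, and with $F_1$ continuous; operations, including the adjoint, are pointwise, and $\mathbf F\ge0$ iff $F_n(v)\ge0$ for all $n$ and $v\in S_n$. $A(\mathbf S)=A(\mathbf S,\mathbb C)$ is a matrix order unit space via $M_r(A(\mathbf S))\cong A(\mathbf S,M_r)$, with unit $\mathbf I$, $I_n(v)=1_n$, and norm $\|\mathbf F\|_r^\sharp=\inf\{t>0:\begin{bmatrix}t\mathbf I^{(r)}&\mathbf F\\ \mathbf F^*&t\mathbf I^{(r)}\end{bmatrix}\ge0\}$, where $I^{(r)}_n(v)=1_n\otimes1_r$. $A_0(\mathbf G)=\{\mathbf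 F\in A(\mathbf G):F_n(\tilde0_n)=0_n\ \forall n\}$. Every element of $K_n$ has the form $\sum_j\alpha_jg_j\beta_j$ with $g_j\in G_{n_j}$, $\alpha_j\in M_{n,n_j}$, $\beta_j\in M_{n_j,n}$, $\sum\alpha_j\alpha_j^*\le1_n$, $\sum\beta_j^*\beta_j\le1_n$, and each $\mathbf F\in A_0(\mathbf G)$ extends to a well-defined $\tilde{\mathbf F}=(\tilde F_n)$ on $\mathbf K$ by $\tilde F_n(\sum_j\alpha_jg_j\beta_j)=\sum_j\alpha_jF_{n_j}(g_j)\beta_j$. Set $A_0(\mathbf K)=\{\tilde{\mathbf F}:\mathbf F\in A_0(\mathbf G)\}\subseteq A(\mathbf K)$ with the operator space structure inherited from $A(\mathbf K)$. The dual operator space $X^*$ of an operator space $X$ has $M_n(X^* )\cong\mathcal{CB}(X,M_n)$ isometrically. The natural map sends $\tilde a\in\tilde{\mathcal V}$ to the functional $\tilde{\mathbf F}\mapsto\check F_1(\tilde a)$ on $A_0(\mathbf K)$, where $\check F_1(\lambda k)=\lambda\tilde F_1(k)$ for $\lambda\ge0$, $k\in K_1$. Completely isometric: each amplification is isometric from $(M_n(\tilde{\mathcal V}),\tilde L_n)$ onto $M_n(A_0(\mathbf K)^* )$. *)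

(* Defs.v *)
From HB Require Import structures.
From mathcomp Require Import all_boot all_order all_algebra.
From mathcomp Require Import sesquilinear spectral complex.
From mathcomp Require Import all_classical all_reals ereal topology normedtype.

Set Implicit Arguments.
Unset Strict Implicit.
Unset Printing Implicit Defensive.

Import Order.TTheory GRing.Theory Num.Theory.
Import numFieldNormedType.Exports.

Local Open Scope classical_set_scope.
Local Open Scope ring_scope.
Local Open Scope complex_scope.
Local Open Scope sesquilinear_scope.

(* Throughout, the scalars are R[i] with R : realType, and all sequences      *)
(* indexed by matrix sizes also carry the index 0.  M_0(V) is a point, so     *)
(* this index carries no information and adds no constraint.                  *)

Notation normc := Normc.normc.

Section ScalarMatrices.
Variable R : realType.
Local Notation C := R[i].

Definition l2norm n (x : 'cV[C]_n) : R :=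
  Num.sqrt (\sum_(i < n) normc (x i 0) ^+ 2).

Definition opnorm m n (A : 'M[C]_(m, n)) : R :=
  sup [set l2norm (A *m x) | x in [set x | l2norm x <= 1]].

(* 0 <= z in R[i] forces z to be real, so A is automatically hermitian.       *)
Definition psd n (A : 'M[C]_n) : Prop :=
  forall x : 'cV[C]_n, 0 <= (x^t* *m A *m x) 0 0.

(* M_r(M_n) identified with M_(r n).                                          *)
Definition flatmx r n (A : 'M['M[C]_n]_r) : 'M[C]_(\sum_(i < r) n) :=
  \mxblock_(i < r, j < r) A i j.

End ScalarMatrices.

Section MatricesOverModule.
Variables (R : realType) (V : lmodType R[i]).
Local Notation C := R[i].

Definition amul m p q n (alpha : 'M[C]_(m, p)) (v : 'M[V]_(p, q))
    (beta : 'M[C]_(q, n)) : 'M[V]_(m, n) :=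
  \matrix_(i, j) \sum_(k < p) \sum_(l < q) (alpha i k * beta l j) *: v k l.

(* MathComp's *: on 'M[V]_(m, n) is only available when V is a ring.          *)
Definition mscale m n (c : C) (v : 'M[V]_(m, n)) : 'M[V]_(m, n) :=
  map_mx (fun x => c *: x) v.

Definition mxstar (star : V -> V) m n (v : 'M[V]_(m, n)) : 'M[V]_(n, m) :=
  map_mx star v^T.

(* alpha (x) e, so that M_n(C e) is the range of this map.                    *)
Definition mxtensor (e : V) m n (alpha : 'M[C]_(m, n)) : 'M[V]_(m, n) :=
  map_mx (fun c => c *: e) alpha.

Definition mxunit (e : V) n : 'M[V]_n := mxtensor e 1%:M.

End MatricesOverModule.

Section MatrixOrderUnitSpaces.
Variables (R : realType) (V : lmodType R[i]).
Local Notation C := R[i].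
Variables (star : V -> V) (e : V) (pos : forall n, set 'M[V]_n).

Record involution : Prop := Involution {
  starK : involutive star;
  star_conj_linear : forall (c : C) u v, star (c *: u + v) = c^* *: star u + star v
}.

Record matrix_ordered : Prop := MatrixOrdered {
  pos_sa : forall n (v : 'M[V]_n), pos v -> mxstar star v = v;
  pos_0 : forall n, pos (0 : 'M[V]_n);
  pos_add : forall n (u v : 'M[V]_n), pos u -> pos v -> pos (u + v);
  pos_scale : forall n (t : R) (v : 'M[V]_n),
    0 <= t -> pos v -> pos (mscale t%:C v);
  pos_proper : forall n (v : 'M[V]_n), pos v -> pos (- v) -> v = 0;
  pos_conj : forall m n (gamma : 'M[C]_(n, m)) (v : 'M[V]_n),
    pos v -> pos (amul (gamma^t* ) v gamma)
}.

Record matrix_order_unit_space : Prop := MatrixOrderUnitSpace {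
  mous_involution : involution;
  mous_ordered : matrix_ordered;
  mous_unit_pos : pos (mxunit e 1%N);
  mous_unit : forall v : 'M[V]_1, mxstar star v = v ->
    exists2 t : R, 0 < t &
      pos (mscale t%:C (mxunit e 1%N) + v) /\ pos (mscale t%:C (mxunit e 1%N) - v);
  mous_arch : forall n (v : 'M[V]_n), mxstar star v = v ->
    (forall t : R, 0 < t -> pos (mscale t%:C (mxunit e n) + v)) -> pos v
}.

Definition mnorm n (v : 'M[V]_n) : R :=
  inf [set t : R | 0 < t /\
    pos (block_mx (mscale t%:C (mxunit e n)) v
                  (mxstar star v) (mscale t%:C (mxunit e n)))].

Definition CP n (phi : V -> 'M[C]_n) : Prop :=
  linear phi /\
  forall r (a : 'M[V]_r), pos a -> psd (flatmx (map_mx phi a)).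

Definition CS n : set (V -> 'M[C]_n) := [set phi | CP phi /\ phi e = 1%:M].

Record matrix_Lipschitz_seminorm (L : forall n, 'M[V]_n -> R) : Prop :=
  MatrixLipschitzSeminorm {
  mls_ge0 : forall n (v : 'M[V]_n), 0 <= L n v;
  mls_triangle : forall n (u v : 'M[V]_n), L n (u + v) <= L n u + L n v;
  mls_scale : forall n (c : C) (v : 'M[V]_n), L n (mscale c v) = normc c * L n v;
  mls_null : forall n (v : 'M[V]_n),
    L n v = 0 <-> exists alpha : 'M[C]_n, v = mxtensor e alpha;
  mls_sum : forall m n (v : 'M[V]_m) (w : 'M[V]_n),
    L (m + n)%N (block_mx v 0 0 w) = Num.max (L m v) (L n w);
  mls_bimodule : forall m n (alpha : 'M[C]_(n, m)) (v : 'M[V]_m)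
      (beta : 'M[C]_(m, n)),
    L n (amul alpha v beta) <= opnorm alpha * L m v * opnorm beta;
  mls_star : forall n (v : 'M[V]_n), L n (mxstar star v) = L n v
}.

(* <<phi, a>> = [phi(a_ij)] in M_r(M_n); its norm does not see the canonical  *)
(* shuffle M_r(M_n) = M_n(M_r).  The supremum is a priori extended-valued.    *)
Definition D_metric (L : forall n, 'M[V]_n -> R) n (phi psi : V -> 'M[C]_n) :
    \bar R :=
  ereal_sup [set x | exists r (a : 'M[V]_r), L r a <= 1 /\
    x = (opnorm (flatmx (map_mx phi a) - flatmx (map_mx psi a)))%:E].

Definition D_open (L : forall n, 'M[V]_n -> R) n (U : set (V -> 'M[C]_n)) : Prop :=
  U `<=` @CS n /\
  forall phi, U phi -> exists2 eps : R, 0 < eps &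
    forall psi, @CS n psi -> (D_metric L phi psi < eps%:E)%E -> U psi.

(* Open sets of CS_n for the topology induced by pointwise convergence        *)
(* V -> M_n; R[i]^o is R[i] with its usual topology.                          *)
Definition BW_open n (U : set (V -> 'M[C]_n)) : Prop :=
  exists2 O : set {ptws V -> 'M[C^o]_n}, open O & U = O `&` @CS n.

Definition matrix_Lip_norm (L : forall n, 'M[V]_n -> R) : Prop :=
  matrix_Lipschitz_seminorm L /\
  forall n (U : set (V -> 'M[C]_n)), D_open L U <-> BW_open U.

End MatrixOrderUnitSpaces.

Section Completion.
Variables (R : realType) (V W : lmodType R[i]).
Local Notation C := R[i].
Variables (N : forall n, 'M[V]_n -> R) (NW : forall n, 'M[W]_n -> R).
Variable iota : {linear V -> W}.

Record operator_space_norm : Prop := OperatorSpaceNorm {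
  osn_ge0 : forall n (w : 'M[W]_n), 0 <= NW w;
  osn_triangle : forall n (u w : 'M[W]_n), NW (u + w) <= NW u + NW w;
  osn_scale : forall n (c : C) (w : 'M[W]_n), NW (mscale c w) = normc c * NW w;
  osn_eq0 : forall n (w : 'M[W]_n), NW w = 0 -> w = 0;
  osn_sum : forall m n (v : 'M[W]_m) (w : 'M[W]_n),
    NW (block_mx v 0 0 w) = Num.max (NW v) (NW w);
  osn_bimodule : forall m n (alpha : 'M[C]_(n, m)) (w : 'M[W]_m)
      (beta : 'M[C]_(m, n)),
    NW (amul alpha w beta) <= opnorm alpha * NW w * opnorm beta
}.

(* (W, NW) is the operator space completion of (V, N), with canonical         *)
(* inclusion iota; this determines it up to complete isometry.                *)
Record is_completion : Prop := IsCompletion {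
  cpl_norm : operator_space_norm;
  cpl_isometry : forall n (v : 'M[V]_n), NW (map_mx iota v) = N v;
  cpl_dense : forall (w : 'M[W]_1) (eps : R), 0 < eps ->
    exists v : 'M[V]_1, NW (w - map_mx iota v) < eps;
  cpl_complete : forall u : nat -> 'M[W]_1,
    (forall eps : R, 0 < eps -> exists k0, forall k l, (k0 <= k)%N -> (k0 <= l)%N ->
       NW (u k - u l) < eps) ->
    exists w, forall eps : R, 0 < eps -> exists k0, forall k, (k0 <= k)%N ->
       NW (u k - w) < eps
}.

Variable L : forall n, 'M[V]_n -> R.

Definition Lball_closure n : set 'M[W]_n :=
  [set w | forall eps : R, 0 < eps ->
    exists2 a : 'M[V]_n, L a <= 1 & NW (w - map_mx iota a) < eps].

Definition Lminus n (w : 'M[W]_n) : \bar R :=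
  ereal_inf [set l%:E | l in [set l : R | 0 < l /\
    exists2 w', @Lball_closure n w' & w = mscale l%:C w']].

Definition Lip_closed : Prop :=
  forall n (w : 'M[W]_n), (Lminus w < +oo)%E ->
    exists2 a : 'M[V]_n, w = map_mx iota a & Lminus w = (L a)%:E.

End Completion.

Section Quotient.
Variables (R : realType) (V : lmodType R[i]) (e : V).
Local Notation C := R[i].

Definition Cunit : {pred V} := [pred v | `[< exists c : C, v = c *: e >]].

Lemma Cunit_zmod_closed : zmod_closed Cunit.
Proof.
split=> [|u v]; first by apply/asboolP; exists 0; rewrite scale0r.
move=> /asboolP[c ->] /asboolP[d ->].
by apply/asboolP; exists (c - d); rewrite scalerBl.
Qed.

HB.instance Definition _ := GRing.isZmodClosed.Build V Cunit Cunit_zmod_closed.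

(* V / C e, on top of MathComp's quotient of a Z-module.                      *)
Definition quotV : Type := Quotient.quot Cunit.
HB.instance Definition _ := GRing.Zmodule.on quotV.

Definition qpi (v : V) : quotV := (\pi_(Quotient.quot Cunit) v)%qT.
Definition qrepr (x : quotV) : V := (repr (x : Quotient.quot Cunit)).

Lemma qreprK x : qpi (qrepr x) = x.
Proof. exact: reprK. Qed.

Lemma qpiP u v : (qpi u = qpi v) <-> exists c : C, u - v = c *: e.
Proof.
split=> [/eqP|[c uvE]].
  by rewrite /qpi -Quotient.idealrBE => /asboolP.
by apply/eqP; rewrite /qpi -Quotient.idealrBE; apply/asboolP; exists c.
Qed.

Lemma qpiD u v : qpi (u + v) = qpi u + qpi v.
Proof. exact: (raddfD \pi_(Quotient.quot Cunit)%qT). Qed.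

Definition qscale (c : C) (x : quotV) : quotV := qpi (c *: qrepr x).

Lemma qpiZ c v : qpi (c *: v) = qscale c (qpi v).
Proof.
apply/qpiP; have /qpiP[d dE] := qreprK (qpi v).
exists (- (c * d)); rewrite -scalerBr -[v - _]opprB dE.
by rewrite scalerN scalerA scaleNr.
Qed.

Lemma qscaleA a b x : qscale a (qscale b x) = qscale (a * b) x.
Proof. by rewrite -[x]qreprK -!qpiZ scalerA. Qed.

Lemma qscale1 : left_id 1 qscale.
Proof. by move=> x; rewrite -[x]qreprK -qpiZ scale1r. Qed.

Lemma qscaleDr : right_distributive qscale +%R.
Proof.
by move=> c x y; rewrite -[x]qreprK -[y]qreprK -qpiD -!qpiZ -qpiD scalerDr.
Qed.

Lemma qscaleDl x : {morph qscale^~ x : a b / a + b}.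
Proof. by move=> a b; rewrite -[x]qreprK -!qpiZ -qpiD scalerDl. Qed.

HB.instance Definition _ :=
  GRing.Zmodule_isLmodule.Build C quotV qscaleA qscale1 qscaleDr qscaleDl.

Lemma qpi_linear : linear qpi.
Proof. by move=> c u v; rewrite qpiD qpiZ. Qed.

HB.instance Definition _ := GRing.isLinear.Build C V quotV _ qpi qpi_linear.

(* Quotient seminorm under M_n(V) -> M_n(V / C e) = M_n(V) / M_n(C e).        *)
Definition qnorm (N : forall n, 'M[V]_n -> R) n (x : 'M[quotV]_n) : R :=
  inf [set N n v | v in [set v | map_mx qpi v = x]].

Lemma qnorm_qpi (star : V -> V) (L : forall n, 'M[V]_n -> R) :
  matrix_Lipschitz_seminorm star e L ->
  forall n (a : 'M[V]_n), qnorm L (map_mx qpi a) = L n a.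
Proof.
move=> HL n a; rewrite /qnorm; set A := [set _ | _ in _].
suff -> : A = [set L n a] by rewrite inf1.
have L0 v w : map_mx qpi v = map_mx qpi w -> L n v <= L n w.
  move=> vw; have -> : v = (v - w) + w by rewrite subrK.
  rewrite (le_trans (mls_triangle HL _ _))// gerDr.
  suff /(mls_null HL) -> : exists alpha, v - w = mxtensor e alpha by [].
  have /choice[f fE] (p : 'I_n * 'I_n) : exists c, v p.1 p.2 - w p.1 p.2 = c *: e.
    by apply/qpiP; have /matrixP/(_ p.1 p.2) := vw; rewrite !mxE.
  by exists (\matrix_(i, j) f (i, j)); apply/matrixP => i j; rewrite !mxE -fE.
apply/seteqP; split=> [_ [v /= vE <-]|_ ->]; last by exists a.
by apply/eqP; rewrite eq_le !L0.
Qed.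

Definition qstar (star : V -> V) (x : quotV) : quotV := qpi (star (qrepr x)).

End Quotient.

Section AffineMaps.
Variables (R : realType) (W : lmodType R[i]).
Local Notation C := R[i].

Definition fam : Type := forall n, 'M[W]_n -> 'M[C]_n.
HB.instance Definition _ := gen_eqMixin fam.
HB.instance Definition _ := gen_choiceMixin fam.

Definition fam0 : fam := fun n v => 0.
Definition fam_opp (F : fam) : fam := fun n v => - F n v.
Definition fam_add (F G : fam) : fam := fun n v => F n v + G n v.
Definition fam_scale (c : C) (F : fam) : fam := fun n v => c *: F n v.

Lemma famP (F G : fam) : (forall n v, F n v = G n v) -> F = G.
Proof. by move=> FG; apply: functional_extensionality_dep => n; apply/funext/FG. Qed.

Lemma fam_addA : associative fam_add.
Proof. by move=> F G H; apply: famP => n v; apply: addrA. Qed.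
Lemma fam_addC : commutative fam_add.
Proof. by move=> F G; apply: famP => n v; apply: addrC. Qed.
Lemma fam_add0 : left_id fam0 fam_add.
Proof. by move=> F; apply: famP => n v; apply: add0r. Qed.
Lemma fam_addN : left_inverse fam0 fam_opp fam_add.
Proof. by move=> F; apply: famP => n v; apply: addNr. Qed.

HB.instance Definition _ :=
  GRing.isZmodule.Build fam fam_addA fam_addC fam_add0 fam_addN.

Lemma fam_scaleA a b F : fam_scale a (fam_scale b F) = fam_scale (a * b) F.
Proof. by apply: famP => n v; apply: scalerA. Qed.
Lemma fam_scale1 : left_id 1 fam_scale.
Proof. by move=> F; apply: famP => n v; apply: scale1r. Qed.
Lemma fam_scaleDr : right_distributive fam_scale +%R.
Proof. by move=> c F G; apply: famP => n v; apply: scalerDr. Qed.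
Lemma fam_scaleDl F : {morph fam_scale^~ F : a b / a + b}.
Proof. by move=> a b; apply: famP => n v; apply: scalerDl. Qed.

HB.instance Definition _ := GRing.Zmodule_isLmodule.Build C fam
  fam_scaleA fam_scale1 fam_scaleDr fam_scaleDl.

Definition fam_star (F : fam) : fam := fun n v => (F n v)^t*.
Definition fam_one : fam := fun n v => 1%:M.

(* M_r(A(S))^+ = A(S, M_r)^+ : the matrix [F_ij] over A(S) is the sequence    *)
(* v |-> [ [F_ij(v)_kl]_ij ]_kl in M_n(M_r).                                  *)
Definition fam_pos (S : forall n, set 'M[W]_n) r : set 'M[fam]_r :=
  [set F : 'M[fam]_r | forall n (v : 'M[W]_n), S n v ->
    psd (flatmx (\matrix_(k < n, l < n) \matrix_(i < r, j < r) F i j n v k l))].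

Definition sharp_norm (S : forall n, set 'M[W]_n) r (F : 'M[fam]_r) : R :=
  mnorm fam_star fam_one (fam_pos S) F.

Variable nu : forall n, 'M[W]_n -> R.

(* A(S); an element is represented by total functions that vanish off S.      *)
Record affine (S : forall n, set 'M[W]_n) (F : fam) : Prop := Affine {
  aff_off : forall n (v : 'M[W]_n), ~ S n v -> F n v = 0;
  aff_comb : forall n m (d : 'I_m -> nat) (gamma : forall i, 'M[C]_(d i, n))
      (v : forall i, 'M[W]_(d i)),
    (forall i, S (d i) (v i)) ->
    \sum_(i < m) ((gamma i)^t* *m gamma i) = 1%:M ->
    F n (\sum_(i < m) amul ((gamma i)^t* ) (v i) (gamma i)) =
    \sum_(i < m) ((gamma i)^t* *m F (d i) (v i) *m gamma i);
  aff_cont : forall (v : 'M[W]_1), S 1%N v -> forall eps : R, 0 < eps ->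
    exists2 del : R, 0 < del & forall w : 'M[W]_1, S 1%N w ->
      nu (w - v) < del -> normc (F 1%N w 0 0 - F 1%N v 0 0) < eps
}.

Variables (star : W -> W) (K : forall n, set 'M[W]_n).

Definition sa_part n : set 'M[W]_n := [set v | K v /\ mxstar star v = v].

Definition A0G (F : fam) : Prop :=
  affine sa_part F /\ forall n, F n (0 : 'M[W]_n) = 0.

(* Every element of K_n has such a decomposition (also with g_j in G), so     *)
(* there is at most one Ft for a given F.                                     *)
Definition extension (F Ft : fam) : Prop :=
  (forall n (v : 'M[W]_n), ~ K v -> Ft n v = 0) /\
  forall n m (d : 'I_m -> nat) (alpha : forall j, 'M[C]_(n, d j))
      (g : forall j, 'M[W]_(d j)) (beta : forall j, 'M[C]_(d j, n)),
    (forall j, sa_part (g j)) ->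
    psd (1%:M - \sum_(j < m) (alpha j *m (alpha j)^t* )) ->
    psd (1%:M - \sum_(j < m) ((beta j)^t* *m beta j)) ->
    Ft n (\sum_(j < m) amul (alpha j) (g j) (beta j)) =
    \sum_(j < m) (alpha j *m F (d j) (g j) *m beta j).

Definition A0K_pred : {pred fam} :=
  [pred Ft | `[< exists2 F, A0G F & extension F Ft >]].

Lemma A0K_submod_closed : submod_closed A0K_pred.
Proof.
have fam0E n (v : 'M[W]_n) : (0 : fam) n v = 0 by [].
have famE c (F H : fam) n (v : 'M[W]_n) :
  (c *: F + H) n v = c *: F n v + H n v by [].
split=> [|c Ft Ht].
  apply/asboolP; exists 0; last first.
    by split=> // *; rewrite fam0E big1// => j _; rewrite fam0E mulmx0 mul0mx.
  split=> //; split=> //.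
    by move=> *; rewrite fam0E big1// => j _; rewrite fam0E mulmx0 mul0mx.
  move=> v _ eps e0; exists 1 => // w _ _.
  by rewrite !fam0E !mxE subrr Normc.normc0.
move=> /asboolP[F [[Foff Fcomb Fcont] F0] [Ftoff Ftext]].
move=> /asboolP[H [[Hoff Hcomb Hcont] H0] [Htoff Htext]].
apply/asboolP; exists (c *: F + H); last first.
  split=> [n v Kv|n m d al g be gG al1 be1].
    by rewrite famE Ftoff// Htoff// scaler0 addr0.
  rewrite famE Ftext// Htext// scaler_sumr -big_split/=.
  apply: eq_bigr => j _.
  by rewrite famE mulmxDr mulmxDl -scalemxAr -scalemxAl.
split; last by move=> n; rewrite famE F0 H0 scaler0 addr0.
split=> [n v Gv|n m d ga v vG ga1|v Gv eps e0].
- by rewrite famE Foff// Hoff// scaler0 addr0.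
- rewrite famE Fcomb// Hcomb// scaler_sumr -big_split/=.
  apply: eq_bigr => j _.
  by rewrite famE mulmxDr mulmxDl -scalemxAr -scalemxAl.
have nc0 : 0 <= normc c by case: (c) => a b; apply: sqrtr_ge0.
have c0 : 0 < normc c + 1 by rewrite ltr_wpDl.
have e20 : 0 < eps / 2 by rewrite divr_gt0.
have [d1 d10 Fd] := Fcont v Gv _ (divr_gt0 e20 c0).
have [d2 d20 Hd] := Hcont v Gv _ e20.
exists (Num.min d1 d2); first by rewrite lt_min d10.
move=> w Gw; rewrite lt_min => /andP[/(Fd w Gw) Fw /(Hd w Gw) Hw].
rewrite !famE !mxE opprD addrACA -mulrBr.
rewrite (le_lt_trans (le_normcD _ _))// [eps]splitr ler_ltD//.
rewrite Normc.normcM; apply: (@le_trans _ _ ((normc c + 1) * (eps / 2 / (normc c + 1)))).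
  by apply: ler_pM => //; [case: (_ - _) => a b; apply: sqrtr_ge0|rewrite lerDl|exact: ltW].
by rewrite mulrC divfK// gt_eqF.
Qed.

HB.instance Definition _ :=
  GRing.isSubmodClosed.Build C fam A0K_pred A0K_submod_closed.

Record A0K : Type := MkA0K { A0K_val :> fam; _ : A0K_val \in A0K_pred }.
HB.instance Definition _ := [isSub for A0K_val].
HB.instance Definition _ := [Choice of A0K by <:].
HB.instance Definition _ := [SubChoice_isSubLmodule of A0K by <:].

Definition A0K_norm r (F : 'M[A0K]_r) : R := sharp_norm K (map_mx A0K_val F).

End AffineMaps.

Section DualOperatorSpace.
Variables (R : realType) (X : lmodType R[i]) (N : forall n, 'M[X]_n -> R).
Local Notation C := R[i].

Definition dual_pred : {pred X -> C^o} :=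
  [pred f | `[< scalar f /\
    exists M : R, forall x, normc (f x) <= M * N (const_mx x : 'M_1) >]].

Lemma dual_submod_closed : submod_closed dual_pred.
Proof.
have fE c (f g : X -> C^o) x : (c *: f + g) x = c * f x + g x by [].
have f0E x : (0 : X -> C^o) x = 0 by [].
split=> [|c f g].
  apply/asboolP; split=> [a x y|]; first by rewrite !f0E mulr0 addr0.
  by exists 0 => x; rewrite f0E Normc.normc0 mul0r.
move=> /asboolP[flin [a fa]] /asboolP[glin [b gb]]; apply/asboolP; split.
  move=> k x y; rewrite !fE flin glin !mulrDr !mulrA.
  by rewrite [c * k]mulrC addrACA.
exists (normc c * a + b) => x; rewrite fE (le_trans (le_normcD _ _))//.
rewrite mulrDl lerD// Normc.normcM -mulrA ler_wpM2l//.
by case: (c) => p q; apply: sqrtr_ge0.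
Qed.

HB.instance Definition _ :=
  GRing.isSubmodClosed.Build C (X -> C^o) dual_pred dual_submod_closed.

Record dual : Type := MkDual { dual_val :> X -> C^o; _ : dual_val \in dual_pred }.
HB.instance Definition _ := [isSub for dual_val].
HB.instance Definition _ := [Choice of dual by <:].
HB.instance Definition _ := [SubChoice_isSubLmodule of dual by <:].

Definition cb_norm n (phi : X -> 'M[C]_n) : \bar R :=
  ereal_sup [set x | exists r (a : 'M[X]_r), N a <= 1 /\
    x = (opnorm (flatmx (map_mx phi a)))%:E].

(* M_n(X^* ) = CB(X, M_n).                                                    *)
Definition dual_norm n (f : 'M[dual]_n) : \bar R :=
  cb_norm (fun x => \matrix_(k, l) f k l x).

End DualOperatorSpace.

Section CompleteIsometry.
Variables (R : realType) (E F : lmodType R[i]).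

Definition complete_isometric_isomorphism (NE : forall n, 'M[E]_n -> R)
    (NF : forall n, 'M[F]_n -> \bar R) (Phi : {linear E -> F}) : Prop :=
  forall n, bijective (fun a : 'M[E]_n => map_mx Phi a) /\
            forall a : 'M[E]_n, NF n (map_mx Phi a) = (NE n a)%:E.

End CompleteIsometry.

Section TheSpaceA0K.
Variables (R : realType) (V : lmodType R[i]).
Variables (star : V -> V) (e : V) (pos : forall n, set 'M[V]_n).
Variable L : forall n, 'M[V]_n -> R.
Local Notation Vt := (quotV e).

Definition Kset n : set 'M[Vt]_n := [set a | qnorm L a <= 1].

(* A_0(K), with continuity taken for the quotient norm of V / C e.            *)
Definition A0 : lmodType R[i] :=
  A0K (qnorm (mnorm star e pos)) (qstar star) Kset.

Definition A0_norm r (F : 'M[A0]_r) : R := A0K_norm F.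

(* Phi(a) is F |-> \check F_1(a), where \check F_1(lambda k) = lambda F_1(k)  *)
(* for lambda >= 0 and k in K_1; every a is of the form lambda k.             *)
Definition natural_map (Phi : Vt -> dual A0_norm) : Prop :=
  forall (F : A0) (lambda : R) (k : 'M[Vt]_1), 0 <= lambda -> Kset k ->
    Phi (lambda%:C *: k 0 0) F = lambda%:C * A0K_val F k 0 0.

End TheSpaceA0K.

(* Main.v *)
Require Import Defs.
From HB Require Import structures.
From mathcomp Require Import all_boot all_order all_algebra.
From mathcomp Require Import sesquilinear spectral complex.
From mathcomp Require Import all_classical all_reals ereal topology normedtype.
From mathcomp Require Import ring lra.

(** Let [W] be the quotient of [V] by the scalars, [N] its Lipschitz norm, [nu]
    the quotient of the order unit norm and K the family of unit balls of [N].
    A normed space whose unit ball is compact for a weaker topology is the dual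
    of the space of functionals that are continuous on the ball; the theorem is
    the operator space version of this fact.

    Compactness ([Lip_ball_compact]). Up to a factor 2, the order unit norm is a
    supremum over the states ([mnorm_le_states]). The states are weakly compact,
    and the Lipschitz distance induces the weak topology, so finitely many states
    approximate all of them uniformly on the Lipschitz ball ([finite_net]), and
    the distance of any two states is finite ([finite_diameter]). Hence each ball
    of [N] is totally bounded for [nu]. A limit of elements of the ball exists in
    the completion, and is in the ball again because the seminorm is closed.

    The predual. An element of A_0(K) is the restriction to the balls of a linear
    functional on [W], applied entrywise ([ev_lin], [ev_entry]) and continuous on
    the unit ball ([ev_cont]); every [nu]-bounded functional arises in this way
    ([functional_isA0]), so these elements separate points ([A0_separates]). The
    norm of a matrix over A_0(K) is the best constant in an inequality between
    quadratic forms over all balls ([formboundP]).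

    The bipolar theorem ([bipolar]). A matrix [f] of functionals on A_0(K) that is
    contractive against the unit ball of matrices over A_0(K) is the evaluation at
    a point of the ball. For 1 x 1 matrices this gives surjectivity, and for the
    evaluations at a given matrix [a] it bounds the norm of [a] from above; the
    other inequality of the isometry is immediate. By compactness only finitely
    many elements of A_0(K) need to be considered at a time. A point [x] of the
    ball that nearly minimises the squared distance from [f] to the evaluations
    yields a matrix [G] over A_0(K), the residual, such that [Re <G, y>] is nearly
    maximal over the ball at [y = x] and [Re f(G)] exceeds this maximum by the
    squared distance. On the other hand a Hahn-Banach argument on pairs of
    matrices ([pairing_factor]) writes [G] as [S^T F T^T], with [F] in the unit
    ball and [|S|^2 + |T|^2] about twice that maximum, so [Re f(G)] is at most the
    maximum ([pairing_polar]) and the distance is zero. *)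

Set Implicit Arguments.
Unset Strict Implicit.
Unset Printing Implicit Defensive.

Import Order.TTheory GRing.Theory Num.Theory.
Import numFieldNormedType.Exports.

Local Open Scope classical_set_scope.
Local Open Scope ring_scope.
Local Open Scope complex_scope.
Local Open Scope sesquilinear_scope.

Local Notation Re := complex.Re.
Local Notation Im := complex.Im.

(** * The Hahn-Banach theorem over the complex numbers *)

Section HahnBanach.
Variables (R : realType) (U : lmodType R[i]).
Local Notation C := R[i].

Definition sublinear (p : U -> R) : Prop :=
  (forall x y, p (x + y) <= p x + p y) /\
  (forall (t : R) x, 0 <= t -> p (t%:C *: x) = t * p x).

Lemma sublinear0 p : sublinear p -> p 0 = 0.
Proof. by move=> [_ pZ]; have := pZ 0 0 (lexx _); rewrite scaler0 mul0r. Qed.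

Lemma sublinear_geN p : sublinear p -> forall x, - p (- x) <= p x.
Proof.
move=> ps x; have [pD _] := ps; have := pD x (- x).
by rewrite subrr sublinear0// -lerBlDr sub0r.
Qed.

(** The values available at [x] may depend on [x] in an arbitrary way, as they
    do in [separating_functional]; the bound [b] keeps the infima finite. *)
Lemma sublinear_infimum (S : U -> set R) (b : U -> R) :
  (forall x, S x !=set0) -> (forall x r, S x r -> b x <= r) ->
  (forall (t : R) x r, 0 < t -> S x r -> exists2 r', S (t%:C *: x) r' & r' <= t * r) ->
  (forall x y r r', S x r -> S y r' -> exists2 r'', S (x + y) r'' & r'' <= r + r') ->
  (forall r, S 0 r -> 0 <= r) -> (forall e, 0 < e -> exists2 r, S 0 r & r <= e) ->
  sublinear (fun x => inf (S x)).
Proof.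
move=> S0 bS SZ SD S0ge S0e.
have infle x r : S x r -> inf (S x) <= r.
  by move=> Sr; apply: inf_lbound => //; exists (b x) => z; exact: bS.
have infge c x : (forall r, S x r -> c <= r) -> c <= inf (S x).
  by move=> H; apply: lb_le_inf.
have half (t : R) x : 0 < t -> inf (S (t%:C *: x)) <= t * inf (S x).
  move=> t0; rewrite -ler_pdivrMl//; apply: (infge _ _) => r Sr.
  have [r' Sr' Hr'] := SZ t x r t0 Sr.
  by rewrite ler_pdivrMl// (le_trans _ Hr')// infle.
split=> [x y|t x] /=.
  rewrite -lerBlDr; apply: (infge _ _) => r Sr; rewrite lerBlDr -lerBlDl.
  apply: (infge _ _) => r' Sr'; have [r'' Sr'' H] := SD x y r r' Sr Sr'.
  by rewrite lerBlDl (le_trans _ H)// infle.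
rewrite le_eqVlt => /predU1P[<-|t0].
  rewrite scale0r mul0r; apply/eqP; rewrite eq_le; apply/andP; split.
    apply/ler_addgt0Pr => d d0; have [r Sr Hr] := S0e d d0.
    by rewrite add0r (le_trans _ Hr)// infle.
  by apply: (infge _ _).
apply/eqP; rewrite eq_le half//= -ler_pdivlMl//.
have := half t^-1 (t%:C *: x); rewrite invr_gt0 => /(_ t0).
by rewrite scalerA -rmorphM mulVf ?gt_eqF// scale1r.
Qed.

Lemma sublinear_inf (I : Type) (D : set I) (P : I -> U -> R) (b : U -> R) :
  D !=set0 -> (forall i x, D i -> b x <= P i x) ->
  (forall i (t : R) x, D i -> 0 < t -> exists2 j, D j & P j (t%:C *: x) <= t * P i x) ->
  (forall i j x y, D i -> D j -> exists2 k, D k & P k (x + y) <= P i x + P j y) ->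
  (forall i, D i -> 0 <= P i 0) -> (forall e, 0 < e -> exists2 i, D i & P i 0 <= e) ->
  sublinear (fun x => inf [set P i x | i in D]).
Proof.
move=> [i0 Di0] bP PZ PD P0 Pe; apply: (@sublinear_infimum _ b).
- by move=> x; exists (P i0 x), i0.
- by move=> x _ [i Di <-]; exact: bP.
- move=> t x _ t0 [i Di <-]; have [j Dj Hj] := PZ i t x Di t0.
  by exists (P j (t%:C *: x)) => //; exists j.
- move=> x y _ _ [i Di <-] [j Dj <-]; have [k Dk Hk] := PD i j x y Di Dj.
  by exists (P k (x + y)) => //; exists k.
- by move=> _ [i Di <-]; exact: P0.
- by move=> e e0; have [i Di Hi] := Pe e e0; exists (P i 0) => //; exists i.
Qed.

(** For fixed [w], the infimum over [s >= 0] of [q (x + s w) - s q w] is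
    sublinear and below [q], hence equal to [q], and [s = 1] gives
    [q x + q w <= q (x + w)]. *)
Lemma minimal_sublinear_additive q : sublinear q ->
  (forall q', sublinear q' -> (forall x, q' x <= q x) -> forall x, q' x = q x) ->
  forall x w, q (x + w) = q x + q w.
Proof.
move=> qs qmin x w; have [qD qZ] := qs.
pose D := [set s : R | 0 <= s].
pose P (s : R) (x : U) := q (x + s%:C *: w) - s * q w.
have lbP s y : 0 <= s -> - q (- y) <= P s y.
  move=> s0; rewrite /P; have := qD (y + s%:C *: w) (- y).
  by rewrite addrAC subrr add0r qZ//; lra.
have Ps : sublinear (fun x => inf [set P s x | s in D]).
  apply: (@sublinear_inf _ _ _ (fun x => - q (- x))).
  - by exists 0; rewrite /D/=.
  - exact: lbP.
  - move=> s t y s0 t0; exists (t * s); first exact: mulr_ge0 (ltW t0) s0.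
    rewrite /P rmorphM -scalerA -scalerDr qZ ?(ltW t0)//.
    by rewrite mulrBr mulrA.
  - move=> s t y z s0 t0; exists (s + t); first exact: addr_ge0.
    have := qD (y + s%:C *: w) (z + t%:C *: w).
    by rewrite /P rmorphD scalerDl addrACA; lra.
  - by move=> s s0; rewrite /P add0r qZ// subrr.
  - move=> d d0; exists 0; first by rewrite /D/=.
    by rewrite /P add0r scale0r sublinear0// mul0r subrr ltW.
have lb y : has_lbound [set P s y | s in D].
  by exists (- q (- y)) => _ [s s0 <-]; exact: lbP.
have Pq y : inf [set P s y | s in D] <= q y.
  apply: (inf_lbound (lb y)); exists 0; first by rewrite /D/=.
  by rewrite /P scale0r addr0 mul0r subr0.
apply/eqP; rewrite eq_le qD/= -lerBrDr -(qmin _ Ps Pq x).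
apply: (inf_lbound (lb x)); exists 1; first by rewrite /D/=.
by rewrite /P scale1r mul1r.
Qed.

(** Zorn's lemma for the sublinear functionals below [p], ordered downwards:
    the pointwise infimum of a chain is sublinear, and a minimal element is
    additive by [minimal_sublinear_additive]. *)
Lemma hahn_banach_real p : sublinear p -> exists l : U -> R,
  [/\ forall x, l x <= p x, forall x y, l (x + y) = l x + l y &
      forall (t : R) x, l (t%:C *: x) = t * l x].
Proof.
move=> ps.
pose T := {q : U -> R | sublinear q /\ forall x, q x <= p x}.
pose le (q r : T) := `[< forall x, sval r x <= sval q x >].
have [||||q qmin] := @Zorn T le.
- by move=> t; apply/asboolP.
- move=> r s t /asboolP rs /asboolP st; apply/asboolP => x.
  exact: le_trans (st x) (rs x).
- move=> [s ?] [t ?] /asboolP/= st /asboolP/= ts.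
  apply: eq_exist; apply/funext => x; apply/eqP; by rewrite eq_le st ts.
- move=> A Atot; have [[a0 Aa0]|A0] := pselect (A !=set0); last first.
    have pp : sublinear p /\ forall x, p x <= p x by [].
    by exists (exist _ p pp) => s As; exfalso; apply: A0; exists s.
  pose b x := - p (- x).
  have lbA (a : T) x : b x <= sval a x.
    case: a => q [qs qp]/=; rewrite (le_trans _ (sublinear_geN qs x))//.
    by rewrite lerN2 qp.
  pose q x := inf [set sval a x | a in A].
  have lb x : has_lbound [set sval a x | a in A].
    by exists (b x) => _ [a _ <-].
  have qs : sublinear q.
    apply: (@sublinear_inf _ _ _ b).
    - by exists a0.
    - by move=> a x _; exact: lbA.
    - move=> a t x Aa t0; exists a => //; have [_ ->//] := (svalP a).1.
      exact: ltW.
    - move=> a c x y Aa Ac.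
      case: (Atot a c Aa Ac) => /asboolP ac.
        by exists c => //; rewrite (le_trans ((svalP c).1.1 x y))// lerD2r ac.
      by exists a => //; rewrite (le_trans ((svalP a).1.1 x y))// lerD2l ac.
    - by move=> a Aa; rewrite (sublinear0 (svalP a).1).
    - by move=> d d0; exists a0 => //; rewrite (sublinear0 (svalP a0).1) ltW.
  have qp : sublinear q /\ forall x, q x <= p x.
    split=> // x; rewrite (le_trans _ ((svalP a0).2 x))//.
    by apply: (inf_lbound (lb x)); exists a0.
  exists (exist _ q qp) => a Aa; apply/asboolP => x /=.
  by apply: (inf_lbound (lb x)); exists a.
case: q qmin => q [qs qp] qmin.
have qadd : forall x w, q (x + w) = q x + q w.
  apply: minimal_sublinear_additive => // q' q's q'q x.
  have q'p : sublinear q' /\ forall x, q' x <= p x.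
    by split=> // y; apply: le_trans (qp y).
  have := qmin (exist _ q' q'p); rewrite /le/= => /(_ _)/(f_equal sval)/= -> //.
  exact/asboolP.
exists q; split=> // t x; have [_ qZ] := qs.
have q0 := sublinear0 qs.
have qN y : q (- y) = - q y.
  by apply/eqP; rewrite -addr_eq0 -qadd addNr q0.
have [t0|/ltW t0] := leP 0 t; first exact: qZ.
rewrite -[in LHS](opprK t) rmorphN scaleNr qN qZ ?oppr_ge0//.
by rewrite mulNr opprK.
Qed.

(** The real functional [l] of [hahn_banach_real] is the real part of the
    complex-linear functional [x |-> l x - i l (i x)]. *)
Theorem hahn_banach p : sublinear p ->
  exists phi : U -> C, (forall (c : C) x y, phi (c *: x + y) = c * phi x + phi y) /\
    forall x, Re (phi x) <= p x.
Proof.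
move=> /hahn_banach_real[l [lp lD lZ]].
have lN x : l (- x) = - l x.
  by have := lZ (-1) x; rewrite rmorphN scaleN1r mulN1r.
exists (fun x => (l x) -i* (l ('i *: x))); split=> [c x y|x]; last exact: lp.
have E (z : C) u : l (z *: u) = Re z * l u + Im z * l ('i *: u).
  by rewrite {1}[z]complexE mulrC scalerDl -scalerA lD !lZ.
rewrite scalerDr scalerA !lD (E c) (E ('i * c)).
case: c {E} => a b.
by apply/eqP; rewrite eq_complex/=; apply/andP; split; apply/eqP; ring.
Qed.

End HahnBanach.

(** * Complex numbers *)

Section ComplexNumbers.
Variable R : realType.
Local Notation C := R[i].
Implicit Types x y z : C.

Lemma half_plus_half : 2^-1 + 2^-1 = 1 :> R. Proof. by field. Qed.

Lemma conjE z : z^*%R = Re z -i* Im z. Proof. by case: z. Qed.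
Lemma creD x y : Re (x + y) = Re x + Re y. Proof. by case: x; case: y. Qed.
Lemma cimD x y : Im (x + y) = Im x + Im y. Proof. by case: x; case: y. Qed.
Lemma creN x : Re (- x) = - Re x. Proof. by case: x. Qed.
Lemma cimN x : Im (- x) = - Im x. Proof. by case: x. Qed.
Lemma creM x y : Re (x * y) = Re x * Re y - Im x * Im y.
Proof. by case: x; case: y. Qed.
Lemma cimM x y : Im (x * y) = Re x * Im y + Im x * Re y.
Proof. by case: x => a b; case: y => c d. Qed.
Lemma creJ z : Re z^*%R = Re z. Proof. by case: z. Qed.
Lemma cimJ z : Im z^*%R = - Im z. Proof. by case: z. Qed.
Lemma conjR (t : R) : (t%:C)^*%R = t%:C.
Proof. by rewrite conjE /= oppr0. Qed.
Lemma creZ (t : R) z : Re (t%:C * z) = t * Re z.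
Proof. by rewrite creM/= mul0r subr0. Qed.
Lemma Re_sum I (r : seq I) (P : pred I) (F : I -> C) :
  Re (\sum_(i <- r | P i) F i) = \sum_(i <- r | P i) Re (F i).
Proof. exact: (big_morph _ creD). Qed.
Lemma complex_ext x y : Re x = Re y -> Im x = Im y -> x = y.
Proof. by case: x; case: y => a b c d /= -> ->. Qed.

Lemma normc_ge0 z : 0 <= normc z. Proof. by case: z => a b; exact: sqrtr_ge0. Qed.
Lemma sqr_normcE z : normc z ^+ 2 = Re z ^+ 2 + Im z ^+ 2.
Proof. by case: z => a b /=; rewrite sqr_sqrtr// addr_ge0// sqr_ge0. Qed.
Lemma cnormJ z : normc z^*%R = normc z.
Proof. by case: z => a b /=; rewrite sqrrN. Qed.
Lemma normcR (t : R) : normc t%:C = `|t|.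
Proof. by rewrite /= expr0n addr0 sqrtr_sqr. Qed.
Lemma normc_le z (t : R) : 0 <= t -> (normc z <= t) = (Re z ^+ 2 + Im z ^+ 2 <= t ^+ 2).
Proof. by move=> t0; rewrite -sqr_normcE ler_sqr// nnegrE normc_ge0. Qed.
Lemma sqr_normcR (t : R) : normc t%:C ^+ 2 = t ^+ 2.
Proof. by rewrite sqr_normcE /= expr0n addr0. Qed.
Lemma normcB x y : normc (x - y) = normc (y - x).
Proof. by rewrite -normcN opprB. Qed.
Lemma normc_leD z : normc z <= `|Re z| + `|Im z|.
Proof.
rewrite normc_le ?addr_ge0// sqrrD !real_normK ?num_real// [X in _ <= X]addrAC lerDl.
by rewrite mulrn_wge0// mulr_ge0.
Qed.
Lemma mulcJ z : z * z^*%R = (normc z ^+ 2)%:C.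
Proof. by rewrite sqr_normcE; apply: complex_ext; rewrite ?creM ?cimM creJ cimJ/=; ring. Qed.
Lemma normr_Re_le z : `|Re z| <= normc z.
Proof.
rewrite -ler_sqr ?nnegrE ?normc_ge0// real_normK ?num_real//.
by rewrite sqr_normcE lerDl sqr_ge0.
Qed.
Lemma normr_Im_le z : `|Im z| <= normc z.
Proof.
rewrite -ler_sqr ?nnegrE ?normc_ge0// real_normK ?num_real//.
by rewrite sqr_normcE lerDr sqr_ge0.
Qed.
Lemma Re_le_normc z : Re z <= normc z.
Proof. exact: le_trans (ler_norm _) (normr_Re_le z). Qed.
Lemma normci : normc ('i : C) = 1.
Proof. by rewrite /= expr0n add0r expr1n sqrtr1. Qed.
Lemma phase z : exists2 u, normc u = 1 & u * z = (normc z)%:C.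
Proof.
have [->|z0] := eqVneq z 0.
  by exists 1; rewrite ?Normc.normc1// mulr0 Normc.normc0.
have n0 : normc z != 0 by apply: contra_neq z0 => /Normc.eq0_normc.
exists (z^*%R * (normc z)^-1%:C).
  by rewrite Normc.normcM cnormJ normcR ger0_norm ?invr_ge0 ?normc_ge0// mulfV.
rewrite mulrAC [_^* * z]mulrC mulcJ.
by rewrite -rmorphM/= expr2 -mulrA mulfV// mulr1.
Qed.
Lemma ge0_cE z : 0 <= Re z -> Im z = 0 -> 0 <= z.
Proof. by case: z => a b /= a0 ->; rewrite lecE/= eqxx. Qed.
Lemma ge0_Re z : 0 <= z -> 0 <= Re z.
Proof. by rewrite lecE => /andP[]. Qed.
Lemma ge0_Im z : 0 <= z -> Im z = 0.
Proof. by rewrite lecE => /andP[/eqP]. Qed.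

End ComplexNumbers.

(** * The Hilbert-Schmidt inner product and the operator norm *)

Section HilbertSchmidt.
Variable R : realType.
Local Notation C := R[i].

(** The Hilbert-Schmidt inner product and the squared Frobenius norm; on
    columns these are the usual inner product and the square of [l2norm]. *)
Definition hs m n (X Y : 'M[C]_(m, n)) : C := \tr (X^t* *m Y).
Definition fro2 m n (X : 'M[C]_(m, n)) : R := Re (hs X X).

Lemma hadj_mul m n p (A : 'M[C]_(m, n)) (B : 'M[C]_(n, p)) :
  (A *m B)^t* = B^t* *m A^t*.
Proof. by rewrite trmx_mul map_mxM. Qed.

Lemma hadjD m n (A B : 'M[C]_(m, n)) : (A + B)^t* = A^t* + B^t*.
Proof. by apply/matrixP => i j; rewrite !mxE rmorphD. Qed.

Lemma hadjZ m n c (A : 'M[C]_(m, n)) : (c *: A)^t* = c^*%R *: A^t*.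
Proof. by apply/matrixP => i j; rewrite !mxE rmorphM. Qed.

Lemma hadj1 n : (1%:M : 'M[C]_n)^t* = 1%:M.
Proof. by apply/matrixP => i j; rewrite !mxE eq_sym; case: (i == j); rewrite ?rmorph1 ?rmorph0. Qed.

Lemma hsE m n (X Y : 'M[C]_(m, n)) :
  hs X Y = \sum_i \sum_j (X i j)^*%R * Y i j.
Proof.
rewrite exchange_big; apply: eq_bigr => j _; rewrite mxE.
by apply: eq_bigr => i _; rewrite !mxE.
Qed.

Lemma hsDr m n (X Y Z : 'M[C]_(m, n)) : hs X (Y + Z) = hs X Y + hs X Z.
Proof. by rewrite /hs mulmxDr linearD. Qed.
Lemma hsZr m n c (X Y : 'M[C]_(m, n)) : hs X (c *: Y) = c * hs X Y.
Proof. by rewrite /hs -scalemxAr linearZ. Qed.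
Lemma hsC m n (X Y : 'M[C]_(m, n)) : hs Y X = (hs X Y)^*%R.
Proof.
rewrite !hsE rmorph_sum; apply: eq_bigr => i _; rewrite rmorph_sum.
by apply: eq_bigr => j _; rewrite rmorphM /= conjCK mulrC.
Qed.
Lemma hsDl m n (X Y Z : 'M[C]_(m, n)) : hs (X + Y) Z = hs X Z + hs Y Z.
Proof. by rewrite hsC hsDr rmorphD /= -!hsC. Qed.
Lemma hsZl m n c (X Y : 'M[C]_(m, n)) : hs (c *: X) Y = c^*%R * hs X Y.
Proof. by rewrite hsC hsZr rmorphM /= -!hsC. Qed.
Lemma hs_mull m n p (X : 'M[C]_(m, n)) (A : 'M[C]_(m, p)) (Y : 'M[C]_(p, n)) :
  hs X (A *m Y) = hs (A^t* *m X) Y.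
Proof. by rewrite /hs hadj_mul trmxCK mulmxA. Qed.

Lemma fro2E m n (X : 'M[C]_(m, n)) : fro2 X = \sum_i \sum_j normc (X i j) ^+ 2.
Proof.
rewrite /fro2 hsE Re_sum; apply: eq_bigr => i _; rewrite Re_sum.
by apply: eq_bigr => j _; rewrite sqr_normcE creM creJ cimJ; ring.
Qed.
Lemma fro2_ge0 m n (X : 'M[C]_(m, n)) : 0 <= fro2 X.
Proof. by rewrite fro2E; do 2!apply: sumr_ge0 => ? _; exact: sqr_ge0. Qed.
Lemma fro2_eq0 m n (X : 'M[C]_(m, n)) : fro2 X = 0 -> X = 0.
Proof.
move=> /eqP x0; apply/matrixP => i j; rewrite mxE; apply: Normc.eq0_normc; apply/eqP.
rewrite -sqrf_eq0; move: x0; rewrite fro2E psumr_eq0 => [|k _]; last first.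
  by apply: sumr_ge0 => ? _; exact: sqr_ge0.
move/allP => /(_ i (mem_index_enum _)) /=.
by rewrite psumr_eq0 => [/allP/(_ j (mem_index_enum _))//|k _]; exact: sqr_ge0.
Qed.
Lemma fro2_tr m n (X : 'M[C]_(m, n)) : fro2 X^T = fro2 X.
Proof.
rewrite !fro2E exchange_big; apply: eq_bigr => i _; apply: eq_bigr => j _.
by rewrite mxE.
Qed.
Lemma fro2_adj m n (X : 'M[C]_(m, n)) : fro2 (X^t* ) = fro2 X.
Proof.
rewrite -[RHS]fro2_tr !fro2E; apply: eq_bigr => i _; apply: eq_bigr => j _.
by rewrite mxE cnormJ.
Qed.
Lemma fro2Z m n c (X : 'M[C]_(m, n)) : fro2 (c *: X) = normc c ^+ 2 * fro2 X.
Proof.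
by rewrite /fro2 hsZr hsZl mulrA mulcJ creZ.
Qed.
Lemma Re_hsZl m n (t : R) (X Y : 'M[C]_(m, n)) :
  Re (hs (t%:C *: X) Y) = t * Re (hs X Y).
Proof. by rewrite hsZl conjR creZ. Qed.
Lemma fro2B m n (X Y : 'M[C]_(m, n)) :
  fro2 (X - Y) = fro2 X + fro2 Y - 2 * Re (hs X Y).
Proof.
rewrite /fro2 -scaleN1r hsDr !hsDl !hsZr !hsZl (hsC X Y) !creD.
rewrite rmorphN rmorph1 !mulN1r opprK !creN creJ.
by move: (Re (hs X X)) (Re (hs X Y)) (Re (hs Y Y)) => a b c; ring.
Qed.
Lemma hs_amgm m n (X Y : 'M[C]_(m, n)) (M : R) : 0 < M ->
  2 * Re (hs X Y) <= M * fro2 X + fro2 Y / M.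
Proof.
move=> M0; have := fro2_ge0 (M%:C *: X - Y).
rewrite fro2B fro2Z normcR gtr0_norm// Re_hsZl => H.
rewrite -(ler_pM2l M0); apply: le_trans (_ : M ^+ 2 * fro2 X + fro2 Y <= _).
  by rewrite mulrA; move: H; move: (fro2 X) (fro2 Y) (Re _) => a b c; lra.
by rewrite mulrDr !mulrA expr2 [M * _ / M]mulrAC divff ?gt_eqF// mul1r.
Qed.

Lemma l2normE n (x : 'cV[C]_n) : l2norm x = Num.sqrt (fro2 x).
Proof. by rewrite /l2norm fro2E; congr Num.sqrt; apply: eq_bigr => i _; rewrite big_ord1. Qed.

Lemma opnorm_sup m n (A : 'M[C]_(m, n)) :
  has_sup [set l2norm (A *m x) | x in [set x | l2norm x <= 1]].
Proof.
split.
  by exists (l2norm (A *m 0)); exists 0 => //=; rewrite l2normE /fro2 /hs mulmx0 mxtrace0 sqrtr0.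
exists (Num.sqrt (\sum_i (\sum_j normc (A i j)) ^+ 2)) => _ [x /= x1 <-].
rewrite l2normE ler_sqrt; last by apply: sumr_ge0 => i _; exact: sqr_ge0.
rewrite fro2E; apply: ler_sum => i _; rewrite big_ord1.
have le_sum_normc (r : seq 'I_n) (F : 'I_n -> C) : normc (\sum_(j <- r) F j) <= \sum_(j <- r) normc (F j).
  elim: r => [|j r IH]; first by rewrite !big_nil Normc.normc0.
  by rewrite !big_cons (le_trans (le_normcD _ _))// lerD2l.
rewrite ler_sqr ?nnegrE ?normc_ge0//; last by apply: sumr_ge0 => ? _; exact: normc_ge0.
rewrite mxE (le_trans (le_sum_normc _ _))//; apply: ler_sum => j _.
rewrite Normc.normcM ler_piMr ?normc_ge0//.
have : fro2 x <= 1.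
  by move: x1; rewrite l2normE -[X in _ <= X]sqrtr1 ler_sqrt.
rewrite fro2E (bigD1 j)//= big_ord1 => x1'.
rewrite -[X in _ <= X](expr1n _ 2) -ler_sqr ?nnegrE ?normc_ge0// in x1' *.
apply: le_trans x1'; rewrite lerDl; apply: sumr_ge0 => k _.
by rewrite big_ord1 sqr_ge0.
Qed.

Lemma opnorm_ge0 m n (A : 'M[C]_(m, n)) : 0 <= opnorm A.
Proof.
have l0 : l2norm (0 : 'cV[C]_n) <= 1.
  by rewrite l2normE /fro2 /hs mulmx0 mxtrace0 sqrtr0.
have H : l2norm (A *m 0) <= opnorm A.
  by apply: (sup_upper_bound (opnorm_sup A)); exists 0.
by apply: le_trans H; exact: sqrtr_ge0.
Qed.

Lemma fro2_mul_opnorm m n (A : 'M[C]_(m, n)) (x : 'cV[C]_n) :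
  fro2 (A *m x) <= opnorm A ^+ 2 * fro2 x.
Proof.
have [x0|x0] := eqVneq (fro2 x) 0.
  by rewrite (fro2_eq0 x0) /fro2 /hs !mulmx0 mxtrace0 mulr0.
have xp : 0 < fro2 x by rewrite lt_neqAle eq_sym x0 fro2_ge0.
pose s := Num.sqrt (fro2 x); have s0 : 0 < s by rewrite sqrtr_gt0.
have n1 : normc (s^-1)%:C ^+ 2 * fro2 x = 1.
  by rewrite normcR ger0_norm ?invr_ge0 ?ltW// exprVn sqr_sqrtr ?mulVf// ltW.
have : l2norm (A *m ((s^-1)%:C *: x)) <= opnorm A.
  apply: (sup_upper_bound (opnorm_sup A)); exists ((s^-1)%:C *: x) => //=.
  by rewrite l2normE fro2Z n1 sqrtr1.
rewrite -ler_sqr ?nnegrE ?sqrtr_ge0 ?opnorm_ge0// l2normE sqr_sqrtr ?fro2_ge0//.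
rewrite -scalemxAr fro2Z => /(ler_wpM2r (fro2_ge0 x)).
by rewrite mulrAC n1 mul1r.
Qed.

(** By the inequality of arithmetic and geometric means one way, and at [x]
    proportional to [A y] the other way. It turns norm estimates into
    inequalities between quadratic forms, which add up. *)
Lemma opnorm_leP m n (A : 'M[C]_(m, n)) (M : R) : 0 <= M ->
  opnorm A <= M <->
  (forall (x : 'cV[C]_m) (y : 'cV[C]_n),
     2 * Re (hs x (A *m y)) <= M * (fro2 x + fro2 y)).
Proof.
move=> M0; split=> [AM x y|H].
  have Ay : fro2 (A *m y) <= M ^+ 2 * fro2 y.
    apply: le_trans (fro2_mul_opnorm _ _) _; rewrite ler_wpM2r ?fro2_ge0//.
    by rewrite ler_sqr ?nnegrE ?opnorm_ge0.
  move: M0; rewrite le_eqVlt => /predU1P[M0|M0].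
    rewrite -M0 expr0n mul0r in Ay; rewrite -M0 mul0r.
    apply/ler_addgt0Pr => d d0; rewrite add0r.
    pose e := d / (fro2 x + 1).
    have e0 : 0 < e by rewrite divr_gt0// ltr_wpDl ?fro2_ge0.
    apply: le_trans (hs_amgm x (A *m y) e0) _.
    have -> : fro2 (A *m y) = 0 by apply/eqP; rewrite eq_le Ay fro2_ge0.
    rewrite mul0r addr0 /e mulrAC ler_pdivrMr; last by rewrite ltr_wpDl ?fro2_ge0.
    by rewrite ler_pM2l// lerDl.
  apply: le_trans (hs_amgm x (A *m y) M0) _.
  by rewrite mulrDr lerD2l ler_pdivrMr// mulrC mulrA -expr2.
apply: ge_sup; first exact: (opnorm_sup A).1.
move=> _ [y /= y1 <-].
have y1' : fro2 y <= 1.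
  by move: y1; rewrite l2normE -[X in _ <= X]sqrtr1 ler_sqrt.
rewrite l2normE -(ger0_norm M0) -sqrtr_sqr ler_sqrt ?sqr_ge0//.
set f := fro2 (A *m y).
have f0 : 0 <= f by exact: fro2_ge0.
have K (s : R) : 2 * s * f <= M * (s ^+ 2 * f + fro2 y).
  have := H (s%:C *: (A *m y)) y.
  rewrite fro2Z sqr_normcR Re_hsZl.
  by rewrite mulrA.
move: M0; rewrite le_eqVlt => /predU1P[M0|M0].
  by have := K 1; rewrite -M0 expr0n /= !mul0r; lra.
have := K M^-1; rewrite -(ler_pM2l M0) => Ks.
apply: (@le_trans _ _ (M ^+ 2 * fro2 y)); last by rewrite ler_piMr ?sqr_ge0.
have E1 : M * (2 * M^-1 * f) = 2 * f by field; rewrite gt_eqF.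
have E2 : M * (M * (M^-1 ^+ 2 * f + fro2 y)) = f + M ^+ 2 * fro2 y by field; rewrite gt_eqF.
by rewrite E1 E2 in Ks; lra.
Qed.

End HilbertSchmidt.

(** * Quadratic forms of block matrices and of matrices of families *)

Section BlockForms.
Variable R : realType.
Local Notation C := R[i].

(** The quadratic form of a matrix of matrices, on vectors arranged as
    matrices so that no flattening appears in what follows. *)
Definition blockform r n (A : 'M['M[C]_n]_r) (X Y : 'M[C]_(r, n)) : C :=
  \sum_k \sum_l \sum_i \sum_j (X k i)^*%R * A k l i j * Y l j.

Definition blockcol r n (X : 'M[C]_(r, n)) : 'cV[C]_(\sum_(i < r) n) :=
  \col_s X (tagnat.sig1 s) (tagnat.sig2 s).

Lemma sum_tagnat r n (F : 'I_r -> 'I_n -> C) :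
  \sum_(s < \sum_(i < r) n) F (tagnat.sig1 s) (tagnat.sig2 s) =
  \sum_k \sum_i F k i.
Proof. by rewrite sig_big_dep/= (reindex _ tagnat.sig_bij_on). Qed.

Lemma blockcol_surj r n (x : 'cV[C]_(\sum_(i < r) n)) : exists X, x = blockcol X.
Proof.
exists (\matrix_(k, i) x (@tagnat.Rank r (fun=> n) k i) 0).
by apply/matrixP => s j; rewrite !mxE tagnat.sig2K ord1.
Qed.

Lemma hs_blockcol r n (A : 'M['M[C]_n]_r) (X Y : 'M[C]_(r, n)) :
  hs (blockcol X) (flatmx A *m blockcol Y) = blockform A X Y.
Proof.
rewrite hsE /blockform.
transitivity (\sum_(s < \sum_(i < r) n)
  (X (tagnat.sig1 s) (tagnat.sig2 s))^*%R *
  \sum_l \sum_j A (tagnat.sig1 s) l (tagnat.sig2 s) j * Y l j).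
  apply: eq_bigr => s _; rewrite big_ord1 !mxE; congr (_ * _).
  rewrite -(sum_tagnat (fun l j => A (tagnat.sig1 s) l (tagnat.sig2 s) j * Y l j)).
  by apply: eq_bigr => u _; rewrite !mxE.
rewrite (sum_tagnat (fun k i => (X k i)^*%R * \sum_l \sum_j A k l i j * Y l j)).
apply: eq_bigr => k _; rewrite exchange_big; apply: eq_bigr => i _.
rewrite mulr_sumr; apply: eq_bigr => l _; rewrite mulr_sumr.
by apply: eq_bigr => j _; rewrite mulrA.
Qed.

Lemma fro2_blockcol r n (X : 'M[C]_(r, n)) : fro2 (blockcol X) = fro2 X.
Proof.
rewrite /fro2 !hsE -(sum_tagnat (fun k i => (X k i)^*%R * X k i)).
by congr Re; apply: eq_bigr => s _; rewrite big_ord1 !mxE.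
Qed.

Lemma psdE n (A : 'M[C]_n) : psd A <-> forall x : 'cV[C]_n, 0 <= hs x (A *m x).
Proof.
have E (x : 'cV_n) : (x^t* *m A *m x) 0 0 = hs x (A *m x).
  by rewrite /hs -trace_mx11 mulmxA.
by split=> H x; have := H x; rewrite E.
Qed.

Lemma psd_flatP r n (A : 'M['M[C]_n]_r) :
  psd (flatmx A) <-> forall X, 0 <= blockform A X X.
Proof.
rewrite psdE; split=> [H X|H x]; first by rewrite -hs_blockcol.
by have [X ->] := blockcol_surj x; rewrite hs_blockcol.
Qed.

Lemma opnorm_flatP r n (A : 'M['M[C]_n]_r) (M : R) : 0 <= M ->
  opnorm (flatmx A) <= M <->
  forall X Y, 2 * Re (blockform A X Y) <= M * (fro2 X + fro2 Y).
Proof.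
move=> M0; rewrite opnorm_leP//; split=> [H X Y|H x y].
  by rewrite -hs_blockcol -(fro2_blockcol X) -(fro2_blockcol Y).
have [X ->] := blockcol_surj x; have [Y ->] := blockcol_surj y.
by rewrite hs_blockcol !fro2_blockcol.
Qed.

End BlockForms.

Section SharpNorm.
Variables (R : realType) (W : lmodType R[i]).
Local Notation C := R[i].
Variable S : forall n, set 'M[W]_n.

Definition famform r (F : 'M[fam W]_r) n (v : 'M[W]_n) (X Y : 'M[C]_(n, r)) : C :=
  \sum_k \sum_l \sum_i \sum_j (X k i)^*%R * F i j n v k l * Y l j.

(** The real part of the form of the block matrix at [(X, - Y)] is
    [t (|X|^2 + |Y|^2)] minus twice the real part of the off-diagonal form. *)
Lemma fam_posP r (F : 'M[fam W]_r) (t : R) :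
  fam_pos S (block_mx (mscale t%:C (mxunit (fam_one (W:=W)) r)) F
    (mxstar (@fam_star R W) F) (mscale t%:C (mxunit (fam_one (W:=W)) r))) <->
  forall n (v : 'M[W]_n), S v -> forall X Y,
    2 * Re (famform F v X Y) <= t * (fro2 X + fro2 Y).
Proof.
set B := block_mx _ _ _ _.
have one n (v : 'M[W]_n) (X : 'M[C]_(n, r)) :
    \sum_k \sum_l \sum_i \sum_j (X k i)^*%R *
      mscale t%:C (mxunit (fam_one (W:=W)) r) i j n v k l * X l j = t%:C * hs X X.
  rewrite hsE mulr_sumr; apply: eq_bigr => k _.
  rewrite (bigD1 k)//= [X in _ + X]big1 ?addr0 => [|l lk]; last first.
    apply: big1 => i _; apply: big1 => j _; rewrite !mxE.
    by rewrite [k == l]eq_sym (negbTE lk) !mulr0 mul0r.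
  rewrite mulr_sumr; apply: eq_bigr => i _.
  rewrite (bigD1 i)//= [X in _ + X]big1 ?addr0 => [|j ji]; last first.
    by rewrite !mxE [i == j]eq_sym (negbTE ji) mul0r !mulr0 mul0r.
  by rewrite !mxE !eqxx !mulr1 mulrAC mulrC.
have adj n (v : 'M[W]_n) (X Y : 'M[C]_(n, r)) :
    \sum_k \sum_l \sum_i \sum_j (Y k i)^*%R *
      mxstar (@fam_star R W) F i j n v k l * X l j = (famform F v X Y)^*%R.
  rewrite /famform rmorph_sum [RHS]/=.
  under [RHS]eq_bigr => k _ do rewrite rmorph_sum /=.
  rewrite exchange_big; apply: eq_bigr => k _; apply: eq_bigr => l _.
  rewrite rmorph_sum exchange_big; apply: eq_bigr => i _ /=.
  rewrite rmorph_sum; apply: eq_bigr => j _ /=.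
  rewrite (_ : mxstar _ F j i n v l k = (F i j n v k l)^*%R).
    by rewrite !rmorphM /= conjCK mulrC [_ * (F _ _ _ _ _ _)^*%R]mulrC mulrA.
  by rewrite !mxE.
have E n (v : 'M[W]_n) (X Y : 'M[C]_(n, r)) :
    blockform (\matrix_(k < n, l < n) \matrix_(i < r + r, j < r + r) B i j n v k l)
      (row_mx X Y) (row_mx X Y) =
    t%:C * hs X X + famform F v X Y + ((famform F v X Y)^*%R + t%:C * hs Y Y).
  rewrite -!(one _ v) -adj /blockform /famform -!big_split; apply: eq_bigr => k _.
  rewrite -!big_split; apply: eq_bigr => l _.
  rewrite /= big_split_ord /=; congr (_ + _);
    rewrite -big_split; apply: eq_bigr => i _;
    rewrite big_split_ord /=; congr (_ + _); apply: eq_bigr => j _;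
    by rewrite mxE [X in _ * X * _]mxE ?row_mxEl ?row_mxEr
      ?block_mxEul ?block_mxEur ?block_mxEdl ?block_mxEdr.
have Re_tot n (v : 'M[W]_n) (X Y : 'M[C]_(n, r)) :
    Re (t%:C * hs X X + famform F v X Y + ((famform F v X Y)^*%R + t%:C * hs Y Y)) =
    t * (fro2 X + fro2 Y) + 2 * Re (famform F v X Y).
  rewrite !creD !creZ creJ /fro2.
  by move: (Re (hs X X)) (Re (hs Y Y)) (Re _) => a b c; ring.
have famN n (v : 'M[W]_n) (X Y : 'M[C]_(n, r)) :
    famform F v X (- Y) = - famform F v X Y.
  rewrite /famform; do 4![rewrite -sumrN; apply: eq_bigr => ? _].
  by rewrite mxE mulrN.
split=> [H n v Sv X Y|H n v Sv].
  have /psd_flatP/(_ (row_mx X (- Y))) := H n v Sv.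
  rewrite E => /ge0_Re; rewrite Re_tot famN creN.
  rewrite (_ : fro2 (- Y) = fro2 Y).
    by move: (fro2 X) (fro2 Y) (Re _) => a b c; lra.
  by rewrite -scaleN1r fro2Z -(rmorphN1 (real_complex R)) sqr_normcR sqrrN expr1n mul1r.
apply/psd_flatP => Z; rewrite -[Z]hsubmxK E; apply: ge0_cE.
  rewrite Re_tot; have := H n v Sv (lsubmx Z) (- rsubmx Z).
  rewrite famN creN (_ : fro2 (- rsubmx Z) = fro2 (rsubmx Z)).
    by move: (fro2 _) (fro2 _) (Re _) => a b c; lra.
  by rewrite -scaleN1r fro2Z -(rmorphN1 (real_complex R)) sqr_normcR sqrrN expr1n mul1r.
have Im_hs m p (Q : 'M[C]_(m, p)) : Im (hs Q Q) = 0.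
  by have := congr1 (@complex.Im R) (hsC Q Q); rewrite cimJ; lra.
by rewrite !cimD !cimM !Im_hs cimJ /= !mulr0 !mul0r; lra.
Qed.

End SharpNorm.

(** * Linear functionals and matrices over a module *)

Section LinearFunctionals.
Variables (R : realType) (T : lmodType R[i]) (f : T -> R[i]).
Local Notation C := R[i].
Hypothesis flin : forall (c : C) x y, f (c *: x + y) = c * f x + f y.

Lemma lin0 : f 0 = 0.
Proof. by have := flin (-1) 0 0; rewrite scaler0 addr0 mulN1r addNr. Qed.

Lemma linZ c x : f (c *: x) = c * f x.
Proof. by have := flin c x 0; rewrite !addr0 lin0 addr0. Qed.

Lemma linN x : f (- x) = - f x.
Proof. by rewrite -scaleN1r linZ mulN1r. Qed.

Lemma big_lin I (r : seq I) (c : I -> C) (u : I -> T) :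
  f (\sum_(i <- r) c i *: u i) = \sum_(i <- r) c i * f (u i).
Proof. by elim: r => [|i r IH]; rewrite ?big_nil ?lin0// !big_cons flin IH. Qed.

Lemma big_lin2 m n (c : 'I_m -> 'I_n -> C) (u : 'I_m -> 'I_n -> T) :
  f (\sum_i \sum_j c i j *: u i j) = \sum_i \sum_j c i j * f (u i j).
Proof.
transitivity (f (\sum_i 1 *: \sum_j c i j *: u i j)).
  by congr f; apply: eq_bigr => i _; rewrite scale1r.
by rewrite big_lin; apply: eq_bigr => i _; rewrite mul1r big_lin.
Qed.

End LinearFunctionals.

Section AmulAlgebra.
Variables (R : realType) (W : lmodType R[i]).
Local Notation C := R[i].

Lemma amulA m p q n k l (a : 'M[C]_(m, p)) (b : 'M[C]_(p, q)) (v : 'M[W]_(q, k))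
    (c : 'M[C]_(k, l)) (d : 'M[C]_(l, n)) :
  amul a (amul b v c) d = amul (a *m b) v (c *m d).
Proof.
apply/matrixP => i j; rewrite !mxE.
transitivity (\sum_x \sum_y \sum_x' \sum_y'
    (a i x * d y j * (b x x' * c y' y)) *: v x' y').
  apply: eq_bigr => x _; apply: eq_bigr => y _; rewrite mxE scaler_sumr.
  apply: eq_bigr => x' _; rewrite scaler_sumr; apply: eq_bigr => y' _.
  by rewrite scalerA.
under eq_bigr => x _ do rewrite exchange_big.
rewrite exchange_big; apply: eq_bigr => x' _.
under eq_bigr => x _ do rewrite exchange_big.
rewrite exchange_big; apply: eq_bigr => y' _.
rewrite !mxE mulr_suml scaler_suml; apply: eq_bigr => x _.
rewrite mulr_sumr scaler_suml; apply: eq_bigr => y _.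
by congr (_ *: _); ring.
Qed.

Lemma amul0 m p q n (a : 'M[C]_(m, p)) (b : 'M[C]_(q, n)) :
  amul a (0 : 'M[W]_(p, q)) b = 0.
Proof.
by apply/matrixP => i j; rewrite !mxE big1// => k _; rewrite big1// => l _;
  rewrite mxE scaler0.
Qed.

Lemma amul_1 m n (v : 'M[W]_(m, n)) : amul 1%:M v 1%:M = v.
Proof.
apply/matrixP => i j; rewrite !mxE (bigD1 i)//= [X in _ + X]big1 ?addr0 => [|k ki].
  rewrite (bigD1 j)//= [X in _ + X]big1 ?addr0 => [|k ki].
    by rewrite !mxE !eqxx mulr1 scale1r.
  by rewrite !mxE (negbTE ki) mulr0 scale0r.
by rewrite big1// => l _; rewrite mxE eq_sym (negbTE ki) mul0r scale0r.
Qed.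

Lemma amul0l m p q n (v : 'M[W]_(p, q)) (b : 'M[C]_(q, n)) :
  amul (0 : 'M[C]_(m, p)) v b = 0.
Proof.
by apply/matrixP => i j; rewrite !mxE big1// => k _; rewrite big1// => l _;
  rewrite mxE mul0r scale0r.
Qed.

Lemma amul0r m p q n (v : 'M[W]_(p, q)) (a : 'M[C]_(m, p)) :
  amul a v (0 : 'M[C]_(q, n)) = 0.
Proof.
by apply/matrixP => i j; rewrite !mxE big1// => k _; rewrite big1// => l _;
  rewrite mxE mulr0 scale0r.
Qed.

Lemma amul_block m p1 p2 q1 q2 n (a1 : 'M[C]_(m, p1)) (a2 : 'M[C]_(m, p2))
    (v11 : 'M[W]_(p1, q1)) (v12 : 'M[W]_(p1, q2)) (v21 : 'M[W]_(p2, q1))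
    (v22 : 'M[W]_(p2, q2)) (b1 : 'M[C]_(q1, n)) (b2 : 'M[C]_(q2, n)) :
  amul (row_mx a1 a2) (block_mx v11 v12 v21 v22) (col_mx b1 b2) =
  amul a1 v11 b1 + amul a1 v12 b2 + (amul a2 v21 b1 + amul a2 v22 b2).
Proof.
apply/matrixP => i j; rewrite !mxE big_split_ord; congr (_ + _);
  rewrite -big_split; apply: eq_bigr => k _;
  rewrite big_split_ord; congr (_ + _); apply: eq_bigr => l _;
  by rewrite ?row_mxEl ?row_mxEr ?col_mxEu ?col_mxEd
    ?row_mxEl ?row_mxEr.
Qed.

Lemma amul_outer m1 m2 n1 n2 p q (a1 : 'M[C]_(m1, p)) (a2 : 'M[C]_(m2, p))
    (v : 'M[W]_(p, q)) (b1 : 'M[C]_(q, n1)) (b2 : 'M[C]_(q, n2)) :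
  amul (col_mx a1 a2) v (row_mx b1 b2) =
  block_mx (amul a1 v b1) (amul a1 v b2) (amul a2 v b1) (amul a2 v b2).
Proof.
apply/matrixP => i j; rewrite mxE.
by case: (split_ordP i) => i' ->; case: (split_ordP j) => j' ->;
  rewrite ?block_mxEul ?block_mxEur ?block_mxEdl ?block_mxEdr mxE;
  apply: eq_bigr => k _; apply: eq_bigr => l _;
  rewrite ?row_mxEl ?row_mxEr ?col_mxEu ?col_mxEd.
Qed.

Lemma amul_scalar m n (c d : C) (v : 'M[W]_(m, n)) :
  amul c%:M v d%:M = mscale (c * d) v.
Proof.
apply/matrixP => i j; rewrite !mxE (bigD1 i)//= [X in _ + X]big1 ?addr0 => [|k ki].
  rewrite (bigD1 j)//= [X in _ + X]big1 ?addr0 => [|k ki].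
    by rewrite !mxE !eqxx !mulr1n.
  by rewrite !mxE (negbTE ki) mulr0n mulr0 scale0r.
by rewrite big1// => l _; rewrite mxE eq_sym (negbTE ki) mulr0n mul0r scale0r.
Qed.

Lemma amulZ m p q n (c d : C) (a : 'M[C]_(m, p)) (v : 'M[W]_(p, q))
    (b : 'M[C]_(q, n)) :
  amul (c *: a) v (d *: b) = mscale (c * d) (amul a v b).
Proof.
apply/matrixP => i j; rewrite !mxE scaler_sumr; apply: eq_bigr => k _.
rewrite scaler_sumr; apply: eq_bigr => l _.
by rewrite !mxE scalerA mulrACA.
Qed.

Lemma amul_mscale m p q n (c : C) (a : 'M[C]_(m, p)) (v : 'M[W]_(p, q))
    (b : 'M[C]_(q, n)) :
  amul a (mscale c v) b = mscale c (amul a v b).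
Proof.
apply/matrixP => i j; rewrite !mxE scaler_sumr; apply: eq_bigr => k _.
by rewrite scaler_sumr; apply: eq_bigr => l _; rewrite !mxE !scalerA mulrC.
Qed.

Lemma amul_entry m n (v : 'M[W]_(m, n)) k l :
  amul (delta_mx 0 k) v (delta_mx l 0) = const_mx (v k l) :> 'M[W]_1.
Proof.
apply/matrixP => i j; rewrite !mxE (bigD1 k)//= [X in _ + X]big1 ?addr0 => [|x xk].
  rewrite (bigD1 l)//= [X in _ + X]big1 ?addr0 => [|x xl].
    by rewrite !mxE !ord1 !eqxx mulr1 scale1r.
  by rewrite !mxE (negbTE xl) mulr0 scale0r.
by rewrite big1// => y _; rewrite mxE (negbTE xk) andbF mul0r scale0r.
Qed.

Lemma map_amul (f : W -> C) m p q n (a : 'M[C]_(m, p)) (v : 'M[W]_(p, q))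
    (b : 'M[C]_(q, n)) :
  (forall (c : C) x y, f (c *: x + y) = c * f x + f y) ->
  map_mx f (amul a v b) = a *m map_mx f v *m b.
Proof.
move=> flin; apply/matrixP => i j; rewrite !mxE big_lin2//.
rewrite exchange_big; apply: eq_bigr => l _.
rewrite mxE mulr_suml; apply: eq_bigr => k _.
by rewrite mxE mulrAC.
Qed.

Lemma amul_map (V : lmodType C) (f : {linear V -> W}) m p q n (a : 'M[C]_(m, p))
    (v : 'M[V]_(p, q)) (b : 'M[C]_(q, n)) :
  map_mx f (amul a v b) = amul a (map_mx f v) b.
Proof.
apply/matrixP => i j; rewrite !mxE linear_sum; apply: eq_bigr => k _.
by rewrite linear_sum; apply: eq_bigr => l _; rewrite linearZ !mxE.
Qed.

Lemma mxstar_block (star : W -> W) m n (a : 'M[W]_m) (b : 'M[W]_(m, n))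
    (c : 'M[W]_(n, m)) (d : 'M[W]_n) :
  mxstar star (block_mx a b c d) =
  block_mx (mxstar star a) (mxstar star c) (mxstar star b) (mxstar star d).
Proof. by rewrite /mxstar tr_block_mx map_block_mx. Qed.

Lemma mscale_const (c : C) (w : W) m n :
  mscale c (const_mx w : 'M[W]_(m, n)) = const_mx (c *: w).
Proof. by apply/matrixP => i j; rewrite !mxE. Qed.

Lemma mx11_const (v : 'M[W]_1) : v = const_mx (v 0 0).
Proof. by apply/matrixP => i j; rewrite !mxE !ord1. Qed.

End AmulAlgebra.

(** * Involutions *)

Section Involution.
Variables (R : realType) (W : lmodType R[i]) (star : W -> W).
Local Notation C := R[i].
Hypothesis starI : involution star.

Lemma star0 : star 0 = 0.
Proof.
have [_ sl] := starI; have := sl (-1) 0 0; rewrite scaler0 addr0 => /eqP.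
by rewrite rmorphN rmorph1 scaleN1r addNr => /eqP.
Qed.

Lemma starD x y : star (x + y) = star x + star y.
Proof. by have [_ sl] := starI; have := sl 1 x y; rewrite rmorph1 !scale1r. Qed.

Lemma starZ c x : star (c *: x) = c^*%R *: star x.
Proof. by have := star_conj_linear starI c x 0; rewrite !addr0 star0 addr0. Qed.

Lemma starB x y : star (x - y) = star x - star y.
Proof. by rewrite starD -[- y]scaleN1r starZ rmorphN rmorph1 scaleN1r. Qed.

Lemma star_sum I (r : seq I) (F : I -> W) :
  star (\sum_(i <- r) F i) = \sum_(i <- r) star (F i).
Proof. by elim: r => [|i r IH]; rewrite ?big_nil ?star0// !big_cons starD IH. Qed.

Definition rpart (v : W) : W := (2^-1)%:C *: (v + star v).

Lemma rpart_sa v : star (rpart v) = rpart v.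
Proof. by rewrite /rpart starZ starD (starK starI) conjR addrC. Qed.

Lemma rpart_id v : star v = v -> rpart v = v.
Proof.
by move=> sv; rewrite /rpart sv -{2}[v]scale1r -{1}[v]scale1r -scalerDl scalerA
  -(rmorph1 (real_complex R)) -rmorphD -rmorphM mulVf ?scale1r// (_ : 1 + 1 = 2).
Qed.

Lemma rpartD u v : rpart (u + v) = rpart u + rpart v.
Proof. by rewrite /rpart -scalerDr starD addrACA. Qed.

Lemma rpartZ (t : R) v : rpart (t%:C *: v) = t%:C *: rpart v.
Proof. by rewrite /rpart starZ conjR -scalerDr !scalerA mulrC. Qed.

Lemma rpartN v : rpart (- v) = - rpart v.
Proof. by rewrite -scaleN1r -(rmorphN1 (real_complex R)) rpartZ rmorphN1 scaleN1r. Qed.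

Lemma cartesian v : v = rpart v + 'i *: rpart (- 'i *: v).
Proof.
rewrite /rpart starZ !scalerDr !scalerA.
rewrite (_ : 'i * (2^-1)%:C * - 'i = (2^-1)%:C); last first.
  by apply: complex_ext; rewrite ?creM ?cimM /=; ring.
rewrite (_ : 'i * ((2^-1)%:C) * (- 'i)^*%R = - (2^-1)%:C); last first.
  by apply: complex_ext; rewrite ?creM ?cimM ?creJ ?cimJ /=; ring.
by rewrite scaleNr addrACA subrr addr0 -scalerDl -rmorphD/= half_plus_half rmorph1 scale1r.
Qed.

Lemma mxstarK m n (v : 'M[W]_(m, n)) : mxstar star (mxstar star v) = v.
Proof. by apply/matrixP => i j; rewrite !mxE (starK starI). Qed.

Lemma mxstar_sum m n I (r : seq I) (T : I -> 'M[W]_(m, n)) :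
  mxstar star (\sum_(i <- r) T i) = \sum_(i <- r) mxstar star (T i).
Proof.
apply/matrixP => k l; rewrite !mxE !summxE star_sum.
by apply: eq_bigr => i _; rewrite !mxE.
Qed.

Lemma mxstar_amul m p q n (a : 'M[C]_(m, p)) (v : 'M[W]_(p, q)) (b : 'M[C]_(q, n)) :
  mxstar star (amul a v b) = amul (b^t* ) (mxstar star v) (a^t* ).
Proof.
apply/matrixP => i j; rewrite !mxE star_sum exchange_big /=.
under eq_bigr => k _ do rewrite star_sum.
apply: eq_bigr => l _; apply: eq_bigr => k _.
by rewrite starZ !mxE rmorphM mulrC.
Qed.

End Involution.

(** * Operator space norms *)

Section OperatorSpace.
Variables (R : realType) (W : lmodType R[i]) (N : forall n, 'M[W]_n -> R).
Local Notation C := R[i].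
Hypothesis osN : operator_space_norm N.

Lemma osn0 n : N (0 : 'M[W]_n) = 0.
Proof.
have := osn_scale osN 0 (0 : 'M[W]_n); rewrite Normc.normc0 mul0r.
suff -> : mscale (0 : C) (0 : 'M[W]_n) = 0 by [].
by apply/matrixP => i j; rewrite !mxE scaler0.
Qed.

Lemma osnN n (v : 'M[W]_n) : N (- v) = N v.
Proof.
have -> : - v = mscale (-1 : C) v by apply/matrixP => i j; rewrite !mxE scaleN1r.
by rewrite (osn_scale osN) normcN Normc.normc1 mul1r.
Qed.

Lemma opnorm_delta (m p : nat) (i : 'I_m) (j : 'I_p) :
  opnorm (delta_mx i j : 'M[C]_(m, p)) <= 1.
Proof.
apply/opnorm_leP => // x y; rewrite mul1r.
have -> : hs x (delta_mx i j *m y) = (x i 0)^*%R * y j 0.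
  rewrite hsE (bigD1 i)//= big_ord1 mxE (bigD1 j)//= mxE !eqxx mul1r.
  rewrite big1 ?addr0 => [|q qj]; last by rewrite mxE (negbTE qj) andbF mul0r.
  rewrite big1 ?addr0// => q qi; rewrite big_ord1 mxE big1 ?mulr0// => q' _.
  by rewrite mxE (negbTE qi) mul0r.
have le_entry q (z : 'cV[C]_q) (o : 'I_q) : normc (z o 0) ^+ 2 <= fro2 z.
  rewrite fro2E (bigD1 o)//= big_ord1 lerDl; apply: sumr_ge0 => ? _.
  by rewrite big_ord1 sqr_ge0.
apply: le_trans (lerD (le_entry _ x i) (le_entry _ y j)).
rewrite !sqr_normcE creM creJ cimJ.
have := sqr_ge0 (Re (x i 0) - Re (y j 0)); have := sqr_ge0 (Im (x i 0) - Im (y j 0)).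
by move: (Re (x _ _)) (Re (y _ _)) (Im (x _ _)) (Im (y _ _)) => a b c d; nra.
Qed.

Lemma osn_entry n (v : 'M[W]_n) k l : N (const_mx (v k l) : 'M[W]_1) <= N v.
Proof.
rewrite -amul_entry (le_trans (osn_bimodule osN _ _ _))//.
apply: le_trans (_ : opnorm (delta_mx (0 : 'I_1) k : 'M[C]_(1, n)) * N v <= _).
  by rewrite ler_piMr// ?opnorm_delta// mulr_ge0 ?opnorm_ge0 ?(osn_ge0 osN).
by rewrite ler_piMl// ?opnorm_delta// (osn_ge0 osN).
Qed.

Lemma osn_le_sum n (v : 'M[W]_n) :
  N v <= \sum_i \sum_j N (const_mx (v i j) : 'M[W]_1).
Proof.
have Nsum I (r : seq I) (T : I -> 'M[W]_n) : N (\sum_(i <- r) T i) <= \sum_(i <- r) N (T i).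
  elim: r => [|i r IH]; first by rewrite !big_nil osn0.
  by rewrite !big_cons (le_trans (osn_triangle osN _ _))// lerD2l.
have {1}-> : v = \sum_i \sum_j amul (delta_mx i 0) (const_mx (v i j) : 'M[W]_1) (delta_mx 0 j).
  apply/matrixP => k l; rewrite summxE (bigD1 k)//= [X in _ + X]big1 ?addr0 => [|i ik].
    rewrite summxE (bigD1 l)//= [X in _ + X]big1 ?addr0 => [|j jl].
      by rewrite mxE !big_ord1 !mxE !eqxx mulr1 scale1r.
    by rewrite mxE !big_ord1 !mxE eq_sym [l == j]eq_sym (negbTE jl) mulr0 scale0r.
  rewrite summxE big1// => j _.
  by rewrite mxE !big_ord1 !mxE [k == i]eq_sym (negbTE ik) mul0r scale0r.
apply: le_trans (Nsum _ _ _) _; apply: ler_sum => i _.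
apply: le_trans (Nsum _ _ _) _; apply: ler_sum => j _.
apply: le_trans (osn_bimodule osN _ _ _) _.
apply: le_trans (_ : opnorm (delta_mx i 0 : 'M[C]_(n, 1)) * N (const_mx (v i j) : 'M[W]_1) <= _).
  by rewrite ler_piMr ?opnorm_delta// mulr_ge0 ?opnorm_ge0 ?(osn_ge0 osN).
by rewrite ler_piMl ?opnorm_delta// (osn_ge0 osN).
Qed.

Lemma opnorm_le_fro2_adj n p (a : 'M[C]_(n, p)) (s : R) : 0 <= s ->
  (forall x : 'cV[C]_n, fro2 (a^t* *m x) <= s ^+ 2 * fro2 x) -> opnorm a <= s.
Proof.
rewrite le_eqVlt => /predU1P[<-|s0] H; apply/opnorm_leP; rewrite ?(ltW s0)// => x y;
  rewrite hs_mull; have := H x.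
  rewrite expr0n mul0r => a0; rewrite mul0r.
  apply/ler_addgt0Pr => d d0; rewrite add0r.
  have y1 : 0 < fro2 y + 1 by rewrite ltr_wpDl ?fro2_ge0.
  apply: le_trans (hs_amgm _ y (divr_gt0 y1 d0)) _.
  have -> : fro2 (a^t* *m x) = 0 by apply/eqP; rewrite eq_le a0 fro2_ge0.
  rewrite mulr0 add0r invf_div mulrCA ler_piMr ?(ltW d0)//.
  by rewrite ler_pdivrMr// mul1r lerDl.
have s1 : 0 < s^-1 by rewrite invr_gt0.
move=> {}H; apply: le_trans (hs_amgm _ y s1) _.
rewrite invrK mulrDr [fro2 y * _]mulrC lerD2r.
by rewrite ler_pdivrMl// mulrA -expr2.
Qed.

Lemma opnorm_le_fro2 n p (b : 'M[C]_(p, n)) (s : R) : 0 <= s ->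
  (forall x : 'cV[C]_n, fro2 (b *m x) <= s ^+ 2 * fro2 x) -> opnorm b <= s.
Proof.
rewrite le_eqVlt => /predU1P[<-|s0] H; apply/opnorm_leP; rewrite ?(ltW s0)// => x y.
  rewrite mul0r; have := H y; rewrite expr0n mul0r => b0.
  apply/ler_addgt0Pr => d d0; rewrite add0r.
  have x1 : 0 < fro2 x + 1 by rewrite ltr_wpDl ?fro2_ge0.
  apply: le_trans (hs_amgm x _ (divr_gt0 d0 x1)) _.
  have -> : fro2 (b *m y) = 0 by apply/eqP; rewrite eq_le b0 fro2_ge0.
  rewrite mul0r addr0 mulrAC -mulrA ler_piMr ?(ltW d0)//.
  by rewrite ler_pdivrMr// mul1r lerDl.
apply: le_trans (hs_amgm x _ s0) _; rewrite mulrDr lerD2l.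
by rewrite ler_pdivrMr// mulrC mulrA -expr2.
Qed.

Lemma psd_1B_le n (A : 'M[C]_n) : psd (1%:M - A) ->
  forall x : 'cV[C]_n, Re (hs x (A *m x)) <= fro2 x.
Proof.
move=> /psdE H x; have := ge0_Re (H x).
rewrite mulmxBl mul1mx -[- (A *m x)]scaleN1r hsDr hsZr mulN1r creD creN /fro2.
by rewrite subr_ge0.
Qed.

(** Finitely many summands are gathered into a single block diagonal one,
    framed by one row and one column: the axiom on direct sums bounds its
    norm, and one bimodule inequality then bounds the whole sum. *)
Lemma gather_sum n m (d : 'I_m -> nat) (al : forall j, 'M[C]_(n, d j))
    (g : forall j, 'M[W]_(d j)) (be : forall j, 'M[C]_(d j, n)) :
  (forall j, N (g j) <= 1) ->
  exists p (a : 'M[C]_(n, p)) (h : 'M[W]_p) (b : 'M[C]_(p, n)),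
  [/\ N h <= 1, \sum_j amul (al j) (g j) (be j) = amul a h b,
      \sum_j (al j *m (al j)^t* ) = a *m a^t* &
      \sum_j ((be j)^t* *m be j) = b^t* *m b].
Proof.
elim: m d al g be => [|m IH] d al g be gN.
  exists 0, 0, 0, 0; rewrite osn0 !big_ord0 amul0 !mul0mx.
  by split=> //; apply/matrixP => i j; rewrite !mxE big1// => -[].
have [p [a [h [b [hN E1 E2 E3]]]]] := IH (fun j => d (lift ord0 j))
  (fun j => al (lift ord0 j)) (fun j => g (lift ord0 j)) (fun j => be (lift ord0 j))
  (fun j => gN (lift ord0 j)).
exists (d ord0 + p)%N, (row_mx (al ord0) a), (block_mx (g ord0) 0 0 h), (col_mx (be ord0) b).
rewrite !big_ord_recl E1 E2 E3 (osn_sum osN) ge_max gN hN; split=> //.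
- by rewrite amul_block !amul0 addr0 add0r.
- by rewrite tr_row_mx map_col_mx mul_row_col.
- by rewrite tr_col_mx map_row_mx mul_row_col.
Qed.

(** After [gather_sum], the two hypotheses say that the row and the column are
    contractions. *)
Lemma ball_comb n m (d : 'I_m -> nat) (al : forall j, 'M[C]_(n, d j))
    (g : forall j, 'M[W]_(d j)) (be : forall j, 'M[C]_(d j, n)) :
  (forall j, N (g j) <= 1) ->
  psd (1%:M - \sum_j (al j *m (al j)^t* )) ->
  psd (1%:M - \sum_j ((be j)^t* *m be j)) ->
  N (\sum_j amul (al j) (g j) (be j)) <= 1.
Proof.
move=> gN; have [p [a [h [b [hN -> -> ->]]]]] := gather_sum al be gN.
move=> /psd_1B_le Ha /psd_1B_le Hb.
have a1 : opnorm a <= 1.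
  apply: opnorm_le_fro2_adj => // x; rewrite expr1n mul1r; have := Ha x.
  by rewrite -mulmxA hs_mull.
have b1 : opnorm b <= 1.
  apply: opnorm_le_fro2 => // x; rewrite expr1n mul1r; have := Hb x.
  by rewrite -mulmxA hs_mull trmxCK.
apply: le_trans (osn_bimodule osN _ _ _) _.
apply: le_trans (_ : opnorm a * N h <= _).
  by rewrite ler_piMr// mulr_ge0 ?opnorm_ge0 ?(osn_ge0 osN).
apply: le_trans (_ : opnorm a <= _) => //.
by rewrite ler_piMr// opnorm_ge0.
Qed.

End OperatorSpace.

(** * Affine families vanishing at zero as linear functionals *)

Section AffineFunctionals.
Variables (R : realType) (W : lmodType R[i]).
Local Notation C := R[i].
Variables (N : forall n, 'M[W]_n -> R) (star : W -> W) (nu : forall n, 'M[W]_n -> R).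
Hypothesis osN : operator_space_norm N.
Hypothesis starI : involution star.
Hypothesis Nstar : forall n (v : 'M[W]_n), N (mxstar star v) = N v.
Hypothesis nuD : forall u v : 'M[W]_1, nu (u + v) <= nu u + nu v.
Hypothesis nuZ : forall (c : C) (u : 'M[W]_1), nu (mscale c u) = normc c * nu u.
Hypothesis nu_star : forall u : 'M[W]_1, nu (mxstar star u) = nu u.

Local Notation K := (fun n => [set a : 'M[W]_n | N a <= 1]).

(** The self-adjoint dilation of [x]. Since [x] is its off-diagonal corner, an
    extension to the whole balls is determined by self-adjoint elements. *)
Definition dilation n (x : 'M[W]_n) : 'M[W]_(n + n) := block_mx 0 x (mxstar star x) 0.

Local Notation upper n := (row_mx 1%:M 0 : 'M[C]_(n, n + n)).
Local Notation lower n := (col_mx 0 1%:M : 'M[C]_(n + n, n)).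

Lemma psd0 n : psd (0 : 'M[C]_n).
Proof. by move=> x; rewrite mulmx0 mul0mx mxE. Qed.

Lemma dilation_corner n (x : 'M[W]_n) : amul (upper n) (dilation x) (lower n) = x.
Proof. by rewrite amul_block !amul0 amul0l amul_1 add0r !addr0. Qed.

Lemma upper_isometry n : upper n *m (upper n)^t* = 1%:M.
Proof. by rewrite tr_row_mx map_col_mx mul_row_col hadj1 mulmx1 mul0mx addr0. Qed.

Lemma lower_isometry n : (lower n)^t* *m lower n = 1%:M.
Proof. by rewrite tr_col_mx map_row_mx mul_row_col hadj1 mulmx1 mulmx0 add0r. Qed.

Lemma dilation_sa n (x : 'M[W]_n) : N x <= 1 -> sa_part star K (dilation x).
Proof.
move=> xN; split; last first.
  have mxstar0 m p : mxstar star (0 : 'M[W]_(m, p)) = 0.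
    by apply/matrixP => i j; rewrite !mxE (star0 starI).
  by rewrite /dilation mxstar_block !mxstar0 (mxstarK starI).
pose a (j : 'I_2) : 'M[C]_(n + n, n) :=
  if j == 0 then col_mx 1%:M 0 else col_mx 0 1%:M.
pose g (j : 'I_2) := if j == 0 then x else mxstar star x.
pose b (j : 'I_2) : 'M[C]_(n, n + n) :=
  if j == 0 then row_mx 0 1%:M else row_mx 1%:M 0.
have -> : dilation x = \sum_(j < 2) amul (a j) (g j) (b j).
  rewrite big_ord_recl big_ord1 /a /b /g /= !amul_outer !amul_1 !amul0l !amul0r.
  by rewrite add_block_mx !addr0 !add0r.
have z m p : (0 : 'M[C]_(m, p))^t* = 0 by apply/matrixP => i j; rewrite !mxE rmorph0.
apply: (ball_comb osN) => [j||].
- by rewrite /g; case: ifP => _; rewrite ?Nstar.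
- rewrite big_ord_recl big_ord1 /a /= !tr_col_mx !map_row_mx !mul_col_row.
  rewrite !z !hadj1 !mulmx1 !mul0mx !mul1mx !add_block_mx !addr0 !add0r -scalar_mx_block subrr.
  exact: psd0.
- rewrite big_ord_recl big_ord1 /b /= !tr_row_mx !map_col_mx !mul_col_row.
  rewrite !z !hadj1 !mulmx1 !mul0mx !mul1mx !add_block_mx !addr0 !add0r -scalar_mx_block subrr.
  exact: psd0.
Qed.

(** The defining property of an extension, for self-adjoint elements, passes to
    arbitrary ones by writing each [x j] as a corner of its dilation. *)
Lemma ext_comb (F Ft : fam W) n m (d : 'I_m -> nat) (al : forall j, 'M[C]_(n, d j))
    (x : forall j, 'M[W]_(d j)) (be : forall j, 'M[C]_(d j, n)) :
  extension star K F Ft ->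
  (forall j, N (x j) <= 1) ->
  psd (1%:M - \sum_j (al j *m (al j)^t* )) ->
  psd (1%:M - \sum_j ((be j)^t* *m be j)) ->
  Ft n (\sum_j amul (al j) (x j) (be j)) = \sum_j (al j *m Ft (d j) (x j) *m be j).
Proof.
move=> FE xN Ha Hb; have [_ FtE] := FE.
have one k (y : 'M[W]_k) : N y <= 1 ->
    Ft k y = upper k *m F (k + k)%N (dilation y) *m lower k.
  move=> yN; have := FtE k 1%N (fun=> (k + k)%N) (fun=> upper k) (fun=> dilation y)
    (fun=> lower k) (fun=> dilation_sa yN).
  rewrite !big_ord1 upper_isometry lower_isometry subrr dilation_corner => -> //;
  exact: psd0.
have := FtE n m (fun j => (d j + d j)%N) (fun j => al j *m upper (d j))
  (fun j => dilation (x j)) (fun j => lower (d j) *m be j)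
  (fun j => dilation_sa (xN j)).
have -> : \sum_j (al j *m upper (d j) *m (al j *m upper (d j))^t* ) =
    \sum_j (al j *m (al j)^t* ).
  apply: eq_bigr => j _.
  by rewrite hadj_mul mulmxA -[al j *m _ *m _]mulmxA upper_isometry mulmx1.
have -> : \sum_j ((lower (d j) *m be j)^t* *m (lower (d j) *m be j)) =
    \sum_j ((be j)^t* *m be j).
  apply: eq_bigr => j _.
  by rewrite hadj_mul mulmxA -[_ *m _ *m lower (d j)]mulmxA lower_isometry mulmx1.
have -> : \sum_j amul (al j *m upper (d j)) (dilation (x j)) (lower (d j) *m be j) =
    \sum_j amul (al j) (x j) (be j).
  by apply: eq_bigr => j _; rewrite -amulA dilation_corner.
move=> /(_ Ha Hb) ->; apply: eq_bigr => j _.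
by rewrite (one _ _ (xN j)) !mulmxA.
Qed.

Lemma ext_sa (F Ft : fam W) n (g : 'M[W]_n) : extension star K F Ft ->
  sa_part star K g -> Ft n g = F n g.
Proof.
move=> FE gG; have := FE.2 n 1%N (fun=> n) (fun=> 1%:M) (fun=> g) (fun=> 1%:M) (fun=> gG).
rewrite !big_ord1 amul_1 hadj1 mul1mx mulmx1 subrr => -> //; last 2 first.
- exact: psd0.
- exact: psd0.
by rewrite mul1mx.
Qed.

Lemma psd_1B_scalar n (t : R) : t <= 1 -> psd (1%:M - t%:C%:M : 'M[C]_n).
Proof.
move=> t1; apply/psdE => x; rewrite -raddfB /= mul_scalar_mx hsZr.
have := hsC x x; have := fro2_ge0 x; rewrite /fro2; case: (hs x x) => a b /= a0 [] b0.
have -> : b = 0 by lra.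
rewrite -(rmorph1 (real_complex R)) -rmorphB -[_ +i* 0]/(a%:C) -rmorphM ler0c.
by rewrite mulr_ge0// subr_ge0.
Qed.

Lemma ext_scale (F Ft : fam W) (c : C) (x : 'M[W]_1) : extension star K F Ft ->
  normc c <= 1 -> N x <= 1 ->
  Ft 1%N (mscale c x) 0 0 = c * Ft 1%N x 0 0.
Proof.
move=> FE c1 xN; have := @ext_comb F Ft 1 1 (fun=> 1%N) (fun=> c%:M) (fun=> x) (fun=> 1%:M)
  FE (fun=> xN).
rewrite !big_ord1 amul_scalar mulr1 hadj1 !mulmx1 subrr => -> //; last 2 first.
- have -> : (c%:M : 'M[C]_1) *m c%:M^t* = ((normc c ^+ 2)%:C)%:M.
    by apply/matrixP => i j; rewrite !mxE big_ord1 !mxE !ord1 /= !mulr1n mulcJ.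
  by apply: psd_1B_scalar; rewrite expr_le1// normc_ge0.
- exact: psd0.
by rewrite mul_scalar_mx mxE.
Qed.

(** A midpoint is a combination whose coefficients are [sqrt (1/2)] on both
    sides. *)
Lemma ext_mid (F Ft : fam W) (x y : 'M[W]_1) : extension star K F Ft -> N x <= 1 -> N y <= 1 ->
  Ft 1%N (mscale (2^-1)%:C x + mscale (2^-1)%:C y) 0 0 =
  (2^-1)%:C * Ft 1%N x 0 0 + (2^-1)%:C * Ft 1%N y 0 0.
Proof.
move=> FE xN yN; pose s : R := Num.sqrt 2^-1.
have s2 : s * s = 2^-1 by rewrite -expr2 sqr_sqrtr// invr_ge0.
pose g (j : 'I_2) := if j == 0 then x else y.
have gN j : N (g j) <= 1 by rewrite /g; case: ifP.
have ss : (s%:C%:M : 'M[C]_1) *m s%:C%:M = (2^-1)%:C%:M.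
  by rewrite -scalar_mxM -rmorphM s2.
have sadj : (s%:C%:M : 'M[C]_1)^t* = s%:C%:M.
  by apply/matrixP => i j; rewrite !mxE !ord1 /= !mulr1n conjR.
have s1 : psd (1%:M - ((2^-1)%:C%:M + (2^-1)%:C%:M) : 'M[C]_1).
  by rewrite -raddfD -rmorphD/= half_plus_half rmorph1 subrr; exact: psd0.
have := @ext_comb F Ft 1 2 (fun=> 1%N) (fun=> s%:C%:M) g (fun=> s%:C%:M) FE gN.
rewrite !big_ord_recl !big_ord0 !addr0 /g/= !amul_scalar -rmorphM s2 sadj ss.
move=> /(_ s1 s1) ->.
by rewrite !mul_scalar_mx !mul_mx_scalar !scalerA -rmorphM s2 !mxE.
Qed.

(** The linear functional on [W] that restricts to [Ft] on the unit ball; the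
    summand [1] keeps the scaling factor positive. *)
Definition ev (Ft : fam W) (w : W) : C :=
  let s := N (const_mx w : 'M[W]_1) + 1 in
  s%:C * Ft 1%N (const_mx (s^-1%:C *: w)) 0 0.

Definition isA0 (Ft : fam W) := exists2 F, A0G nu star K F & extension star K F Ft.

Lemma N1_ge0 (w : W) : 0 <= N (const_mx w : 'M[W]_1). Proof. exact: (osn_ge0 osN). Qed.
Lemma N1_gt0 (w : W) : 0 < N (const_mx w : 'M[W]_1) + 1.
Proof. by rewrite ltr_wpDl// N1_ge0. Qed.

Lemma N1Z (c : C) (w : W) : N (const_mx (c *: w) : 'M[W]_1) = normc c * N (const_mx w : 'M_1).
Proof. by rewrite -mscale_const (osn_scale osN). Qed.

Lemma N1_scale_le (s : R) (w : W) : 0 < s -> N (const_mx w : 'M[W]_1) <= s ->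
  N (const_mx (s^-1%:C *: w) : 'M[W]_1) <= 1.
Proof.
move=> s0 ws; rewrite N1Z normcR gtr0_norm ?invr_gt0// mulrC ler_pdivrMr// mul1r.
exact: ws.
Qed.

Lemma evE Ft (lam : R) (w : W) : isA0 Ft -> 0 <= lam ->
  N (const_mx w : 'M[W]_1) <= 1 ->
  ev Ft (lam%:C *: w) = lam%:C * Ft 1%N (const_mx w) 0 0.
Proof.
move=> [F FA FE] l0 wN; rewrite /ev; set s := N _ + 1.
have s0 : 0 < s by exact: N1_gt0.
have sc (t : R) (x : W) : 0 <= t -> t <= 1 -> N (const_mx x : 'M[W]_1) <= 1 ->
    Ft 1%N (const_mx (t%:C *: x)) 0 0 = t%:C * Ft 1%N (const_mx x) 0 0.
  move=> t0 t1 xN; rewrite -mscale_const (ext_scale FE)// normcR ger0_norm//.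
have [ls|/ltW ls] := leP lam s.
  rewrite scalerA -rmorphM sc//.
  - by rewrite mulrA -rmorphM mulrA mulfV ?mul1r// gt_eqF.
  - by rewrite mulr_ge0// invr_ge0 ltW.
  - by rewrite mulrC ler_pdivrMr// mul1r.
have l1 : 0 < lam by exact: lt_le_trans ls.
have wE : w = (s / lam)%:C *: (s^-1%:C *: (lam%:C *: w)).
  rewrite !scalerA -!rmorphM (_ : s / lam * s^-1 * lam = 1) ?scale1r//.
  by field; rewrite !gt_eqF.
rewrite [in RHS]wE (sc (s / lam)).
- by rewrite mulrA -rmorphM mulrCA mulfV ?mulr1// gt_eqF.
- by rewrite mulr_ge0 ?invr_ge0// ltW.
- by rewrite ler_pdivrMr// mul1r.
- by apply: N1_scale_le => //; rewrite lerDl.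
Qed.

Lemma ev_ball Ft (w : W) : isA0 Ft -> N (const_mx w : 'M[W]_1) <= 1 ->
  ev Ft w = Ft 1%N (const_mx w) 0 0.
Proof. by move=> Fi wN; have := evE Fi ler01 wN; rewrite scale1r mul1r. Qed.

Lemma ev_add Ft (x y : W) : isA0 Ft -> ev Ft (x + y) = ev Ft x + ev Ft y.
Proof.
move=> Fi; have [F FA FE] := Fi.
pose s : R := N (const_mx x : 'M[W]_1) + N (const_mx y : 'M[W]_1) + 1.
have s0 : 0 < s by rewrite ltr_wpDl// addr_ge0// N1_ge0.
have xs : N (const_mx x : 'M[W]_1) <= s by rewrite /s -addrA lerDl addr_ge0// N1_ge0.
have ys : N (const_mx y : 'M[W]_1) <= s by rewrite /s addrAC lerDr addr_ge0// N1_ge0.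
have E (z : W) : z = s%:C *: (s^-1%:C *: z).
  by rewrite scalerA -rmorphM mulfV ?scale1r// gt_eqF.
rewrite [in RHS](E x) [in RHS](E y) !evE ?N1_scale_le// ?(ltW s0)//.
have -> : x + y = (s + s)%:C *: ((2^-1)%:C *: (s^-1%:C *: x) + (2^-1)%:C *: (s^-1%:C *: y)).
  rewrite -scalerDr -scalerDr !scalerA -!rmorphM -[LHS]scale1r; congr (_ *: _).
  by rewrite -(rmorph1 (real_complex R)); congr real_complex_def; field; rewrite gt_eqF.
set u := s^-1%:C *: x; set v := s^-1%:C *: y.
have uN : N (const_mx u : 'M[W]_1) <= 1 by exact: N1_scale_le.
have vN : N (const_mx v : 'M[W]_1) <= 1 by exact: N1_scale_le.
have cE : (const_mx ((2^-1)%:C *: u + (2^-1)%:C *: v) : 'M[W]_1) =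
    mscale (2^-1)%:C (const_mx u) + mscale (2^-1)%:C (const_mx v).
  by apply/matrixP => i j; rewrite !mxE.
have ss0 : 0 <= s + s by apply: addr_ge0; exact: ltW.
rewrite evE//.
  rewrite cE (ext_mid FE)// mulrDr !mulrA -rmorphM.
  by have -> : (s + s) / 2 = s by field.
rewrite cE (le_trans (osn_triangle osN _ _))// !(osn_scale osN) !normcR !ger0_norm ?invr_ge0//.
by move: (N _) (N _) uN vN => a b; lra.
Qed.

Lemma ev_scale Ft c (x : W) : isA0 Ft -> ev Ft (c *: x) = c * ev Ft x.
Proof.
move=> Fi; have [F FA FE] := Fi.
have [u u1 uc] := phase c.
pose s : R := N (const_mx x : 'M[W]_1) + 1.
have s0 : 0 < s by exact: N1_gt0.
pose y := s^-1%:C *: x.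
have yN : N (const_mx y : 'M[W]_1) <= 1 by apply: N1_scale_le => //; rewrite lerDl.
have xE : x = s%:C *: y by rewrite scalerA -rmorphM mulfV ?scale1r// gt_eqF.
have cE : c = (normc c)%:C * u^*%R.
  rewrite -uc mulrAC.
  by rewrite mulcJ u1 expr1n mul1r.
have -> : c *: x = (normc c * s)%:C *: (u^*%R *: y).
  by rewrite [in LHS]xE scalerA [in LHS]cE [in RHS]scalerA mulrAC -rmorphM.
have uyN : N (const_mx (u^*%R *: y) : 'M[W]_1) <= 1.
  by rewrite N1Z cnormJ u1 mul1r.
rewrite evE// ?mulr_ge0 ?normc_ge0 ?(ltW s0)//.
rewrite -mscale_const (ext_scale FE)// ?cnormJ ?u1//.
rewrite [in RHS]xE evE// ?(ltW s0)// [in RHS]cE rmorphM.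
by rewrite -!mulrA; congr (_ * _); rewrite mulrCA.
Qed.

Lemma ev_lin Ft c (x y : W) : isA0 Ft -> ev Ft (c *: x + y) = c * ev Ft x + ev Ft y.
Proof. by move=> Fi; rewrite ev_add// ev_scale. Qed.

(** An entry is the compression by two unit vectors, which [ext_comb] moves
    through [Ft]. Thus [Ft] is determined by its first level. *)
Lemma ev_entry Ft n (v : 'M[W]_n) k l : isA0 Ft -> N v <= 1 ->
  Ft n v k l = ev Ft (v k l).
Proof.
move=> Fi vN; have [F FA FE] := Fi.
rewrite ev_ball//; last exact: le_trans (osn_entry osN _ _ _) vN.
have := ext_comb (al := fun _ : 'I_1 => delta_mx (0 : 'I_1) k)
  (be := fun _ : 'I_1 => delta_mx l 0) FE (fun=> vN).
have dk (q : 'I_n) : psd (1%:M - (delta_mx (0 : 'I_1) q : 'M[C]_(1, n)) *m (delta_mx (0 : 'I_1) q)^t* ).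
  rewrite (_ : _ *m _ = 1%:M) ?subrr; first exact: psd0.
  apply/matrixP => i j; rewrite [LHS]mxE (bigD1 q)//= big1 ?addr0 => [|z zq].
    by rewrite !mxE !ord1 !eqxx /= conjC1 mulr1.
  by rewrite !mxE (negbTE zq) andbF mul0r.
have dl : (delta_mx l (0 : 'I_1) : 'M[C]_(n, 1))^t* = delta_mx 0 l.
  by apply/matrixP => i j; rewrite !mxE andbC; case: (_ && _) => /=; rewrite ?conjC0 ?conjC1.
rewrite !big_ord1 amul_entry => ->.
- rewrite mxE (bigD1 l)//= [X in _ + X]big1 ?addr0 => [|z zl]; last first.
    by rewrite [delta_mx _ _ _ _]mxE (negbTE zl) mulr0.
  rewrite [delta_mx _ _ _ _]mxE !eqxx mulr1 mxE (bigD1 k)//= mxE !eqxx mul1r.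
  by rewrite big1 ?addr0// => z zk; rewrite mxE (negbTE zk) mul0r.
- exact: dk.
- rewrite dl (_ : delta_mx l 0 = (delta_mx (0 : 'I_1) l)^t* ); first exact: dk.
  by rewrite -dl trmxCK.
Qed.

(** Continuity is prescribed at self-adjoint points only. A general point is
    split into its real and imaginary parts, and these depend on it in a
    [nu]-contractive way. *)
Lemma ev_cont Ft (k : 'M[W]_1) : isA0 Ft -> N k <= 1 ->
  forall eps : R, 0 < eps -> exists2 del : R, 0 < del &
    forall w : 'M[W]_1, N w <= 1 -> nu (w - k) < del ->
      normc (ev Ft (w 0 0) - ev Ft (k 0 0)) < eps.
Proof.
move=> Fi kN eps e0; have [F [Faff F0] FE] := Fi.
pose part (u : C) (w : 'M[W]_1) : 'M[W]_1 :=
  mscale (2^-1)%:C (mscale u w + mxstar star (mscale u w)).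
have partE u w : part u w 0 0 = rpart star (u *: w 0 0) by rewrite !mxE.
have part_sa u w : normc u = 1 -> N w <= 1 -> sa_part star K (part u w).
  move=> u1 wN; split.
    rewrite /= (osn_scale osN) normcR ger0_norm ?invr_ge0// mulrC ler_pdivrMr// mul1r.
    rewrite (le_trans (osn_triangle osN _ _))// Nstar (osn_scale osN) u1 mul1r.
    by move: (N w) wN => a; lra.
  by apply/matrixP => i j; rewrite !ord1 2!mxE partE rpart_sa.
have partB u w w' : part u w - part u w' = part u (w - w').
  apply/matrixP => i j; rewrite !mxE !(scalerBr u) (starB starI).
  by rewrite -[LHS]scalerBr opprD addrACA.
have nu_part u w : normc u = 1 -> nu (part u w) <= nu w.
  move=> u1; rewrite nuZ normcR ger0_norm ?invr_ge0// mulrC ler_pdivrMr//.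
  rewrite (le_trans (nuD _ _))// nu_star nuZ u1 mul1r.
  by move: (nu w) => a; lra.
have splitE (w : 'M[W]_1) : w 0 0 = part 1 w 0 0 + 'i *: part (- 'i) w 0 0.
  by rewrite !partE scale1r -cartesian.
have i1 : normc (- 'i : C) = 1 by rewrite normcN normci.
have n1 : normc (1 : C) = 1 by exact: Normc.normc1.
have e20 : 0 < eps / 2 by rewrite divr_gt0.
have [d1 d10 H1] := aff_cont Faff (part_sa _ _ n1 kN) e20.
have [d2 d20 H2] := aff_cont Faff (part_sa _ _ i1 kN) e20.
exists (Num.min d1 d2); first by rewrite lt_min d10.
move=> w wN; rewrite lt_min => /andP[w1 w2].
have evp u z : normc u = 1 -> N z <= 1 -> ev Ft (part u z 0 0) = F 1%N (part u z) 0 0.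
  move=> u1 zN; have [pK _] := part_sa _ _ u1 zN.
  by rewrite ev_ball// -mx11_const// (ext_sa FE (part_sa _ _ u1 zN)).
rewrite (splitE w) (splitE k) !ev_add// !ev_scale// !evp//.
rewrite opprD addrACA -mulrBr (le_lt_trans (le_normcD _ _))// [eps]splitr.
rewrite ltrD//; first by apply: H1; [exact: part_sa|rewrite partB (le_lt_trans _ w1)// nu_part].
rewrite Normc.normcM normci mul1r.
by apply: H2; [exact: part_sa|rewrite partB (le_lt_trans _ w2)// nu_part].
Qed.

(** Conversely, a functional dominated by [nu] is applied entrywise and cut off
    outside the balls. *)
Lemma functional_isA0 (f : W -> C) (M : R) :
  (forall (c : C) x y, f (c *: x + y) = c * f x + f y) ->
  (forall w, normc (f w) <= M * nu (const_mx w : 'M[W]_1)) ->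
  exists2 Ft, isA0 Ft & forall w, N (const_mx w : 'M[W]_1) <= 1 ->
    Ft 1%N (const_mx w) 0 0 = f w.
Proof.
move=> flin fM; have f0 := lin0 flin.
have fsum n m (T : 'I_m -> 'M[W]_n) : map_mx f (\sum_j T j) = \sum_j map_mx f (T j).
  apply/matrixP => i j; rewrite mxE !summxE.
  rewrite (big_morph f (id1 := 0) (op1 := +%R))//.
    by apply: eq_bigr => k _; rewrite mxE.
  by move=> x y; have := flin 1 x y; rewrite scale1r mul1r.
pose cut (P : forall n, set 'M[W]_n) : fam W := fun n v => if `[< P n v >] then map_mx f v else 0.
have cutE P n (v : 'M[W]_n) : P n v -> cut P n v = map_mx f v.
  by move=> Pv; rewrite /cut (asboolT Pv).
have cutN (P : forall n, set 'M[W]_n) n (v : 'M[W]_n) : ~ P n v -> cut P n v = 0.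
  by move=> Pv; rewrite /cut (asboolF Pv).
have z n : sa_part star K (0 : 'M[W]_n).
  split; first by rewrite /= osn0.
  by apply/matrixP => i j; rewrite !mxE (star0 starI).
exists (cut K); last first.
  by move=> w wN; rewrite cutE// !mxE.
exists (cut (sa_part star K)); last first.
  split=> [n v|n m d al g be gG Ha Hb]; first exact: cutN.
  rewrite cutE; last by apply: (ball_comb osN) => // j; have [] := gG j.
  by rewrite fsum; apply: eq_bigr => j _; rewrite map_amul// (cutE _ _ _ (gG j)).
split; last first.
  by move=> n; rewrite (cutE _ _ _ (z n)); apply/matrixP => i j; rewrite !mxE f0.
split=> [n v|n m d ga v vG ga1|v vG eps e0]; first exact: cutN.
- have sG : sa_part star K (\sum_(i < m) amul ((ga i)^t* ) (v i) (ga i)).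
    split.
      apply: (ball_comb osN) => [j||]; first by have [] := vG j.
        under eq_bigr => j _ do rewrite trmxCK.
        rewrite ga1 subrr; exact: psd0.
      rewrite ga1 subrr; exact: psd0.
    rewrite (mxstar_sum starI); apply: eq_bigr => j _; rewrite (mxstar_amul starI) trmxCK.
    by have [_ ->] := vG j.
  rewrite (cutE _ _ _ sG) fsum; apply: eq_bigr => j _.
  by rewrite map_amul// (cutE _ _ _ (vG j)).
have M0 : 0 < `|M| + 1 by rewrite ltr_wpDl.
exists (eps / (`|M| + 1)); first exact: divr_gt0.
move=> w wG wv; rewrite !cutE// !mxE.
have nu0 : 0 <= nu (w - v).
  have := nuD (w - v) (mscale (-1 : C) (w - v)).
  rewrite nuZ normcN Normc.normc1 mul1r.
  have -> : mscale (-1 : C) (w - v) = - (w - v).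
    by apply/matrixP => i j; rewrite !mxE scaleN1r.
  have -> : w - v + - (w - v) = mscale (0 : C) (w - v).
    by rewrite subrr; apply/matrixP => i j; rewrite !mxE scale0r.
  by rewrite nuZ Normc.normc0 mul0r; move: (nu _) => a; lra.
have -> : f (w 0 0) - f (v 0 0) = f ((w - v) 0 0).
  have -> : (w - v) 0 0 = -1 *: v 0 0 + w 0 0 by rewrite !mxE scaleN1r addrC.
  by rewrite flin mulN1r addrC.
apply: le_lt_trans (fM _) _; rewrite -mx11_const.
apply: (@le_lt_trans _ _ ((`|M| + 1) * nu (w - v))).
  by rewrite ler_wpM2r// (le_trans (ler_norm _))// lerDl.
by rewrite mulrC -ltr_pdivlMr.
Qed.

End AffineFunctionals.

(** * Operator norm estimates and hermitian square roots *)

Section OpnormSublinear.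
Variable R : realType.
Local Notation C := R[i].

Lemma opnorm_bound m n (A : 'M[C]_(m, n)) (x : 'cV[C]_m) (y : 'cV[C]_n) :
  2 * Re (hs x (A *m y)) <= opnorm A * (fro2 x + fro2 y).
Proof. by have /(opnorm_leP A (opnorm_ge0 A)) := lexx (opnorm A); exact. Qed.

Lemma opnormD m n (A B : 'M[C]_(m, n)) : opnorm (A + B) <= opnorm A + opnorm B.
Proof.
apply/opnorm_leP => [|x y]; first by rewrite addr_ge0 ?opnorm_ge0.
have := lerD (opnorm_bound A x y) (opnorm_bound B x y).
by rewrite -mulrDr -[in X in _ <= X]mulrDl mulmxDl hsDr creD.
Qed.

Lemma opnormZ_le m n (t : R) (A : 'M[C]_(m, n)) : 0 <= t ->
  opnorm (t%:C *: A) <= t * opnorm A.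
Proof.
move=> t0; apply/opnorm_leP => [|x y]; first by rewrite mulr_ge0 ?opnorm_ge0.
by rewrite -scalemxAl hsZr creZ mulrCA -mulrA ler_wpM2l// opnorm_bound.
Qed.

Lemma opnormN m n (A : 'M[C]_(m, n)) : opnorm (- A) = opnorm A.
Proof.
have le (B : 'M[C]_(m, n)) : opnorm (- B) <= opnorm B.
  apply/opnorm_leP => [|x y]; first exact: opnorm_ge0.
  have := opnorm_bound B (- x) y; rewrite -scaleN1r hsZl.
  rewrite (_ : fro2 (-1 *: x) = fro2 x); last first.
    by rewrite fro2Z normcN Normc.normc1 expr1n mul1r.
  by rewrite rmorphN rmorph1 mulN1r mulNmx -[- (B *m y)]scaleN1r hsZr mulN1r.
by apply/eqP; rewrite eq_le le -[X in opnorm X <= _]opprK le.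
Qed.

Lemma opnorm0 m n : opnorm (0 : 'M[C]_(m, n)) = 0.
Proof.
apply/eqP; rewrite eq_le opnorm_ge0 andbT; apply/opnorm_leP => // x y.
by rewrite mul0mx /hs mulmx0 mxtrace0 mul0r mulr0.
Qed.

Lemma opnorm1 n : opnorm (1%:M : 'M[C]_n) <= 1.
Proof.
apply/opnorm_leP => // x y; rewrite mul1mx mul1r.
by have := hs_amgm x y ltr01; rewrite mul1r divr1.
Qed.

(** This and the next lemma are the C-star identity, as an inequality. *)
Lemma opnorm_sqr_le_row m n (A : 'M[C]_(m, n)) :
  opnorm A <= Num.sqrt (opnorm (A *m A^t* )).
Proof.
apply: opnorm_le_fro2_adj => [|x]; first exact: sqrtr_ge0.
rewrite sqr_sqrtr ?opnorm_ge0//; have := opnorm_bound (A *m A^t* ) x x.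
rewrite -mulmxA hs_mull -/(fro2 _); move: (opnorm _) (fro2 _) (fro2 _) => a b c; lra.
Qed.

Lemma opnorm_sqr_le_col m n (A : 'M[C]_(m, n)) :
  opnorm A <= Num.sqrt (opnorm (A^t* *m A)).
Proof.
apply: opnorm_le_fro2 => [|x]; first exact: sqrtr_ge0.
rewrite sqr_sqrtr ?opnorm_ge0//; have := opnorm_bound (A^t* *m A) x x.
rewrite -mulmxA hs_mull trmxCK -/(fro2 _).
by move: (opnorm _) (fro2 _) (fro2 _) => a b c; lra.
Qed.

Lemma hs_CauchySchwarz m n (X Y : 'M[C]_(m, n)) :
  normc (hs X Y) ^+ 2 <= fro2 X * fro2 Y.
Proof.
have [x0|x0] := eqVneq (fro2 X) 0.
  rewrite (fro2_eq0 x0) /hs /fro2 /hs trmx0 map_mx0 !mul0mx mxtrace0 Normc.normc0.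
  by rewrite expr0n mul0r.
have xp : 0 < fro2 X by rewrite lt_neqAle eq_sym x0 fro2_ge0.
have := hs_amgm (hs X Y *: X) Y (_ : 0 < (fro2 X)^-1).
rewrite invr_gt0 => /(_ xp); rewrite fro2Z hsZl invrK.
have -> : Re ((hs X Y)^*%R * hs X Y) = normc (hs X Y) ^+ 2.
  by rewrite sqr_normcE creM creJ cimJ; move: (Re _) (Im _) => a b; ring.
rewrite [_^-1 * _]mulrC mulfK// [fro2 Y * _]mulrC.
by move: (_ ^+ 2) (fro2 X * _) => a b; lra.
Qed.

Lemma opnorm_le_fro m n (A : 'M[C]_(m, n)) : opnorm A <= Num.sqrt (fro2 A).
Proof.
apply: opnorm_le_fro2 => [|x]; first exact: sqrtr_ge0.
rewrite sqr_sqrtr ?fro2_ge0// [fro2 (A *m x)]fro2E [fro2 A]fro2E mulr_suml.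
apply: ler_sum => i _; rewrite big_ord1.
have -> : (A *m x) i 0 = hs ((row i A)^t* ) x.
  by rewrite hsE mxE; apply: eq_bigr => j _; rewrite big_ord1 !mxE conjCK.
apply: le_trans (hs_CauchySchwarz _ _) _; rewrite fro2_adj ler_wpM2r ?fro2_ge0//.
by rewrite fro2E big_ord1; apply: ler_sum => j _; rewrite mxE.
Qed.

(** [S] is the square root, by diagonalisation, of the hermitian part of [A]
    shifted by [d]; the shift makes it invertible. *)
Lemma hermitian_sqrt n (A : 'M[C]_n) (d : R) : 0 < d ->
  (forall x : 'cV[C]_n, 0 <= Re (hs x (A *m x))) ->
  exists2 S : 'M[C]_n, S \in unitmx & forall r (a : 'M[C]_(n, r)),
    fro2 (S *m a) = Re (hs a (A *m a)) + d * fro2 a.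
Proof.
move=> d0 A0.
pose H : 'M[C]_n := (2^-1)%:C *: (A + A^t* ) + d%:C%:M.
have HE r (a : 'M[C]_(n, r)) : Re (hs a (H *m a)) = Re (hs a (A *m a)) + d * fro2 a.
  rewrite mulmxDl hsDr creD -scalemxAl hsZr creZ mul_scalar_mx hsZr creZ; congr (_ + _).
  rewrite mulmxDl hsDr creD [hs a (A^t* *m a)]hs_mull trmxCK hsC creJ.
  by move: (Re _) => z; lra.
have Hh : H^t* = H.
  rewrite hadjD hadjZ conjR hadjD trmxCK addrC [A^t* + A]addrC addrC; congr (_ + _).
  by apply/matrixP => i j; rewrite !mxE eq_sym; case: eqP => _; rewrite ?mulr1n ?mulr0n ?conjR ?conjC0.
have Hn : H \is normalmx by apply/normalmxP; rewrite Hh.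
have /orthomx_spectralP := Hn.
set U := spectralmx H; set D := spectral_diag H => HD.
have Uu : U \is unitarymx by exact: spectral_unitarymx.
have UU : U *m U^t* = 1%:M by exact/unitarymxP.
have UU' : U^t* *m U = 1%:M by rewrite -invmx_unitary// mulVmx// unitarymx_unit.
have DE : diag_mx D = U *m H *m U^t*.
  by rewrite HD invmx_unitary// !mulmxA UU mul1mx -mulmxA UU mulmx1.
have Dpos i : exists2 s : R, 0 < s & D 0 i = (s ^+ 2)%:C.
  have e : D 0 i = hs (U^t* *m delta_mx i (0 : 'I_1)) (H *m (U^t* *m delta_mx i 0)).
    rewrite -hs_mull mulmxA mulmxA -DE hsE (bigD1 i)//= big_ord1.
    rewrite big1 ?addr0 => [|k ki].
      rewrite !mxE !eqxx conjC1 mul1r (bigD1 i)//= !mxE !eqxx mulr1n mulr1 big1 ?addr0// => k ki.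
      by rewrite !mxE (negbTE ki) /= mulr0.
    by rewrite big_ord1 [delta_mx _ _ k _]mxE (negbTE ki) conjC0 mul0r.
  have im : Im (D 0 i) = 0.
    rewrite e; set x := U^t* *m _.
    have := congr1 (@complex.Im R) (hsC x (H *m x)); rewrite cimJ -{1}Hh -hs_mull.
    by move: (Im _) => z; lra.
  have re : 0 < Re (D 0 i).
    rewrite e HE; apply: ltr_wpDl; first exact: A0.
    apply: mulr_gt0 => //; rewrite /fro2 -hs_mull mulmxA UU mul1mx -/(fro2 _) fro2E.
    rewrite (bigD1 i)//= big_ord1 mxE !eqxx Normc.normc1 expr1n.
    by apply: ltr_wpDr => //; apply: sumr_ge0 => k _; rewrite big_ord1 sqr_ge0.
  exists (Num.sqrt (Re (D 0 i))); first by rewrite sqrtr_gt0.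
  rewrite sqr_sqrtr ?ltW//; apply: complex_ext => //.
have [s s0 sE] : exists2 s : 'I_n -> R, forall i, 0 < s i & forall i, D 0 i = (s i ^+ 2)%:C.
  have /choice[s sP] : forall i, exists s : R, 0 < s /\ D 0 i = (s ^+ 2)%:C.
    by move=> i; have [s] := Dpos i; exists s.
  by exists s => i; have [] := sP i.
pose E : 'M[C]_n := diag_mx (\row_i (s i)%:C).
have EE : E^t* *m E = diag_mx D.
  have -> : E^t* = E.
    rewrite /E tr_diag_mx; apply/matrixP => i j; rewrite !mxE.
    by case: eqP => _; rewrite ?mulr1n ?mulr0n ?conjR ?conjC0.
  rewrite /E mulmx_diag; congr diag_mx; apply/rowP => i.
  by rewrite !mxE sE expr2 rmorphM.
exists (E *m U).
  rewrite unitmx_mul; apply/andP; split; last exact: unitarymx_unit.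
  rewrite unitmxE det_diag unitfE.
  apply/prodf_neq0 => i _; rewrite mxE.
  by apply/eqP => /(congr1 (@complex.Re R)) /= s00; have := s0 i; rewrite s00 ltxx.
move=> r a; rewrite -HE.
have -> : H = (E *m U)^t* *m (E *m U).
  by rewrite hadj_mul mulmxA -[_ *m _ *m E]mulmxA EE DE !mulmxA UU' mul1mx -mulmxA UU' mulmx1.
by have := hs_mull a ((E *m U)^t* ) (E *m U *m a); rewrite trmxCK mulmxA => ->.
Qed.

End OpnormSublinear.

(** * Factorisation of bounded functionals on matrices *)

Section Factorization.
Variables (R : realType) (W : lmodType R[i]) (N : forall n, 'M[W]_n -> R).
Local Notation C := R[i].
Hypothesis osN : operator_space_norm N.

Lemma linear_trace n (f : 'M[C]_n -> C) :
  (forall (c : C) A B, f (c *: A + B) = c * f A + f B) ->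
  exists L : 'M[C]_n, forall m (a : 'M[C]_(n, m)), f (a *m a^t* ) = hs a (L *m a).
Proof.
move=> flin.
exists (\matrix_(i, j) f (delta_mx j i)) => m a.
rewrite /hs mxtrace_mulC -mulmxA mxtrace_mulC.
set A := a *m a^t*; rewrite [in LHS](matrix_sum_delta A).
rewrite (big_lin2 flin); apply: eq_bigr => i _; rewrite mxE.
by apply: eq_bigr => j _; congr (_ * _); rewrite [RHS]mxE.
Qed.

Definition pairing n (G : 'I_n -> 'I_n -> W -> C) (x : 'M[W]_n) : C :=
  \sum_k \sum_l G k l (x k l).

Variables (n : nat) (G : 'I_n -> 'I_n -> W -> C).
Hypothesis Glin : forall k l (c : C) x y, G k l (c *: x + y) = c * G k l x + G k l y.

Lemma pairing_lin (c : C) (x y : 'M[W]_n) :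
  pairing G (mscale c x + y) = c * pairing G x + pairing G y.
Proof.
rewrite /pairing mulr_sumr -big_split; apply: eq_bigr => k _.
rewrite mulr_sumr -big_split; apply: eq_bigr => l _.
by rewrite !mxE Glin.
Qed.

Lemma pairing0 : pairing G 0 = 0.
Proof.
have := pairing_lin (-1) 0 0; rewrite mulN1r addNr => <-; congr (pairing G).
by apply/matrixP => i j; rewrite !mxE scaler0 addr0.
Qed.

Lemma pairingD x y : pairing G (x + y) = pairing G x + pairing G y.
Proof.
rewrite -[pairing G x]mul1r -pairing_lin; congr (pairing G (_ + _)).
by apply/matrixP => i j; rewrite !mxE scale1r.
Qed.

Lemma pairingZ c x : pairing G (mscale c x) = c * pairing G x.
Proof. by have := pairing_lin c x 0; rewrite !addr0 pairing0 addr0. Qed.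

Variable t : R.
Hypothesis t0 : 0 <= t.
Hypothesis Gt : forall x : 'M[W]_n, N x <= 1 -> Re (pairing G x) <= t.

Lemma pairing_le x : Re (pairing G x) <= t * N x.
Proof.
have [x0|x0] := eqVneq (N x) 0.
  by rewrite (osn_eq0 osN x0) pairing0 osn0// mulr0.
have xp : 0 < N x by rewrite lt_neqAle eq_sym x0 (osn_ge0 osN).
have /Gt : N (mscale (N x)^-1%:C x) <= 1.
  by rewrite (osn_scale osN) normcR gtr0_norm ?invr_gt0// mulVf.
by rewrite pairingZ creZ mulrC ler_pdivrMr.
Qed.

Lemma sqrt_amgm (p q : R) : 0 <= p -> 0 <= q ->
  2 * (Num.sqrt p * Num.sqrt q) <= p + q.
Proof.
move=> p0 q0; have := sqr_ge0 (Num.sqrt p - Num.sqrt q).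
by rewrite sqrrB !sqr_sqrtr//; move: (Num.sqrt p * _) => z; lra.
Qed.

Lemma shift_bound (o1 o2 o3 o4 p q z : R) : 0 <= t ->
  p - o1 <= o3 -> q - o2 <= o4 -> z <= t * (p + q) ->
  - (t * (o1 + o2)) <= t * (o3 + o4) - z.
Proof.
move=> tt h1 h2 h3; have := ler_wpM2l tt (lerD h1 h2); move: h3.
by rewrite !mulrDr !mulrN; lra.
Qed.

Lemma merge_bound (o1 o2 p1 p2 q1 q2 z w : R) : o1 <= p1 + q1 -> o2 <= p2 + q2 ->
  t * (o1 + o2) - 2 * (z + w) <= t * (p1 + p2) - 2 * z + (t * (q1 + q2) - 2 * w).
Proof.
by move=> h1 h2; have := ler_wpM2l t0 (lerD h1 h2); rewrite !mulrDr; lra.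
Qed.

Lemma pairing_amul_le r (a : 'M[C]_(n, r)) (v : 'M[W]_r) (b : 'M[C]_(r, n)) : N v <= 1 ->
  2 * Re (pairing G (amul a v b)) <= t * (opnorm (a *m a^t* ) + opnorm (b^t* *m b)).
Proof.
move=> vN; set p := opnorm _; set q := opnorm _.
have p0 : 0 <= p by exact: opnorm_ge0.
have q0 : 0 <= q by exact: opnorm_ge0.
have Nx : N (amul a v b) <= Num.sqrt p * Num.sqrt q.
  apply: le_trans (osn_bimodule osN _ _ _) _.
  apply: ler_pM (opnorm_sqr_le_col b); rewrite ?mulr_ge0 ?opnorm_ge0 ?(osn_ge0 osN)//.
  apply: le_trans (opnorm_sqr_le_row a).
  by rewrite ler_piMr// opnorm_ge0.
have tN := le_trans (pairing_le _) (ler_wpM2l t0 Nx).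
have pq := sqrt_amgm p0 q0.
apply: le_trans (ler_wpM2l t0 pq); rewrite mulrCA ler_pM2l//.
Qed.

(** The duality behind the operator space version of the Hahn-Banach theorem.
    The quadratic data [(a a^*, b^* b, pairing G (a v b))] form a convex cone,
    because direct sums add them up, so a sandwich argument produces a linear
    functional on pairs of matrices, i.e. two positive matrices. Their square
    roots, after a small shift, are [S] and the adjoint of [T]. *)
Lemma pairing_factor (d : R) : 0 < d ->
  exists S T : 'M[C]_n, [/\ S \in unitmx, T \in unitmx,
    fro2 S + fro2 T <= 2 * t + d &
    forall r (a : 'M[C]_(n, r)) (v : 'M[W]_r) (b : 'M[C]_(r, n)), N v <= 1 ->
      2 * Re (pairing G (amul a v b)) <= fro2 (S *m a) + fro2 (b *m T)].
Proof.
move=> d0.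
pose I := {r : nat & ('M[C]_(n, r) * 'M[W]_r * 'M[C]_(r, n))%type}.
pose mk r a v b : I := existT (fun r => ('M[C]_(n, r) * 'M[W]_r * 'M[C]_(r, n))%type) r (a, v, b).
pose D : set I := [set i | N (projT2 i).1.2 <= 1].
pose U : lmodType C := ('M[C]_n * 'M[C]_n)%type.
pose P (i : I) (x : U) : R :=
  t * (opnorm (x.1 + (projT2 i).1.1 *m (projT2 i).1.1^t* ) +
       opnorm (x.2 + (projT2 i).2^t* *m (projT2 i).2)) -
  2 * Re (pairing G (amul (projT2 i).1.1 (projT2 i).1.2 (projT2 i).2)).
pose b (x : U) : R := - (t * (opnorm x.1 + opnorm x.2)).
have opB (A B : 'M[C]_n) : opnorm B - opnorm A <= opnorm (A + B).
  by have := opnormD (A + B) (- A); rewrite opnormN addrAC subrr add0r -lerBlDr.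
have bP i x : D i -> b x <= P i x.
  case: i => r [[a v] c]; rewrite /D /= => vN; rewrite /P /b /=.
  apply: (shift_bound t0 (opB x.1 (a *m a^t* )) (opB x.2 (c^t* *m c))).
  exact: pairing_amul_le.
pose i0 : I := mk 0%N 0 0 0.
have D0 : D i0 by rewrite /D/= osn0.
have P0E x : P i0 x = t * (opnorm x.1 + opnorm x.2).
  by rewrite /P /= !mul0mx mulmx0 !addr0 amul0 pairing0 mulr0 subr0.
(* An index is rescaled by [sqrt s] on both sides, and two indices are added by
   their direct sum. *)
have ps : sublinear (fun x => inf [set P i x | i in D]).
  apply: (@sublinear_inf _ U _ _ _ b) => //; first by exists i0.
  - move=> [r [[a v] c]] s x vN s0; rewrite /D/= in vN.
    have ss : Num.sqrt s * Num.sqrt s = s by rewrite -expr2 sqr_sqrtr// ltW.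
    exists (mk r ((Num.sqrt s)%:C *: a) v ((Num.sqrt s)%:C *: c)); first by [].
    rewrite /P /= !hadjZ !conjR -!scalemxAl -!scalemxAr !scalerA -rmorphM ss -!scalerDr.
    have -> : amul ((Num.sqrt s)%:C *: a) v ((Num.sqrt s)%:C *: c) =
        mscale s%:C (amul a v c).
      by rewrite amulZ -rmorphM ss.
    rewrite pairingZ creZ mulrBr [2 * (s * _)]mulrCA lerD2r mulrCA ler_wpM2l//.
    by rewrite mulrDr lerD// opnormZ_le// ltW.
  - move=> [r [[a v] c]] [r' [[a' v'] c']] x y vN vN'; rewrite /D/= in vN vN'.
    exists (mk (r + r')%N (row_mx a a') (block_mx v 0 0 v') (col_mx c c')).
      by rewrite /D/= (osn_sum osN) ge_max vN vN'.
    rewrite /P /= tr_row_mx map_col_mx mul_row_col tr_col_mx map_row_mx mul_row_col.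
    rewrite amul_block !amul0 addr0 add0r pairingD creD.
    by apply: merge_bound; rewrite addrACA opnormD.
  - by move=> i Di; rewrite (le_trans _ (bP i 0 Di))// /b /= !opnorm0 addr0 mulr0 oppr0.
  - by move=> e e0; exists i0 => //; rewrite P0E /= !opnorm0 addr0 mulr0 ltW.
have lbP x : has_lbound [set P i x | i in D].
  by exists (b x) => _ [i Di <-]; exact: bP.
have [phi [philin phip]] := hahn_banach ps.
have phiP i x : D i -> Re (phi x) <= P i x.
  by move=> Di; apply: le_trans (phip x) _; apply: (inf_lbound (lbP x)); exists i.
have phi1 (c : C) A B : phi (c *: A + B, 0) = c * phi (A, 0) + phi (B, 0).
  by rewrite -philin; congr phi; congr (_, _) => /=; rewrite scaler0 addr0.
have phi2 (c : C) A B : phi (0, c *: A + B) = c * phi (0, A) + phi (0, B).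
  by rewrite -philin; congr phi; congr (_, _) => /=; rewrite scaler0 addr0.
have [L1 L1E] := linear_trace phi1.
have [L2 L2E] := linear_trace phi2.
have phiD A B : phi (A, B) = phi (A, 0) + phi (0, B).
  have := philin 1 (A, 0) (0, B); rewrite scale1r mul1r => <-.
  by congr phi; congr (_, _) => /=; rewrite ?addr0 ?add0r.
have key r (a : 'M[C]_(n, r)) (v : 'M[W]_r) (c : 'M[C]_(r, n)) : N v <= 1 ->
    2 * Re (pairing G (amul a v c)) <= Re (hs a (L1 *m a)) + Re (hs (c^t* ) (L2 *m c^t* )).
  move=> vN; rewrite -L1E -L2E trmxCK -creD -phiD.
  have := @phiP (mk r a v c) (- (a *m a^t* ), - (c^t* *m c)) vN.
  rewrite /P /= !addNr !opnorm0 addr0 mulr0 sub0r.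
  have -> : phi (- (a *m a^t* ), - (c^t* *m c)) = - phi (a *m a^t*, c^t* *m c).
    exact: (linN philin (a *m a^t*, c^t* *m c)).
  by rewrite creN lerN2.
have n0 : 0 < 2 * (n%:R + 1) :> R by rewrite mulr_gt0// ltr_wpDl.
pose dl := d / (2 * (n%:R + 1)).
have dl0 : 0 < dl by rewrite divr_gt0.
have N10 : N (0 : 'M[W]_1) <= 1 by rewrite osn0.
(* The hermitian part of [L1] is positive: take [v = 0] in [key]. *)
have [x|S Su SE] := @hermitian_sqrt R n L1 dl dl0.
  have := key 1%N x 0 0 N10.
  by rewrite amul0 pairing0 /= mulr0 trmx0 map_mx0 /hs !mulmx0 mxtrace0 /= addr0.
have [x|T Tu TE] := @hermitian_sqrt R n L2 dl dl0.
  have := key 1%N 0 0 (x^t* ) N10.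
  by rewrite amul0 pairing0 /= mulr0 trmxCK /hs !mulmx0 mxtrace0 /= add0r.
exists S, (T^t* ); split=> //.
- have TV : T^t* *m (invmx T)^t* = 1%:M.
    by rewrite -hadj_mul mulVmx// hadj1.
  exact: (mulmx1_unit TV).1.
- rewrite fro2_adj -[S]mulmx1 -[T]mulmx1 SE TE -L1E -L2E hadj1 mulmx1 addrACA -creD -phiD.
  have f1 : fro2 (1%:M : 'M[C]_n) = n%:R.
    by rewrite /fro2 /hs hadj1 mul1mx mxtrace1 -(rmorph_nat (real_complex R)).
  rewrite lerD//.
    rewrite (le_trans (phiP i0 _ D0))// P0E mulrC ler_wpM2r//.
    by rewrite -[2]/(1 + 1) lerD// opnorm1.
  have dlE : dl * (2 * (n%:R + 1)) = d by rewrite /dl divfK// gt_eqF.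
  have E (z m : R) : 0 < z -> z * (2 * (m + 1)) = d -> z * m + z * m <= d.
    by move=> z0 <-; rewrite mulrCA mulrDr mulr1; lra.
  by rewrite f1; exact: E.
move=> r a v c vN; rewrite -[fro2 (c *m _)]fro2_adj hadj_mul trmxCK SE TE.
apply: le_trans (key _ a v c vN) _.
by rewrite addrACA lerDl addr_ge0// mulr_ge0 ?fro2_ge0// ltW.
Qed.

End Factorization.

(** * The norm of matrices over the predual *)

Section Predual.
Variables (R : realType) (W : lmodType R[i]).
Local Notation C := R[i].
Variables (N : forall n, 'M[W]_n -> R) (star : W -> W) (nu : forall n, 'M[W]_n -> R).
Hypothesis osN : operator_space_norm N.
Hypothesis starI : involution star.
Hypothesis Nstar : forall n (v : 'M[W]_n), N (mxstar star v) = N v.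
Hypothesis nuD : forall u v : 'M[W]_1, nu (u + v) <= nu u + nu v.
Hypothesis nuZ : forall (c : C) (u : 'M[W]_1), nu (mscale c u) = normc c * nu u.
Hypothesis nu_star : forall u : 'M[W]_1, nu (mxstar star u) = nu u.

Local Notation K := (fun n => [set a : 'M[W]_n | N a <= 1]).
Local Notation A := (A0K nu star K).

(** Entrywise [nu]-compactness of the unit balls, phrased with ultrafilters. *)
Hypothesis Kcompact : forall n (F : set_system 'M[W]_n), UltraFilter F ->
  F [set x | N x <= 1] -> exists2 k : 'M[W]_n, N k <= 1 &
    forall eps : R, 0 < eps ->
      F [set x | forall i j, nu (const_mx (x i j - k i j) : 'M[W]_1) < eps].

Definition evA (F : A) (w : W) : C := ev N (A0K_val F) w.

Lemma A0K_isA0 (F : A) : isA0 N star nu F.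
Proof. by case: F => F /= /asboolP. Qed.

Lemma evA_linl w (c : C) (F G : A) : evA (c *: F + G) w = c * evA F w + evA G w.
Proof.
have -> : evA (c *: F + G) w = ev N (c *: A0K_val F + A0K_val G) w.
  by congr ev; exact: (linearP (val : A -> fam W)).
rewrite /evA /ev; set u := const_mx (_ *: _).
have -> : (c *: A0K_val F + A0K_val G) 1%N u 0 0 =
    c * A0K_val F u 0 0 + A0K_val G u 0 0.
  by rewrite -[LHS]/((c *: A0K_val F u + A0K_val G u) 0 0) !mxE.
by rewrite mulrDr mulrCA.
Qed.

Lemma evA_linr (F : A) (c : C) x y : evA F (c *: x + y) = c * evA F x + evA F y.
Proof. exact: (ev_lin osN starI Nstar c x y (A0K_isA0 F)). Qed.

Lemma evA0r (F : A) : evA F 0 = 0.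
Proof. exact: lin0 (evA_linr F). Qed.

Lemma evAB (F : A) x y : evA F (x - y) = evA F x - evA F y.
Proof. by rewrite addrC -scaleN1r evA_linr mulN1r addrC. Qed.

Lemma evAZ (F : A) c x : evA F (c *: x) = c * evA F x.
Proof. exact: linZ (evA_linr F) c x. Qed.

Lemma evA_cont (F : A) (k : W) : N (const_mx k : 'M[W]_1) <= 1 ->
  forall eps : R, 0 < eps -> exists2 del : R, 0 < del &
    forall w, N (const_mx w : 'M[W]_1) <= 1 -> nu (const_mx (w - k) : 'M[W]_1) < del ->
      normc (evA F w - evA F k) < eps.
Proof.
move=> kN eps e0.
have [del d0 H] := ev_cont osN starI Nstar nuD nuZ nu_star (A0K_isA0 F) kN e0.
exists del => // w wN wk; have := H (const_mx w) wN; rewrite !mxE; apply.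
by rewrite (_ : const_mx w - const_mx k = const_mx (w - k))//; apply/matrixP => i j; rewrite !mxE.
Qed.

(** If [F] were unbounded on the ball, some ultrafilter would eventually leave
    every sublevel set of [F]; but [F] is continuous at its limit. *)
Lemma evA_bounded (F : A) : exists2 M : R, 0 <= M &
  forall w, normc (evA F w) <= M * N (const_mx w : 'M[W]_1).
Proof.
have [[M HM]|nM] := pselect (exists M : R, forall w, N (const_mx w : 'M[W]_1) <= 1 ->
    normc (evA F w) <= M).
  have M0 : 0 <= M.
    have := HM 0; rewrite evA0r Normc.normc0; apply.
    by rewrite (_ : const_mx 0 = 0) ?osn0//; apply/matrixP => i j; rewrite !mxE.
  exists M => // w; set s := N _.
  have [s0|s0] := eqVneq s 0.
    have w0 : w = 0 by have /matrixP/(_ 0 0) := osn_eq0 osN s0; rewrite !mxE.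
    by rewrite w0 evA0r Normc.normc0 s0 mulr0.
  have sp : 0 < s by rewrite lt_neqAle eq_sym s0 /s (osn_ge0 osN).
  have := HM (s^-1%:C *: w); rewrite evAZ Normc.normcM normcR gtr0_norm ?invr_gt0//.
  by rewrite mulrC ler_pdivrMr//; apply; exact: N1_scale_le.
pose B (m : nat) : set 'M[W]_1 := [set x | N x <= 1 /\ m%:R < normc (evA F (x 0 0))].
have FB : ProperFilter (filter_from setT B).
  apply: filter_from_proper; last first.
    move=> m _; apply: contrapT => Bm; apply: nM; exists m%:R => w wN.
    rewrite leNgt; apply/negP => mw; apply: Bm; exists (const_mx w).
    by split=> //; rewrite mxE.
  apply: filter_from_filter; first by exists 0%N.
  move=> i j _ _; exists (maxn i j) => // x [xN xm].
  by split; split=> //; apply: le_lt_trans xm; rewrite ler_nat ?leq_maxl ?leq_maxr.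
have [U [UU UB]] := ultraFilterLemma FB.
have [|k kN Uk] := Kcompact UU.
  by apply: UB; exists 0%N => // x [].
have kN' : N (const_mx (k 0 0) : 'M[W]_1) <= 1 by rewrite -mx11_const.
have [del d0 Hd] := evA_cont F kN' ltr01.
pose m := Num.bound (normc (evA F (k 0 0)) + 1).
have UBm : U (B m) by apply: UB; exists m.
have [x [/= xk [xN xm]]] := filter_ex (filterI (Uk _ d0) UBm).
have : normc (evA F (x 0 0)) < m%:R.
  apply: (@lt_trans _ _ (normc (evA F (k 0 0)) + 1)); last first.
    by apply: archi_boundP; rewrite addr_ge0// normc_ge0.
  rewrite -ltrBlDl; apply: le_lt_trans _ (Hd (x 0 0) _ (xk 0 0)); last by rewrite -mx11_const.
  by rewrite lerBlDl -[X in normc X <= _](subrK (evA F (k 0 0))) addrC le_normcD.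
by rewrite ltNge (ltW xm).
Qed.

(** The positivity required of [s] in the definition of the norm of [F], as an
    inequality between quadratic forms: see [formboundP]. *)
Definition formbound r (F : 'M[A]_r) (s : R) : Prop :=
  forall n (v : 'M[W]_n), N v <= 1 -> forall X Y : 'M[C]_(n, r),
    2 * Re (pairing (fun i j => evA (F i j)) (amul (X^t* ) v Y)) <= s * (fro2 X + fro2 Y).

Lemma A0K_famform r (F : 'M[A]_r) n (v : 'M[W]_n) (X Y : 'M[C]_(n, r)) : N v <= 1 ->
  famform (map_mx (@A0K_val _ _ _ _ _) F) v X Y =
  pairing (fun i j => evA (F i j)) (amul (X^t* ) v Y).
Proof.
move=> vN; rewrite /famform /pairing.
transitivity (\sum_k \sum_i \sum_j \sum_l (X k i)^*%R * evA (F i j) (v k l) * Y l j).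
  apply: eq_bigr => k _; rewrite exchange_big; apply: eq_bigr => i _.
  rewrite exchange_big; apply: eq_bigr => j _; apply: eq_bigr => l _.
  by rewrite mxE (ev_entry osN starI Nstar k l (A0K_isA0 (F i j)) vN).
rewrite exchange_big; apply: eq_bigr => i _.
rewrite exchange_big; apply: eq_bigr => j _.
rewrite mxE.
rewrite (big_lin2 (evA_linr (F i j))); apply: eq_bigr => k _; apply: eq_bigr => l _.
by rewrite !mxE mulrAC.
Qed.

Lemma formboundP r (F : 'M[A]_r) (s : R) :
  fam_pos K (block_mx (mscale s%:C (mxunit (fam_one (W:=W)) r)) (map_mx (@A0K_val _ _ _ _ _) F)
    (mxstar (@fam_star R W) (map_mx (@A0K_val _ _ _ _ _) F))
    (mscale s%:C (mxunit (fam_one (W:=W)) r))) <-> formbound F s.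
Proof.
rewrite fam_posP; split=> H n v vN X Y; have := H n v vN X Y; by rewrite A0K_famform.
Qed.

Lemma A0K_norm_le r (F : 'M[A]_r) (s : R) : 0 < s -> formbound F s -> A0K_norm F <= s.
Proof.
move=> s0 Fs; rewrite /A0K_norm /sharp_norm /mnorm; apply: ge_inf.
  by exists 0 => t [/ltW].
by split=> //; apply/formboundP.
Qed.

(** The sum of the bounds of the entries is a crude but finite bound. *)
Lemma formbound_ex r (F : 'M[A]_r) : exists2 s : R, 0 < s & formbound F s.
Proof.
have /choice[M HM] : forall p : 'I_r * 'I_r, exists M : R, 0 <= M /\
    forall w, normc (evA (F p.1 p.2) w) <= M * N (const_mx w : 'M[W]_1).
  by move=> p; have [M M0 H] := evA_bounded (F p.1 p.2); exists M.
pose s := \sum_i \sum_j M (i, j).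
have s0 : 0 <= s by apply: sumr_ge0 => i _; apply: sumr_ge0 => j _; have [] := HM (i, j).
exists (s + 1); first by rewrite ltr_wpDl.
move=> n v vN X Y; set w := amul _ _ _.
have XY0 : 0 <= fro2 X + fro2 Y by rewrite addr_ge0// fro2_ge0.
have wN : 2 * N w <= fro2 X + fro2 Y.
  apply: le_trans (sqrt_amgm (fro2_ge0 X) (fro2_ge0 Y)); rewrite ler_pM2l//.
  apply: le_trans (osn_bimodule osN _ _ _) _.
  apply: ler_pM (opnorm_le_fro Y); rewrite ?mulr_ge0 ?opnorm_ge0 ?(osn_ge0 osN)//.
  rewrite -fro2_adj; apply: le_trans (opnorm_le_fro _).
  by rewrite ler_piMr// opnorm_ge0.
have Rw : Re (pairing (fun i j => evA (F i j)) w) <= s * N w.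
  rewrite Re_sum mulr_suml; apply: ler_sum => i _; rewrite Re_sum mulr_suml.
  apply: ler_sum => j _; apply: le_trans (Re_le_normc _) _.
  have [M0 H] := HM (i, j); apply: le_trans (H _) _; rewrite ler_wpM2l//.
  exact: osn_entry.
apply: (@le_trans _ _ (s * (2 * N w))); first by rewrite mulrCA ler_pM2l.
by apply: (le_trans (ler_wpM2l s0 wN)); rewrite ler_wpM2r// lerDl.
Qed.

(** The infimum defining the norm is attained, since a family of inequalities
    passes to the limit in [s]. *)
Lemma formbound_unit r (F : 'M[A]_r) : A0K_norm F <= 1 -> formbound F 1.
Proof.
move=> F1 n v vN X Y; apply/ler_addgt0Pr => d d0.
pose z := fro2 X + fro2 Y.
have z0 : 0 <= z by rewrite addr_ge0// fro2_ge0.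
have e0 : 0 < d / (z + 1) by rewrite divr_gt0// ltr_wpDl.
set E := (X in inf X <= 1) in F1.
have hiE : has_inf E.
  split; last by exists 0 => t [/ltW].
  have [s s0 Fs] := formbound_ex F; exists s; split=> //.
  exact/formboundP.
have [s [s0 /formboundP Fs] sE] := inf_adherent e0 hiE.
apply: le_trans (Fs n v vN X Y) _; rewrite -/z.
have : s <= 1 + d / (z + 1) by apply: ltW; apply: lt_le_trans sE _; rewrite lerD2r.
move=> /(ler_wpM2r z0)/le_trans -> //; rewrite mulrDl lerD2l.
by rewrite mulrAC ler_pdivrMr ?ltr_wpDl// ler_pM2l// lerDl.
Qed.

End Predual.

(** * The bipolar theorem *)

Section Transfer.
Variables (R : realType) (U W : lmodType R[i]) (B : U -> W -> R[i]).
Local Notation C := R[i].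
Hypothesis Bl : forall w (c : C) x y, B (c *: x + y) w = c * B x w + B y w.
Hypothesis Br : forall x (c : C) v w, B x (c *: v + w) = c * B x v + B x w.

(** Scalar coefficients pass from one side of the pairing to the other, where
    they appear transposed. *)
Lemma pairing_transfer m n (a : 'M[C]_(m, n)) (F : 'M[U]_n) (b : 'M[C]_(n, m))
    (w : 'M[W]_m) :
  pairing (fun i j => B (amul a F b i j)) w =
  pairing (fun k l => B (F k l)) (amul (a^T) w (b^T)).
Proof.
rewrite /pairing.
transitivity (\sum_i \sum_j \sum_k \sum_l (a i k * b l j) * B (F k l) (w i j)).
  apply: eq_bigr => i _; apply: eq_bigr => j _; rewrite mxE.
  by rewrite (big_lin2 (f := fun x => B x (w i j))).
transitivity (\sum_k \sum_l \sum_i \sum_j (a i k * b l j) * B (F k l) (w i j)).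
  under eq_bigr => i _ do rewrite exchange_big.
  rewrite exchange_big; apply: eq_bigr => k _.
  under eq_bigr => i _ do rewrite exchange_big.
  by rewrite exchange_big.
apply: eq_bigr => k _; apply: eq_bigr => l _; rewrite mxE.
rewrite (big_lin2 (f := B (F k l)))//; apply: eq_bigr => i _; apply: eq_bigr => j _.
by rewrite !mxE.
Qed.

End Transfer.

Lemma sum_lin4 (R : realType) I (r : seq I) (h1 h2 h3 h4 : I -> R) (c e : R) :
  \sum_(i <- r) (h1 i - c * (h2 i - h3 i) + e * h4 i) =
  \sum_(i <- r) h1 i - c * (\sum_(i <- r) h2 i - \sum_(i <- r) h3 i) +
  e * \sum_(i <- r) h4 i.
Proof. by rewrite big_split sumrB /= -!mulr_sumr sumrB. Qed.

Section Bipolar.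
Variables (R : realType) (W : lmodType R[i]).
Local Notation C := R[i].
Variables (N : forall n, 'M[W]_n -> R) (star : W -> W) (nu : forall n, 'M[W]_n -> R).
Hypothesis osN : operator_space_norm N.
Hypothesis starI : involution star.
Hypothesis Nstar : forall n (v : 'M[W]_n), N (mxstar star v) = N v.
Hypothesis nuD : forall u v : 'M[W]_1, nu (u + v) <= nu u + nu v.
Hypothesis nuZ : forall (c : C) (u : 'M[W]_1), nu (mscale c u) = normc c * nu u.
Hypothesis nu_star : forall u : 'M[W]_1, nu (mxstar star u) = nu u.

Local Notation K := (fun n => [set a : 'M[W]_n | N a <= 1]).
Local Notation A := (A0K nu star K).

Hypothesis Kcompact : forall n (F : set_system 'M[W]_n), UltraFilter F ->
  F [set x | N x <= 1] -> exists2 k : 'M[W]_n, N k <= 1 &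
    forall eps : R, 0 < eps ->
      F [set x | forall i j, nu (const_mx (x i j - k i j) : 'M[W]_1) < eps].

Local Notation evl := (evA_linl (N := N) (star := star) (nu := nu)).
Local Notation evr := (evA_linr osN starI Nstar).

Variables (n : nat) (f : 'I_n -> 'I_n -> A -> C).
Hypothesis flin : forall i j (c : C) F G, f i j (c *: F + G) = c * f i j F + f i j G.
Hypothesis fball : forall F : 'M[A]_n, A0K_norm F <= 1 -> forall X Y : 'M[C]_n,
  2 * Re (pairing f (amul X F Y)) <= fro2 X + fro2 Y.

(** By [pairing_factor], [G] is [S^T F T^T] where [F] lies in the unit ball of
    the matrices over [A] and the sizes of [S] and [T] are controlled by [tau];
    and [f] is contractive at [F]. *)
Lemma pairing_polar (G : 'M[A]_n) (tau : R) : 0 <= tau ->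
  (forall y : 'M[W]_n, N y <= 1 -> Re (pairing (fun i j => evA (G i j)) y) <= tau) ->
  Re (pairing f G) <= tau.
Proof.
move=> tau0 Gtau; apply/ler_addgt0Pr => d d0.
have Glin i j (c : C) x y : evA (G i j) (c *: x + y) = c * evA (G i j) x + evA (G i j) y.
  exact: evr.
have d20 : 0 < d * 2 by rewrite mulr_gt0.
have [S [T [Su Tu ST GST]]] := pairing_factor osN Glin tau0 Gtau d20.
pose F := amul (invmx S)^T G (invmx T)^T.
have F1 : A0K_norm F <= 1.
  apply: (A0K_norm_le osN starI Nstar) => // m v vN X Y; rewrite mul1r.
  rewrite (pairing_transfer evl evr) !trmxK amulA.
  apply: le_trans (GST _ _ _ _ vN) _.
  by rewrite !mulmxA mulmxV// mul1mx -mulmxA mulVmx// mulmx1 fro2_adj.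
have := fball F1 (S^T) (T^T).
rewrite /F amulA -!trmx_mul mulVmx// mulmxV// trmx1 amul_1.
rewrite !fro2_tr => H; have := le_trans H ST.
by move: (Re _) => z; lra.
Qed.

(** A near-minimiser of the distance from [f] to the evaluations at points of
    the ball satisfies an approximate variational inequality, and its
    right-hand side is controlled by [pairing_polar]. *)
Lemma bipolar_finite (s : seq A) (eps : R) : 0 < eps ->
  exists2 x : 'M[W]_n, N x <= 1 & forall F i j, F \in s ->
    normc (evA F (x i j) - f i j F) < eps.
Proof.
move=> eps0.
pose J (x : 'M[W]_n) : R :=
  \sum_(F <- s) \sum_i \sum_j normc (f i j F - evA F (x i j)) ^+ 2.
have J0 x : 0 <= J x.
  by apply: sumr_ge0 => F _; do 2!apply: sumr_ge0 => ? _; exact: sqr_ge0.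
pose E := [set J x | x in [set x | N x <= 1]].
have hE : has_inf E.
  split; first by exists (J 0), 0 => //=; rewrite osn0.
  by exists 0 => _ [x _ <-].
have Ele x : N x <= 1 -> inf E <= J x.
  by move=> xN; apply: (inf_lbound hE.2); exists x.
suff E0 : inf E <= 0.
  have e2 : 0 < eps ^+ 2 by rewrite exprn_gt0.
  have [_ [x xN <-] Jx] := inf_adherent e2 hE.
  exists x => // F i j Fs; rewrite normcB -ltr_sqr ?nnegrE ?normc_ge0 ?(ltW eps0)//.
  apply: le_lt_trans (_ : J x < _); last first.
    by apply: lt_le_trans Jx _; rewrite gerDr.
  rewrite /J (big_rem F)//= -[X in X <= _]addr0 lerD//; last first.
    by apply: sumr_ge0 => G _; do 2!apply: sumr_ge0 => ? _; exact: sqr_ge0.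
  rewrite (bigD1 i)//= -[X in X <= _]addr0 lerD//; last first.
    by do 2!apply: sumr_ge0 => ? _; exact: sqr_ge0.
  rewrite (bigD1 j)//= -[X in X <= _]addr0 lerD//.
  by apply: sumr_ge0 => ? _; exact: sqr_ge0.
rewrite leNgt; apply/negP => d0; set d := inf E in d0 Ele.
pose B (z : 'M[W]_n) : R := \sum_(F <- s) \sum_i \sum_j normc (evA F (z i j)) ^+ 2.
have [M M0 MB] : exists2 M : R, 0 < M & forall x y : 'M[W]_n, N x <= 1 -> N y <= 1 ->
    B (y - x) <= M.
  have /choice[b bP] : forall F : A, exists b : R, 0 <= b /\
      forall w, normc (evA F w) <= b * N (const_mx w : 'M[W]_1).
    move=> F; have [b b0 H] := evA_bounded osN starI Nstar nuD nuZ nu_star Kcompact F.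
    by exists b.
  pose M := \sum_(F <- s) \sum_(i < n) \sum_(j < n) (b F * 2) ^+ 2.
  have M0 : 0 <= M by apply: sumr_ge0 => F _; do 2!apply: sumr_ge0 => ? _; exact: sqr_ge0.
  exists (M + 1); first by rewrite ltr_wpDl.
  move=> x y xN yN; apply: (@le_trans _ _ M); last by rewrite lerDl.
  apply: ler_sum => F _; do 2!apply: ler_sum => ? _.
  have [b0 H] := bP F.
  rewrite ler_sqr ?nnegrE ?normc_ge0 ?mulr_ge0//; apply: le_trans (H _) _.
  rewrite ler_wpM2l//; apply: le_trans (osn_entry osN _ _ _) _.
  apply: le_trans (osn_triangle osN _ _) _; rewrite osnN//.
  by move: (N x) (N y) xN yN => p q; lra.
pose t := Num.min 1 (d / (2 * M)).
have t0 : 0 < t by rewrite lt_min ltr01 divr_gt0// mulr_gt0.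
have t1 : t <= 1 by rewrite ge_min lexx.
have tM : t * M <= d / 2.
  have : t <= d / (2 * M) by rewrite ge_min lexx orbT.
  by rewrite ler_pdivlMr ?mulr_gt0// mulrCA; move: (t * M) => z; lra.
have td0 : 0 < t * (d / 2) by rewrite mulr_gt0// divr_gt0.
have [_ [x xN <-] Jx] := inf_adherent td0 hE; rewrite -/d in Jx.
pose G : 'M[A]_n := \matrix_(i, j) \sum_(F <- s) ((f i j F - evA F (x i j))^*%R *: F).
have rhoE y : Re (pairing (fun i j => evA (G i j)) y) =
    \sum_(F <- s) \sum_i \sum_j Re ((f i j F - evA F (x i j))^*%R * evA F (y i j)).
  rewrite Re_sum; under eq_bigr => i _ do rewrite Re_sum.
  rewrite exchange_big /=; under [RHS]eq_bigr => F _ do rewrite exchange_big.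
  rewrite [RHS]exchange_big /=; apply: eq_bigr => j _.
  rewrite [RHS]exchange_big /=; apply: eq_bigr => i _.
  by rewrite mxE (big_lin (f := fun F => evA F (y i j)))// ?Re_sum// => *; exact: evl.
have fGE : Re (pairing f G) =
    \sum_(F <- s) \sum_i \sum_j Re ((f i j F - evA F (x i j))^*%R * f i j F).
  rewrite Re_sum; under eq_bigr => i _ do rewrite Re_sum.
  rewrite exchange_big /=; under [RHS]eq_bigr => F _ do rewrite exchange_big.
  rewrite [RHS]exchange_big /=; apply: eq_bigr => j _.
  rewrite [RHS]exchange_big /=; apply: eq_bigr => i _.
  by rewrite mxE (big_lin (f := f i j))// Re_sum.
have JE : Re (pairing f G) = Re (pairing (fun i j => evA (G i j)) x) + J x.
  rewrite fGE rhoE /J -big_split; apply: eq_bigr => F _; rewrite -big_split.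
  apply: eq_bigr => i _; rewrite -big_split; apply: eq_bigr => j _.
  rewrite sqr_normcE; move: (f i j F) (evA F _) => [a b] [p q] /=; ring.
(* Moving from [x] towards [y] by [t] changes [J] at first order by
   [- 2 t Re <G, y - x>] and at second order by at most [t^2 M]; since [x] nearly
   minimises [J], the first order term cannot be very negative. *)
have Gx y : N y <= 1 -> Re (pairing (fun i j => evA (G i j)) y) <=
    Re (pairing (fun i j => evA (G i j)) x) + d / 2.
  move=> yN; pose z := mscale (1 - t)%:C x + mscale t%:C y.
  have zN : N z <= 1.
    apply: le_trans (osn_triangle osN _ _) _; rewrite !(osn_scale osN) !normcR.
    rewrite !ger0_norm ?subr_ge0 ?(ltW t0)//.
    apply: le_trans (lerD (ler_wpM2l _ xN) (ler_wpM2l (ltW t0) yN)) _.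
      by rewrite subr_ge0.
    by rewrite !mulr1 subrK.
  have Jz : J z = J x - 2 * t * (Re (pairing (fun i j => evA (G i j)) y) -
      Re (pairing (fun i j => evA (G i j)) x)) + t ^+ 2 * B (y - x).
    rewrite !rhoE /J /B -sum_lin4; apply: eq_bigr => F _.
    rewrite -sum_lin4; apply: eq_bigr => i _; rewrite -sum_lin4; apply: eq_bigr => j _.
    have -> : z i j = (1 - t)%:C *: x i j + t%:C *: y i j by rewrite !mxE.
    have -> : (y - x) i j = y i j - x i j by rewrite !mxE.
    rewrite evr (evAZ osN starI Nstar) (evAB osN starI Nstar) !sqr_normcE.
    move: (f i j F) (evA F (x i j)) (evA F (y i j)) => [a a'] [p p'] [q q'] /=; ring.
  have := Ele z zN; rewrite Jz -lerBlDl => H1.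
  have H2 := ler_wpM2l (sqr_ge0 t) (MB x y xN yN).
  have H3 := ler_wpM2l (ltW t0) tM.
  rewrite -(ler_pM2l t0); move: H1 H2 H3 Jx.
  move: (Re _) (Re _) (B _) (J x) (d) => ry rx b j q; rewrite expr2; nra.
have tau0 : 0 <= Re (pairing (fun i j => evA (G i j)) x) + d / 2.
  apply: le_trans (Gx 0 _); last by rewrite osn0.
  rewrite Re_sum; apply: sumr_ge0 => i _; rewrite Re_sum; apply: sumr_ge0 => j _.
  by have -> : (0 : 'M[W]_n) i j = 0; [rewrite mxE|rewrite (evA0r osN starI Nstar)].
have := pairing_polar tau0 Gx; rewrite JE lerD2l => Jd.
have := le_trans (Ele x xN) Jd; move: d0; move: (d) => q; lra.
Qed.

(** Compactness turns the approximate points of [bipolar_finite] into an exact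
    one. *)
Theorem bipolar : exists2 k : 'M[W]_n, N k <= 1 &
  forall i j F, f i j F = evA F (k i j).
Proof.
pose Bs (p : seq A * R) : set 'M[W]_n := [set x | N x <= 1 /\
  forall F i j, F \in p.1 -> normc (evA F (x i j) - f i j F) < p.2].
have FB : ProperFilter (filter_from [set p | 0 < p.2] Bs).
  apply: filter_from_proper; last first.
    by move=> [s eps] /= e0; have [x xN xs] := bipolar_finite s e0; exists x.
  apply: filter_from_filter; first by exists ([::], 1); rewrite /=.
  move=> [s1 e1] [s2 e2] /= e10 e20; exists (s1 ++ s2, Num.min e1 e2).
    by rewrite /= lt_min e10.
  move=> x [xN H]; split; split=> // F i j Fs.
    by have := H F i j; rewrite /= mem_cat Fs lt_min => /(_ isT) /andP[].
  by have := H F i j; rewrite /= mem_cat Fs orbT lt_min => /(_ isT) /andP[].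
have [U [UU UB]] := ultraFilterLemma FB.
have [|k kN Uk] := Kcompact UU.
  by apply: UB; exists ([::], 1) => [|x []]; [exact: ltr01|].
exists k => // i j F.
have kijN : N (const_mx (k i j) : 'M[W]_1) <= 1 by exact: le_trans (osn_entry osN _ _ _) kN.
apply/eqP; rewrite -subr_eq0; apply/eqP/Normc.eq0_normc/eqP.
rewrite eq_le normc_ge0 andbT; apply/ler_addgt0Pr => e e0; rewrite add0r.
have e20 : 0 < e / 2 by rewrite divr_gt0.
have [del d0 Hd] := evA_cont osN starI Nstar nuD nuZ nu_star F kijN e20.
have Us : U (Bs ([:: F], e / 2)) by apply: UB; exists ([:: F], e / 2).
have [x [/= xk [xN xF]]] := filter_ex (filterI (Uk _ d0) Us).
have xijN : N (const_mx (x i j) : 'M[W]_1) <= 1 by exact: le_trans (osn_entry osN _ _ _) xN.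
have -> : f i j F - evA F (k i j) = - (evA F (x i j) - f i j F) + (evA F (x i j) - evA F (k i j)).
  by rewrite opprB addrA subrK.
apply: le_trans (le_normcD _ _) _; rewrite normcN [e]splitr lerD//.
  by apply/ltW/xF; rewrite mem_head.
by apply: ltW; apply: Hd => //; exact: xk.
Qed.

End Bipolar.

(** * Limits along filters *)

Section Limits.
Variable R : realType.
Local Notation C := R[i].

Lemma ptws_cvg (U : Type) (V : topologicalType) (F : set_system (U -> V)) (f : U -> V) :
  Filter F -> (forall v, (fun g => g v) @ F --> f v) -> {ptws, F --> f}.
Proof.
move=> FF H; apply/cvg_sup => v A; rewrite nbhsE => -[B [[O Oo OB] Bf] BA].
apply: (filterS BA); rewrite -OB; apply: H.
by apply: open_nbhs_nbhs; split => //; rewrite -OB in Bf.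
Qed.

Lemma mx11_cvg (T : Type) (F : set_system T) (g : T -> 'M[C^o]_1) (M : 'M[C^o]_1) :
  Filter F -> (forall eps : R, 0 < eps -> F [set x | normc (g x 0 0 - M 0 0) < eps]) ->
  g @ F --> M.
Proof.
move=> FF H A /nbhs_ballP[e /= e0 eA].
have eE : e = (Re e)%:C by apply: complex_ext => //=; rewrite (ge0_Im (ltW e0)).
have re0 : 0 < Re e by move: e0; rewrite {1}eE ltcR.
change (F [set x | A (g x)]).
apply: filterS (H _ re0) => x gx; apply: eA; split=> // i j; rewrite !ord1.
rewrite -ball_normE /= eE normc_def ltcR.
have sqrtE (z : C) : Num.sqrt (Re z ^+ 2 + Im z ^+ 2) = normc z by case: z.
by rewrite (sqrtE (M 0 0 - g x 0 0 : C)) normcB.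
Qed.

(** The limit is the supremum of the numbers that are lower bounds of [h] along
    [U]. *)
Lemma ultra_real_lim (T : Type) (U : set_system T) (h : T -> R) (M : R) :
  UltraFilter U -> U [set x | `|h x| <= M] ->
  exists c : R, forall eps, 0 < eps -> U [set x | `|h x - c| < eps].
Proof.
move=> UU UM.
pose E := [set r | U [set x | r <= h x]].
have EM r : E r -> r <= M.
  move=> Er; have [x [/= rx hM]] := filter_ex (filterI Er UM).
  by apply: le_trans rx (le_trans (ler_norm _) hM).
have hE : has_sup E.
  split; last by exists M => r; exact: EM.
  exists (- M); apply: filterS UM => x /=; rewrite ler_norml => /andP[]//.
exists (sup E) => e e0.
have [r Er re] := sup_adherent e0 hE.
have nE : ~ E (sup E + e / 2).
  move=> /(sup_upper_bound hE); rewrite gerDl leNgt => /negP; apply.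
  by rewrite divr_gt0.
have [//|U2] := in_ultra_setVsetC [set x | sup E + e / 2 <= h x] UU.
apply: filterS (filterI Er U2) => x [/= rh /negP]; rewrite -ltNge => hr.
have e2 : e / 2 < e by rewrite ltr_pdivrMr// ltr_pMr// ltr1n.
by rewrite ltr_norml; apply/andP; split; move: re rh hr e2; move: (sup E) (h x) => s y; lra.
Qed.

Lemma ultra_lim (T : Type) (U : set_system T) (g : T -> C) (M : R) :
  UltraFilter U -> U [set x | normc (g x) <= M] ->
  exists c : C, forall eps : R, 0 < eps -> U [set x | normc (g x - c) < eps].
Proof.
move=> UU UM.
have [|a aP] := @ultra_real_lim T U (fun x => Re (g x)) M UU.
  by apply: filterS UM => x /=; apply: le_trans; exact: normr_Re_le.
have [|b bP] := @ultra_real_lim T U (fun x => Im (g x)) M UU.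
  by apply: filterS UM => x /=; apply: le_trans; exact: normr_Im_le.
exists (a +i* b) => e e0.
have e20 : 0 < e / 2 by rewrite divr_gt0.
apply: filterS (filterI (aP _ e20) (bP _ e20)) => x [/= xa xb].
apply: le_lt_trans (normc_leD _) _; rewrite creD cimD creN cimN /= [e]splitr.
exact: ltrD.
Qed.

Lemma normc_small (z : C) : (forall eps : R, 0 < eps -> normc z <= eps) -> z = 0.
Proof.
move=> H; apply: Normc.eq0_normc; apply/eqP; rewrite eq_le normc_ge0 andbT.
by apply/ler_addgt0Pr => e e0; rewrite add0r; exact: H.
Qed.

End Limits.

(** * Positive elements and their separation by states *)

Section States.
Variables (R : realType) (V : lmodType R[i]).
Local Notation C := R[i].
Variables (star : V -> V) (e : V) (pos : forall n, set 'M[V]_n).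
Hypothesis M : matrix_order_unit_space star e pos.

Let starI : involution star := mous_involution M.
Let MO : matrix_ordered star pos := mous_ordered M.
Local Notation rpart := (rpart star).

Definition geq0 (v : V) : Prop := pos (const_mx v : 'M[V]_1).

Lemma mxunit1 : mxunit e 1 = const_mx e.
Proof. by apply/matrixP => i j; rewrite !mxE !ord1 eqxx scale1r. Qed.

Lemma geq0_sa v : geq0 v -> star v = v.
Proof. by move=> /(pos_sa MO)/matrixP/(_ 0 0); rewrite !mxE. Qed.

Lemma geq0_0 : geq0 0.
Proof.
rewrite /geq0; have -> : const_mx 0 = 0 :> 'M[V]_1 by apply/matrixP => i j; rewrite !mxE.
exact: (pos_0 MO).
Qed.

Lemma geq0D u v : geq0 u -> geq0 v -> geq0 (u + v).
Proof.
move=> u0 v0; rewrite /geq0.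
have -> : const_mx (u + v) = const_mx u + const_mx v :> 'M[V]_1.
  by apply/matrixP => i j; rewrite !mxE.
exact: (pos_add MO).
Qed.

Lemma geq0Z (t : R) v : 0 <= t -> geq0 v -> geq0 (t%:C *: v).
Proof. by move=> t0 v0; rewrite /geq0 -mscale_const; exact: (pos_scale MO). Qed.

Lemma geq0_anti v : geq0 v -> geq0 (- v) -> v = 0.
Proof.
move=> v0 v0'; have /matrixP/(_ 0 0) : const_mx v = 0 :> 'M[V]_1.
  apply: (pos_proper MO) => //.
  have -> : - const_mx v = const_mx (- v) :> 'M[V]_1 by apply/matrixP => i j; rewrite !mxE.
  by [].
by rewrite !mxE.
Qed.

Lemma geq0_e : geq0 e. Proof. by have := mous_unit_pos M; rewrite mxunit1. Qed.
Lemma star_e : star e = e. Proof. exact: geq0_sa geq0_e. Qed.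

Lemma order_unit v : star v = v -> exists2 t : R, 0 < t &
  geq0 (t%:C *: e + v) /\ geq0 (t%:C *: e - v).
Proof.
move=> sv; have [|t t0 []] := mous_unit M (v := const_mx v).
  by apply/matrixP => i j; rewrite !mxE.
rewrite mxunit1 mscale_const => H1 H2; exists t => //; split.
  by move: H1; congr pos; apply/matrixP => i j; rewrite !mxE.
by move: H2; congr pos; apply/matrixP => i j; rewrite !mxE.
Qed.

Lemma archimedean v : star v = v -> (forall t : R, 0 < t -> geq0 (t%:C *: e + v)) -> geq0 v.
Proof.
move=> sv H; apply: (mous_arch M) => [|t t0].
  by apply/matrixP => i j; rewrite !mxE.
by have := H t t0; congr pos; apply/matrixP => i j; rewrite mxunit1 !mxE.
Qed.

Lemma geq0_mono (s t : R) v : s <= t -> geq0 (s%:C *: e + v) -> geq0 (t%:C *: e + v).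
Proof.
move=> st H; have -> : t%:C *: e + v = (t - s)%:C *: e + (s%:C *: e + v).
  by rewrite addrA -scalerDl -rmorphD subrK.
by apply: geq0D => //; apply: geq0Z; rewrite ?subr_ge0//; exact: geq0_e.
Qed.

(** By the Archimedean property, [t0 e + v0] is not positive for some [t0 > 0].
    The infimum defining the sublinear functional already contains the ray
    through [v0], so that any functional it dominates is at most [- t0] there. *)
Lemma separating_functional v0 : star v0 = v0 -> ~ geq0 v0 ->
  exists phi : V -> C, [/\ (forall (c : C) x y, phi (c *: x + y) = c * phi x + phi y),
    phi e = 1, (forall v, geq0 v -> 0 <= phi v) & Re (phi v0) < 0].
Proof.
move=> s0 nv0.
have [t0 t00 nt0] : exists2 t0 : R, 0 < t0 & ~ geq0 (t0%:C *: e + v0).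
  apply: contrapT => H; apply: nv0; apply: archimedean => // t tp.
  by apply: contrapT => nt; apply: H; exists t.
pose S (v : V) : set R := [set r | exists s t : R, [/\ 0 <= s,
  geq0 (t%:C *: e + s%:C *: v0 - rpart v) & r = t - s * t0]].
have /choice[b bP] : forall v, exists b : R, forall r, S v r -> b <= r.
  move=> v; have [r r0 [_ rv]] := order_unit (rpart_sa starI (- v)).
  exists (- r) => _ [s [t [sp H ->]]].
  have : geq0 ((t + r)%:C *: e + s%:C *: v0).
    have -> : (t + r)%:C *: e + s%:C *: v0 =
        (t%:C *: e + s%:C *: v0 - rpart v) + (r%:C *: e - rpart (- v)).
      by rewrite (rpartN starI) opprK rmorphD scalerDl [RHS]addrACA addNr addr0 addrAC.
    exact: geq0D.
  move=> H2; rewrite leNgt; apply/negP => lt; apply: nt0.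
  have sp' : 0 < s \/ s = 0 by move: sp; rewrite le_eqVlt => /predU1P[<-|]; [right|left].
  case: sp' => [sp'|s00].
    apply: (@geq0_mono ((t + r) / s)).
      by rewrite ler_pdivrMr//; move: lt; rewrite [s * _]mulrC; lra.
    have -> : ((t + r) / s)%:C *: e + v0 = s^-1%:C *: ((t + r)%:C *: e + s%:C *: v0).
      rewrite scalerDr !scalerA -!rmorphM mulVf ?gt_eqF// rmorph1 scale1r.
      by rewrite [s^-1 * _]mulrC.
    by apply: geq0Z => //; rewrite invr_ge0.
  have tr : t + r < 0 by move: lt; rewrite s00 mul0r; lra.
  have e0 : e = 0.
    apply: geq0_anti; first exact: geq0_e.
    have -> : - e = (- (t + r)^-1)%:C *: ((t + r)%:C *: e + s%:C *: v0).
      rewrite s00 rmorph0 scale0r addr0 scalerA -rmorphM mulNr mulVf ?lt_eqF//.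
      by rewrite rmorphN1 scaleN1r.
    by apply: geq0Z => //; rewrite oppr_ge0 invr_le0 ltW.
  have [q q0 [vq _]] := order_unit s0.
  by rewrite e0 scaler0 add0r; rewrite e0 scaler0 add0r in vq.
have S00 : S 0 0.
  exists 0, 0; split=> //; last by rewrite mul0r subr0.
  by rewrite rmorph0 !scale0r addr0 add0r /rpart (star0 starI) addr0 scaler0 oppr0; exact: geq0_0.
have lbS v : has_lbound (S v) by exists (b v) => r; exact: bP.
have S0ge r : S 0 r -> 0 <= r.
  move=> Sr; rewrite leNgt; apply/negP => r0.
  have Sn (n : nat) : S 0 (n%:R * r).
    have [s [t [sp H rE]]] := Sr; exists (n%:R * s), (n%:R * t); split.
    - exact: mulr_ge0.
    - have -> : rpart 0 = n%:R%:C *: rpart 0 by rewrite -(rpartZ starI) scaler0.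
      by rewrite !rmorphM -!scalerA -scalerDr -scalerBr; exact: geq0Z.
    - by rewrite rE mulrBr mulrA.
  pose n := Num.bound (b 0 / r).
  have := bP 0 _ (Sn n); rewrite leNgt => /negP; apply.
  have : b 0 / r < n%:R.
    have b0 : b 0 <= 0 by exact: bP.
    by apply: archi_boundP; rewrite mulr_le0// invr_le0 ltW.
  by rewrite ltr_ndivrMr.
have subl : sublinear (fun v => inf (S v)).
  apply: (@sublinear_infimum _ _ _ b) => //.
  - move=> v; have [r r0 [_ rv]] := order_unit (rpart_sa starI v).
    by exists (r - 0 * t0), 0, r; rewrite scale0r addr0.
  - move=> t v _ tp [s [q [sp H ->]]]; exists (t * (q - s * t0)) => //.
    exists (t * s), (t * q); split; first by rewrite mulr_ge0// ltW.
      by rewrite (rpartZ starI) !rmorphM -!scalerA -scalerDr -scalerBr; apply: geq0Z => //; exact: ltW.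
    by rewrite mulrBr mulrA.
  - move=> u v _ _ [s [t [sp H ->]]] [s' [t' [sp' H' ->]]].
    exists (t - s * t0 + (t' - s' * t0)) => //; exists (s + s'), (t + t'); split.
    + exact: addr_ge0.
    + have -> : (t + t')%:C *: e + (s + s')%:C *: v0 - rpart (u + v) =
          t%:C *: e + s%:C *: v0 - rpart u + (t'%:C *: e + s'%:C *: v0 - rpart v).
        by rewrite (rpartD starI) !rmorphD !scalerDl opprD [RHS]addrACA [X in X + _ = _]addrACA.
      exact: geq0D.
    + by rewrite mulrDl opprD addrACA.
  - by move=> d d0; exists 0 => //; exact: ltW.
have [phi [philin phiS]] := hahn_banach subl.
have phile v r : S v r -> Re (phi v) <= r.
  by move=> Sr; apply: le_trans (phiS v) _; exact: (inf_lbound (lbS v)).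
have phiN := linN philin.
have phi_pos v : geq0 v -> 0 <= Re (phi v).
  move=> vp; rewrite -oppr_le0 -creN -phiN; apply: phile.
  exists 0, 0; split=> //; last by rewrite mul0r subr0.
  by rewrite rmorph0 !scale0r addr0 add0r (rpartN starI) opprK rpart_id// geq0_sa.
have phi_im v : star v = v -> Im (phi v) = 0.
  have ir w : star w = w -> Im (phi w) <= 0.
    move=> sw; have : Re (phi (- 'i *: w)) <= 0.
      apply: phile; exists 0, 0; split=> //; last by rewrite mul0r subr0.
      rewrite rmorph0 !scale0r addr0 add0r /rpart (starZ starI) sw -scalerDl.
      rewrite (_ : - 'i + (- 'i)^*%R = 0); last first.
        by apply: complex_ext; rewrite ?creD ?cimD ?creJ ?cimJ /=; ring.
      by rewrite scale0r scaler0 oppr0; exact: geq0_0.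
    by rewrite (linZ philin) creM /=; move: (Re _) (Im _) => p q; lra.
  move=> sv; apply/eqP; rewrite eq_le ir//= -oppr_le0 -cimN -phiN ir//.
  by rewrite -scaleN1r (starZ starI) sv rmorphN rmorph1.
exists phi; split=> //.
- apply: complex_ext; last by rewrite phi_im ?star_e.
  have r_e (t : R) : rpart (t%:C *: e) = t%:C *: e by rewrite (rpartZ starI) rpart_id// star_e.
  apply/eqP; rewrite eq_le; apply/andP; split.
    apply: phile; exists 0, 1; split=> //; last by rewrite mul0r subr0.
    rewrite rmorph0 scale0r addr0 rmorph1 scale1r rpart_id ?star_e// subrr; exact: geq0_0.
  rewrite -lerN2 -creN -phiN; apply: phile; exists 0, (- 1); split=> //.
    rewrite rmorph0 scale0r addr0 (rpartN starI) rmorphN1 scaleN1r rpart_id ?star_e// opprK addNr.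
    exact: geq0_0.
  by rewrite mul0r subr0.
- by move=> v vp; apply: ge0_cE; [exact: phi_pos|apply: phi_im; exact: geq0_sa].
- apply: le_lt_trans (_ : - t0 < 0); last by rewrite oppr_lt0.
  apply: phile; exists 1, 0; split=> //; last by rewrite mul1r sub0r.
  by rewrite rmorph0 scale0r add0r rmorph1 scale1r rpart_id// subrr; exact: geq0_0.
Qed.

End States.

(** * States and the order unit norm *)

Section StateNorm.
Variables (R : realType) (V : lmodType R[i]).
Local Notation C := R[i].
Variables (star : V -> V) (e : V) (pos : forall n, set 'M[V]_n).
Hypothesis M : matrix_order_unit_space star e pos.

Let starI : involution star := mous_involution M.
Let MO : matrix_ordered star pos := mous_ordered M.
Local Notation geq0 := (geq0 pos).
Local Notation rpart := (rpart star).

Definition scalar_state (f : V -> C) : Prop :=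
  [/\ (forall (c : C) x y, f (c *: x + y) = c * f x + f y), f e = 1 &
      forall v, geq0 v -> 0 <= f v].

(** A positive functional is completely positive, since its quadratic form on
    matrices compresses to its value at a positive element. *)
Lemma scalar_state_CS f : scalar_state f ->
  @CS _ _ e pos 1 (fun v => const_mx (f v)).
Proof.
move=> [flin fe fpos]; split; last by apply/matrixP => i j; rewrite !mxE !ord1 fe.
split=> [c x y|r a apos].
  by apply/matrixP => i j; rewrite !mxE flin.
apply/psd_flatP => X.
have -> : blockform (map_mx (fun v => const_mx (f v) : 'M[C]_1) a) X X =
    f (amul (X^t* ) a X 0 0).
  rewrite mxE (big_lin2 (f := f))//; apply: eq_bigr => k _; apply: eq_bigr => l _.
  by rewrite !big_ord1 !mxE mulrAC.
apply: fpos; rewrite /geq0 -mx11_const; exact: (pos_conj MO).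
Qed.

Lemma CS_scalar_state (psi : V -> 'M[C]_1) : @CS _ _ e pos 1 psi ->
  scalar_state (fun v => psi v 0 0).
Proof.
move=> [[plin ppos] pe]; split=> [c x y||v v0].
- by rewrite plin !mxE.
- by rewrite pe mxE eqxx.
have /psd_flatP/(_ (const_mx 1)) := ppos 1%N (const_mx v) v0.
by rewrite /blockform !big_ord1 !mxE conjC1 mul1r mulr1.
Qed.

Section OneState.
Variable f : V -> C.
Hypothesis fS : scalar_state f.

Let flin (c : C) x y : f (c *: x + y) = c * f x + f y. Proof. by have [] := fS. Qed.

Lemma stateZ c v : f (c *: v) = c * f v.
Proof. exact: linZ flin c v. Qed.
Lemma stateD u v : f (u + v) = f u + f v.
Proof. by have := flin 1 u v; rewrite scale1r mul1r. Qed.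
Lemma stateN v : f (- v) = - f v.
Proof. exact: linN flin v. Qed.

Lemma state_real v : star v = v -> Im (f v) = 0.
Proof.
move=> sv; have [t t0 [H _]] := order_unit M sv.
have [_ fe fpos] := fS.
have := ge0_Im (fpos _ H); rewrite stateD stateZ fe mulr1 cimD /=.
by rewrite add0r.
Qed.

Lemma state_star v : f (star v) = (f v)^*%R.
Proof.
have sa1 : star (v + star v) = v + star v.
  by rewrite (starD starI) (starK starI) addrC.
have sa2 : star ('i *: (v - star v)) = 'i *: (v - star v).
  rewrite (starZ starI) (starB starI) (starK starI) -opprB scalerN -scaleNr.
  by congr (_ *: _); apply: complex_ext; rewrite ?creN ?cimN ?creJ ?cimJ /=; ring.
have := state_real sa1; have := state_real sa2.
rewrite stateZ !stateD stateN cimM !cimD !creD !cimN !creN /= => H1 H2.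
apply: complex_ext; rewrite ?creJ ?cimJ; move: H1 H2;
  move: (Re (f v)) (Re (f (star v))) (Im (f v)) (Im (f (star v))) => a b c d; lra.
Qed.

End OneState.

Lemma const_mxD (u v : V) : const_mx (u + v) = const_mx u + const_mx v :> 'M[V]_1.
Proof. by apply/matrixP => i j; rewrite !mxE. Qed.

Definition normblock (t : R) (v : V) : 'M[V]_(1 + 1) :=
  block_mx (const_mx (t%:C *: e)) (const_mx v) (const_mx (star v)) (const_mx (t%:C *: e)).

Lemma normblockE t v : block_mx (mscale t%:C (mxunit e 1)) (const_mx v)
  (mxstar star (const_mx v)) (mscale t%:C (mxunit e 1)) = normblock t v.
Proof.
rewrite /normblock mxunit1 mscale_const; congr block_mx.
by apply/matrixP => i j; rewrite !mxE.
Qed.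

(** A self-adjoint [k] with [- t e <= k <= t e], multiplied by a phase [z]:
    the block is the average of two rank one compressions. *)
Lemma normblock_sa (z : C) (t : R) (k : V) : normc z = 1 ->
  geq0 (t%:C *: e + k) -> geq0 (t%:C *: e - k) -> star k = k -> pos (normblock t (z *: k)).
Proof.
move=> z1 H1 H2 sk.
have zz : z * z^*%R = 1 by rewrite mulcJ z1 expr1n.
pose g (y : C) : 'M[C]_(1, 1 + 1) := row_mx 1%:M y%:M.
have gadj y : (g y)^t* = col_mx 1%:M (y^*%R)%:M.
  rewrite tr_row_mx map_col_mx hadj1; congr col_mx.
  by apply/matrixP => i j; rewrite !mxE !ord1 /= !mulr1n.
have comp (y : C) w : geq0 w -> pos (block_mx (const_mx w) (const_mx (y *: w))
    (const_mx (y^*%R *: w)) (const_mx ((y * y^*%R) *: w)) : 'M[V]_(1 + 1)).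
  move=> w0; have := pos_conj MO (g y) w0; rewrite gadj amul_outer.
  by rewrite !amul_scalar !mscale_const !mul1r mulr1 scale1r mulrC.
have half (x : V) : (2^-1)%:C *: (x + x) = x.
  by rewrite scalerDr -scalerDl -rmorphD/= half_plus_half rmorph1 scale1r.
have C1 := comp z _ H1; have C2 := comp (- z) _ H2.
have h0 : 0 <= 2^-1 :> R by [].
have := pos_scale MO h0 (pos_add MO C1 C2); congr pos.
set w1 := _ + k; set w2 := _ - k.
have w12 : w1 + w2 = t%:C *: e + t%:C *: e by rewrite addrACA subrr addr0.
have w12' : w1 - w2 = k + k by rewrite opprB addrC addrA subrK.
rewrite add_block_mx /mscale map_block_mx; congr block_mx; apply/matrixP => i j;
  rewrite !mxE.
- by rewrite w12 half.
- by rewrite scaleNr -scalerBr w12' scalerA mulrC -scalerA half.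
- rewrite rmorphN scaleNr -scalerBr w12' scalerA mulrC -scalerA half.
  by rewrite (starZ starI) sk.
- by rewrite rmorphN mulrNN zz !scale1r w12 half.
Qed.

Lemma normblock_cartesian (t : R) v :
  geq0 (t%:C *: e + rpart v) -> geq0 (t%:C *: e - rpart v) ->
  geq0 (t%:C *: e + rpart (- 'i *: v)) -> geq0 (t%:C *: e - rpart (- 'i *: v)) ->
  pos (normblock (2 * t) v).
Proof.
move=> h1 h2 k1 k2.
have := pos_add MO (normblock_sa (Normc.normc1 R) h1 h2 (rpart_sa starI _))
  (normblock_sa (normci R) k1 k2 (rpart_sa starI _)).
rewrite scale1r add_block_mx -!const_mxD -(starD starI) -(cartesian starI).
by rewrite -scalerDl -rmorphD /= -mulr2n mulr_natl.
Qed.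

Lemma mnorm_le (t : R) v : 0 < t -> pos (normblock t v) ->
  mnorm star e pos (const_mx v : 'M[V]_1) <= t.
Proof.
move=> t0 H; apply: ge_inf; first by exists 0 => s [/ltW].
by split=> //; rewrite normblockE.
Qed.

Lemma normblock_ex v : exists2 t : R, 0 < t & pos (normblock t v).
Proof.
have [t t0 [h1 h2]] := order_unit M (rpart_sa starI v).
have [s s0 [k1 k2]] := order_unit M (rpart_sa starI (- 'i *: v)).
have ts : t <= t + s by rewrite lerDl ltW.
have st : s <= t + s by rewrite lerDr ltW.
exists (2 * (t + s)); first by rewrite mulr_gt0// addr_gt0.
apply: normblock_cartesian.
- exact: (geq0_mono M ts h1).
- exact: (geq0_mono M ts h2).
- exact: (geq0_mono M st k1).
- exact: (geq0_mono M st k2).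
Qed.

(** The numerical radius controls the norm; the factor [2] comes from the
    splitting into real and imaginary parts. *)
Lemma mnorm_le_states (t : R) v : 0 < t ->
  (forall f, scalar_state f -> normc (f v) <= t) ->
  mnorm star e pos (const_mx v : 'M[V]_1) <= 2 * t.
Proof.
move=> t0 H; apply: mnorm_le; first by rewrite mulr_gt0.
have key u (s : R) : (forall f, scalar_state f -> `|Re (f u)| <= t) -> `|s| = 1 ->
    star u = u -> geq0 (t%:C *: e + s%:C *: u).
  move=> Hu s1 su; apply: contrapT => /(separating_functional M)[|f [flin fe fpos]].
    by rewrite (starD starI) !(starZ starI) !conjR (star_e M) su.
  have fS : scalar_state f by [].
  rewrite (stateD fS) !(stateZ fS) fe mulr1 creD creZ /= => H1.
  have := Hu f fS; have : `|s * Re (f u)| = `|Re (f u)| by rewrite normrM s1 mul1r.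
  by move=> <-; rewrite ler_norml; move: H1; move: (s * _) => z; lra.
have fr f (fS : scalar_state f) u : f (rpart u) = (Re (f u))%:C.
  rewrite (stateZ fS) (stateD fS) (state_star fS).
  by apply: complex_ext; rewrite ?creM ?cimM ?creD ?cimD ?creJ ?cimJ /=; field.
have h f : scalar_state f -> `|Re (f (rpart v))| <= t.
  by move=> fS; rewrite fr// (le_trans (normr_Re_le _) (H f fS)).
have k f : scalar_state f -> `|Re (f (rpart (- 'i *: v)))| <= t.
  move=> fS; rewrite fr// (stateZ fS) creM /= oppr0 mul0r sub0r mulN1r opprK.
  exact: le_trans (normr_Im_le _) (H f fS).
apply: normblock_cartesian.
- by have := key (rpart v) 1 h (normr1 _) (rpart_sa starI _); rewrite rmorph1 scale1r.
- by have := key (rpart v) (- 1) h (normrN1 _) (rpart_sa starI _); rewrite rmorphN1 scaleN1r.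
- by have := key _ 1 k (normr1 _) (rpart_sa starI _); rewrite rmorph1 scale1r.
- by have := key _ (- 1) k (normrN1 _) (rpart_sa starI _); rewrite rmorphN1 scaleN1r.
Qed.

(** The positive block is tested on the vector [(1, - u)], where the phase [u]
    makes [u * f v] real. *)
Lemma state_le_mnorm f v : scalar_state f ->
  normc (f v) <= mnorm star e pos (const_mx v : 'M[V]_1).
Proof.
move=> fS; apply: lb_le_inf.
  have [t t0 H] := normblock_ex v; exists t; split=> //.
  by rewrite normblockE.
move=> t [t0]; rewrite normblockE => H.
have [u u1 uf] := phase (f v).
have [_ fe fpos] := fS.
pose g : 'M[C]_(1 + 1, 1) := col_mx 1%:M (- u)%:M.
have gadj : g^t* = row_mx 1%:M (- u^*%R)%:M.
  rewrite tr_col_mx map_row_mx hadj1; congr row_mx.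
  by apply/matrixP => i j; rewrite !mxE !ord1 /= !mulr1n rmorphN.
have := pos_conj MO g H; rewrite gadj amul_block !amul_scalar !mscale_const -!const_mxD.
move=> /fpos /ge0_Re.
rewrite !(stateD fS) !(stateZ fS) fe (state_star fS) !mul1r !mulr1.
have uu : - u^*%R * - u = 1 by rewrite mulrNN mulrC mulcJ u1 expr1n.
have ufJ : u^*%R * (f v)^*%R = (normc (f v))%:C by rewrite -conjR -uf rmorphM.
rewrite uu mul1r !mulNr uf ufJ !creD !creN /=.
by move: (normc _) => z; lra.
Qed.

Lemma states_separate v : (forall f, scalar_state f -> f v = 0) -> v = 0.
Proof.
move=> H.
have key u : (forall f, scalar_state f -> Re (f u) = 0) -> star u = u -> geq0 u.
  move=> Hu su; apply: contrapT => /(separating_functional M su)[f [flin fe fpos]].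
  by rewrite Hu// ltxx.
have z u : (forall f, scalar_state f -> f u = 0) -> star u = u -> u = 0.
  move=> Hu su; apply: (geq0_anti M).
    by apply: key => // f fS; rewrite Hu.
  apply: key => [f fS|]; first by rewrite (stateN fS) Hu// oppr0.
  by rewrite -scaleN1r (starZ starI) su rmorphN rmorph1.
have r u : (forall f, scalar_state f -> f u = 0) -> rpart u = 0.
  move=> Hu; apply: z (rpart_sa starI u) => f fS.
  by rewrite (stateZ fS) (stateD fS) (state_star fS) Hu// conjC0 addr0 mulr0.
rewrite [v](cartesian starI) r// r ?scaler0 ?addr0// => f fS.
by rewrite (stateZ fS) H// mulr0.
Qed.

End StateNorm.

(** * The Lipschitz distance on the state space *)

Section LipTopology.
Variables (R : realType) (V : lmodType R[i]).
Local Notation C := R[i].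
Variables (star : V -> V) (e : V) (pos : forall n, set 'M[V]_n).
Variable L : forall n, 'M[V]_n -> R.
Hypothesis M : matrix_order_unit_space star e pos.
Hypothesis HL : matrix_Lip_norm star e pos L.

Local Notation CS1 := (@CS _ _ e pos 1).

(** A ball for the Lipschitz distance, in terms of upper bounds instead of the
    supremum; the gap between [del] and [eps] makes it open. *)
Definition Dball (phi : V -> 'M[C]_1) (eps : R) : set (V -> 'M[C]_1) :=
  [set psi | CS1 psi /\ exists2 del : R, del < eps & forall r (a : 'M[V]_r), L a <= 1 ->
    opnorm (flatmx (map_mx phi a) - flatmx (map_mx psi a)) <= del].

Lemma Dball_open phi eps : D_open e pos L (Dball phi eps).
Proof.
split=> [psi []//|psi [psiS [del de H]]].
exists ((eps - del) / 2); first by rewrite divr_gt0// subr_gt0.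
move=> chi chiS Dlt; split=> //; exists (del + (eps - del) / 2); first by lra.
move=> r a La.
have -> : flatmx (map_mx phi a) - flatmx (map_mx chi a) =
    (flatmx (map_mx phi a) - flatmx (map_mx psi a)) +
    (flatmx (map_mx psi a) - flatmx (map_mx chi a)) by rewrite addrA subrK.
apply: le_trans (opnormD _ _) _; apply: lerD; first exact: H.
rewrite -lee_fin; apply: le_trans (ltW Dlt).
by apply: ereal_sup_ubound; exists r, a.
Qed.

Lemma Dball_center phi eps : 0 < eps -> CS1 phi -> Dball phi eps phi.
Proof.
move=> e0 phiS; split=> //; exists 0 => // r a _.
by rewrite subrr opnorm0.
Qed.

Lemma Dball_close phi eps psi : Dball phi eps psi ->
  forall v, L (const_mx v : 'M[V]_1) <= 1 -> normc (phi v 0 0 - psi v 0 0) <= eps.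
Proof.
move=> [psiS [del de H]] v /H Hv; apply: le_trans (ltW de).
have d0 : 0 <= del by apply: le_trans Hv; exact: opnorm_ge0.
set z := _ - _; have [u u1 uz] := phase z.
have flatB (A B : 'M['M[C]_1]_1) : flatmx A - flatmx B = flatmx (A - B).
  by apply/matrixP => i j; rewrite !mxE.
move: Hv; rewrite flatB => /(opnorm_flatP _ d0)/(_ (const_mx u^*%R) (const_mx 1)).
rewrite /blockform !big_ord1 !mxE conjCK mulr1 !fro2E !big_ord1 !mxE -/z uz.
rewrite cnormJ u1 Normc.normc1 expr1n /=.
by move: (normc z) => q; lra.
Qed.

(** The hypothesis that the distance induces the weak topology enters here: it
    makes the ball around [phi] weakly open. *)
Lemma Dball_near (F : set_system (V -> 'M[C]_1)) phi : Filter F -> CS1 phi -> F CS1 ->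
  (forall v (eps : R), 0 < eps -> F [set psi | normc (psi v 0 0 - phi v 0 0) < eps]) ->
  forall eps : R, 0 < eps -> F (Dball phi eps).
Proof.
move=> FF phiS FS Fphi eps e0.
have /(HL.2 1%N)[O Oo DO] := Dball_open phi eps.
rewrite DO; apply: filterI => //.
have cv : {ptws, F --> (phi : V -> 'M[C^o]_1)}.
  by apply: (@ptws_cvg V 'M[C^o]_1 F phi) => v; apply: mx11_cvg => d d0; exact: Fphi.
apply: cv; apply: open_nbhs_nbhs; split=> //.
by have [] : (O `&` CS1) phi by rewrite -DO; exact: Dball_center.
Qed.

Lemma scalar_state_closed (T : Type) (U : set_system T) (g : T -> V -> C) (f : V -> C) :
  ProperFilter U -> U [set x | scalar_state e pos (g x)] ->
  (forall v (eps : R), 0 < eps -> U [set x | normc (g x v - f v) < eps]) ->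
  scalar_state e pos f.
Proof.
move=> UU US Uf.
have eqP' (v : V) (z : C) (c : R) : 0 <= c ->
    (forall eps : R, 0 < eps -> normc (f v - z) <= c * eps) -> f v = z.
  move=> c0 H; apply/eqP; rewrite -subr_eq0; apply/eqP; apply: normc_small => d d0.
  have c1 : 0 < c + 1 by rewrite ltr_wpDl.
  apply: le_trans (H _ (divr_gt0 d0 c1)) _.
  by rewrite mulrCA ger_pMr// ler_pdivrMr// mul1r lerDl.
split=> [c x y||v v0].
- apply: (@eqP' _ _ (normc c + 2)) => [|d d0]; first by rewrite addr_ge0 ?normc_ge0.
  have [t [[glin _ _] [t1 [t2 t3]]]] := filter_ex (filterI US
    (filterI (Uf (c *: x + y) d d0) (filterI (Uf x d d0) (Uf y d d0)))).
  rewrite /= in t1 t2 t3; rewrite glin normcB in t1.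
  have -> : f (c *: x + y) - (c * f x + f y) =
     (f (c *: x + y) - (c * g t x + g t y)) + (c * (g t x - f x) + (g t y - f y)).
    by rewrite mulrBr; ring.
  apply: le_trans (le_normcD _ _) _; rewrite [normc c + 2]addrC !mulrDl !mul1r -addrA.
  rewrite lerD ?(ltW t1)//; apply: le_trans (le_normcD _ _) _.
  rewrite Normc.normcM addrC lerD ?(ltW t3)//.
  by rewrite ler_wpM2l ?normc_ge0 ?(ltW t2).
- apply: (@eqP' _ _ 1) => // d d0; rewrite mul1r.
  have [t [[_ gE _] /= t1]] := filter_ex (filterI US (Uf e d d0)).
  by rewrite gE normcB in t1; exact: ltW.
have step d : 0 < d -> - d <= Re (f v) /\ `|Im (f v)| <= d.
  move=> d0; have [t [[_ _ gp] /= t1]] := filter_ex (filterI US (Uf v d d0)).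
  have g0 := gp v v0; have := ge0_Re g0; have := ge0_Im g0.
  have := Re_le_normc (g t v - f v).
  have im := normr_Im_le (g t v - f v).
  rewrite creD creN; move: im; rewrite cimD cimN => im h1 h2 h3; rewrite h2 add0r normrN in im.
  split; last exact: le_trans im (ltW t1).
  by move: h1 h3 t1; move: (Re _) (Re _) (normc _) => a b q; lra.
apply: ge0_cE.
  by apply/ler_addgt0Pr => d d0; have [] := step d d0; rewrite -subr_ge0 opprK addrC.
by apply/eqP; rewrite -normr_le0; apply/ler_addgt0Pr => d d0; rewrite add0r (step d d0).2.
Qed.

(** Compactness of the state space in the weak topology, by limits along
    ultrafilters. *)
Lemma state_limit (U : set_system (V -> 'M[C]_1)) : UltraFilter U -> U CS1 ->
  exists2 phi, CS1 phi &
    forall v (eps : R), 0 < eps -> U [set psi | normc (psi v 0 0 - phi v 0 0) < eps].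
Proof.
move=> UU US.
have /choice[f fP] : forall v, exists c : C, forall eps : R, 0 < eps ->
    U [set psi | normc (psi v 0 0 - c) < eps].
  move=> v; apply: (@ultra_lim _ _ U (fun psi => psi v 0 0)
    (mnorm star e pos (const_mx v : 'M[V]_1))).
  apply: filterS US => psi psiS /=.
  exact: (state_le_mnorm M v (CS_scalar_state psiS)).
exists (fun v => const_mx (f v)); last first.
  by move=> v eps e0; have := fP v eps e0; congr U; apply/funext => psi /=; rewrite mxE.
apply: (scalar_state_CS M); apply: (@scalar_state_closed _ U (fun psi v => psi v 0 0)) => //.
by apply: filterS US => psi; exact: CS_scalar_state.
Qed.

(** Otherwise the states that are far from finitely many given ones generate a
    filter. An ultrafilter above it has a limit state, and some state would be
    both close to this limit and far from it. *)
Lemma finite_net (eps : R) : 0 < eps -> exists m (s : nat -> V -> 'M[C]_1),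
  (forall i, (i < m)%N -> CS1 (s i)) /\
  forall psi, CS1 psi -> exists2 i, (i < m)%N &
    forall v, L (const_mx v : 'M[V]_1) <= 1 -> normc (s i v 0 0 - psi v 0 0) <= eps.
Proof.
move=> e0; apply: contrapT => H.
pose near (phi psi : V -> 'M[C]_1) :=
  forall v, L (const_mx v : 'M[V]_1) <= 1 -> normc (phi v 0 0 - psi v 0 0) <= eps.
pose D : set (nat * (nat -> V -> 'M[C]_1)) := [set p | forall i, (i < p.1)%N -> CS1 (p.2 i)].
pose B (p : nat * (nat -> V -> 'M[C]_1)) : set (V -> 'M[C]_1) :=
  [set psi | CS1 psi /\ forall i, (i < p.1)%N -> ~ near (p.2 i) psi].
have FB : ProperFilter (filter_from D B).
  apply: filter_from_proper; last first.
    move=> [m s] Ds; apply: contrapT => nB; apply: H; exists m, s; split=> // psi psiS.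
    apply: contrapT => Hn; apply: nB; exists psi; split=> // i im nr.
    by apply: Hn; exists i.
  apply: filter_from_filter; first by exists (0%N, fun _ _ => 0).
  move=> [m1 s1] [m2 s2] D1 D2.
  exists ((m1 + m2)%N, fun i => if (i < m1)%N then s1 i else s2 (i - m1)%N).
    move=> i /= im; case: ifPn => [/D1//|]; rewrite -leqNgt => mi; apply: D2 => /=.
    by rewrite ltn_subLR.
  move=> psi [psiS P]; split; split=> // i /= im.
    by have := P i; rewrite /= im; apply; exact: ltn_addr.
  have := P (m1 + i)%N; rewrite /= ltn_add2l => /(_ im).
  by rewrite ltnNge leq_addr /= addKn.
have [U [UU UB]] := ultraFilterLemma FB.
have US : U CS1 by apply: UB; exists (0%N, fun _ _ => 0) => // psi [].
have [phi phiS phiU] := state_limit UU US.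
have U1 : U (Dball phi eps) by exact: Dball_near.
have U2 : U (B (1%N, fun=> phi)) by apply: UB; exists (1%N, fun=> phi).
have [psi [/Dball_close p1 [_ p2]]] := filter_ex (filterI U1 U2).
by have := p2 0%N isT; apply.
Qed.

(** Points of the segment from [f] to [g] converge weakly to [f], so one of them
    other than [f] is at finite distance from [f]; by homogeneity so is [g]. *)
Lemma finite_diameter f g : scalar_state e pos f -> scalar_state e pos g ->
  exists K : R, forall v, L (const_mx v : 'M[V]_1) <= 1 -> normc (f v - g v) <= K.
Proof.
move=> fS gS.
pose t (k : nat) : R := k.+1%:R^-1.
have t0 k : 0 < t k by rewrite invr_gt0.
have t1 k : t k <= 1 by rewrite invf_le1// ler1n.
pose h k : V -> C := fun v => f v + (t k)%:C * (g v - f v).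
have hS k : scalar_state e pos (h k).
  have [flin fe fpos] := fS; have [glin ge gpos] := gS; split=> [c x y||v v0].
  - by rewrite /h flin glin; ring.
  - by rewrite /h fe ge subrr mulr0 addr0.
  have -> : h k v = (1 - t k)%:C * f v + (t k)%:C * g v.
    by rewrite /h rmorphB rmorph1; ring.
  by rewrite addr_ge0// mulr_ge0 ?fpos ?gpos// ler0c ?subr_ge0// ltW.
pose F : set_system (V -> 'M[C]_1) := filter_from setT
  (fun m : nat => [set psi | exists2 k, (m <= k)%N & psi = fun v => const_mx (h k v)]).
have FF : ProperFilter F.
  apply: filter_from_proper; last by move=> m _; exists (fun v => const_mx (h m v)), m.
  apply: filter_from_filter; first by exists 0%N.
  move=> i j _ _; exists (maxn i j) => // psi [k].
  by rewrite geq_max => /andP[ik jk] ->; split; exists k.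
have near1 : F (Dball (fun v => const_mx (f v)) 1).
  apply: Dball_near => //; first exact: (scalar_state_CS M).
    by exists 0%N => // psi [k _ ->]; exact: (scalar_state_CS M).
  move=> v eps e0; pose m := Num.bound (normc (g v - f v) / eps).
  exists m => // psi [k mk ->] /=; rewrite !mxE /h [f v + _]addrC addrK.
  rewrite Normc.normcM normcR gtr0_norm// mulrC ltr_pdivrMr//.
  rewrite -ltr_pdivrMl// mulrC.
  have : normc (g v - f v) / eps < m%:R.
    by apply: archi_boundP; rewrite divr_ge0 ?normc_ge0// ltW.
  by move=> H; apply: lt_le_trans H _; rewrite ler_nat (leq_trans mk).
have [psi [[k _ ->] /Dball_close H]] : exists psi, 
    (exists2 k, (0 <= k)%N & psi = fun v => const_mx (h k v)) /\
    Dball (fun v => const_mx (f v)) 1 psi.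
  have F0 : F [set psi | exists2 k, (0 <= k)%N & psi = fun v => const_mx (h k v)].
    by exists 0%N.
  by have [psi [p1 p2]] := filter_ex (filterI F0 near1); exists psi.
exists (k.+1%:R) => v /H; rewrite !mxE /h opprD addrA subrr add0r normcN.
rewrite Normc.normcM normcR gtr0_norm// /t ler_pdivrMl// mulr1 normcB.
by [].
Qed.

End LipTopology.

(** * Compactness of the Lipschitz ball of the quotient *)

Section QuotientSpace.
Variables (R : realType) (V : lmodType R[i]).
Local Notation C := R[i].
Variables (star : V -> V) (e : V) (pos : forall n, set 'M[V]_n).
Variable L : forall n, 'M[V]_n -> R.
Variables (Vbar : lmodType C) (Nbar : forall n, 'M[Vbar]_n -> R) (iota : {linear V -> Vbar}).
Hypothesis M : matrix_order_unit_space star e pos.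
Hypothesis HL : matrix_Lip_norm star e pos L.
Hypothesis cpl : is_completion (mnorm star e pos) Nbar iota.
Hypothesis Lcl : Lip_closed Nbar iota L.

Local Notation W := (quotV e).
Local Notation pi := (@qpi R V e).
Local Notation mn := (mnorm star e pos).
Local Notation N := (qnorm (e := e) L).
Local Notation nu := (qnorm (e := e) mn).

Let starI : involution star := mous_involution M.
Let LS : matrix_Lipschitz_seminorm star e L := HL.1.

Lemma lift_mx m n (x : 'M[W]_(m, n)) : exists a : 'M[V]_(m, n), x = map_mx pi a.
Proof. by exists (map_mx (@qrepr R V e) x); apply/matrixP => i j; rewrite !mxE qreprK. Qed.

Lemma qnormE n (a : 'M[V]_n) : N (map_mx pi a) = L a.
Proof. exact: (qnorm_qpi LS). Qed.

Lemma map_mscale m n (c : C) (a : 'M[V]_(m, n)) :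
  map_mx pi (mscale c a) = mscale c (map_mx pi a).
Proof. by apply/matrixP => i j; rewrite !mxE linearZ. Qed.

Lemma qnorm_osn : operator_space_norm N.
Proof.
split.
- by move=> n x; have [a ->] := lift_mx x; rewrite qnormE; exact: (mls_ge0 LS).
- move=> n x y; have [a ->] := lift_mx x; have [b ->] := lift_mx y.
  by rewrite -map_mxD !qnormE; exact: (mls_triangle LS).
- move=> n c x; have [a ->] := lift_mx x.
  by rewrite -map_mscale !qnormE; exact: (mls_scale LS).
- move=> n x; have [a ->] := lift_mx x; rewrite qnormE => /(mls_null LS)[al ->].
  apply/matrixP => i j; rewrite !mxE -(linear0 pi); apply/qpiP.
  by exists (al i j); rewrite subr0.
- move=> m n x y; have [a ->] := lift_mx x; have [b ->] := lift_mx y.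
  have -> : block_mx (map_mx pi a) 0 0 (map_mx pi b) = map_mx pi (block_mx a 0 0 b).
    by rewrite map_block_mx !map_mx0.
  by rewrite !qnormE; exact: (mls_sum LS).
- move=> m n al x be; have [a ->] := lift_mx x.
  by rewrite -amul_map !qnormE; exact: (mls_bimodule LS).
Qed.

Lemma qstar_pi v : qstar star (pi v) = pi (star v).
Proof.
rewrite /qstar; apply/qpiP; have /qpiP[c cE] := qreprK (pi v).
exists (c^*%R); rewrite -(starB starI) cE (starZ starI).
by rewrite (star_e M).
Qed.

Lemma qstar_involution : involution (qstar (e := e) star).
Proof.
split=> [x|c x y].
  by rewrite -[x]qreprK !qstar_pi (starK starI).
rewrite -[x]qreprK -[y]qreprK -linearP !qstar_pi.
by rewrite (star_conj_linear starI) linearP.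
Qed.

Lemma qnorm_star n (x : 'M[W]_n) : N (mxstar (qstar star) x) = N x.
Proof.
have [a ->] := lift_mx x.
have -> : mxstar (qstar star) (map_mx pi a) = map_mx pi (mxstar star a).
  by apply/matrixP => i j; rewrite !mxE qstar_pi.
by rewrite !qnormE (mls_star LS).
Qed.

Lemma mnorm_iota n (v : 'M[V]_n) : mn v = Nbar (map_mx iota v).
Proof. by rewrite (cpl_isometry cpl). Qed.

Let osB : operator_space_norm Nbar := cpl_norm cpl.

Lemma mnorm_ge0 n (v : 'M[V]_n) : 0 <= mn v.
Proof. by rewrite mnorm_iota (osn_ge0 osB). Qed.

Lemma mnormD n (u v : 'M[V]_n) : mn (u + v) <= mn u + mn v.
Proof. by rewrite !mnorm_iota map_mxD (osn_triangle osB). Qed.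

Lemma mnormZ n (c : C) (v : 'M[V]_n) : mn (mscale c v) = normc c * mn v.
Proof.
rewrite !mnorm_iota -(osn_scale osB); congr Nbar.
by apply/matrixP => i j; rewrite !mxE linearZ.
Qed.

(** Exchanging the two coordinates turns the block of an element into the block
    of its adjoint. *)
Lemma mnorm_star (v : 'M[V]_1) : mn (mxstar star v) = mn v.
Proof.
have le (u : V) : mn (const_mx (star u) : 'M[V]_1) <= mn (const_mx u : 'M[V]_1).
  apply: lb_le_inf.
    by have [t t0 H] := normblock_ex M u; exists t; split=> //; rewrite normblockE.
  move=> t [t0]; rewrite normblockE => H; apply: (mnorm_le t0).
  pose g : 'M[C]_(1 + 1) := row_mx (col_mx 0 1%:M) (col_mx 1%:M 0).
  have gadj : g^t* = col_mx (row_mx 0 1%:M) (row_mx 1%:M 0).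
    rewrite tr_row_mx map_col_mx !tr_col_mx !map_row_mx !hadj1.
    by rewrite !trmx0 !map_mx0.
  have := pos_conj (mous_ordered M) g H.
  rewrite gadj amul_outer !amul_block !amul0l !amul0r !amul_1 !addr0 !add0r.
  congr pos; rewrite /normblock (starK starI); congr block_mx.
rewrite [v]mx11_const.
have mxsE u : mxstar star (const_mx u : 'M[V]_1) = const_mx (star u).
  by apply/matrixP => i j; rewrite !mxE.
by rewrite mxsE; apply/eqP; rewrite eq_le le -{1}[v 0 0](starK starI) le.
Qed.

Lemma quotient_norm_le n (v : 'M[V]_n) : nu (map_mx pi v) <= mn v.
Proof.
apply: ge_inf; last by exists v.
by exists 0 => _ [u _ <-]; exact: mnorm_ge0.
Qed.

Lemma quotient_norm_lift n (x : 'M[W]_n) (d : R) : nu x < d -> exists2 v, x = map_mx pi v & mn v < d.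
Proof.
move=> xd; have d0 : 0 < d - nu x by rewrite subr_gt0.
have [|_ [v /= vx <-] vd] := inf_adherent d0 (E := [set mn v | v in [set v | map_mx pi v = x]]).
  split; first by have [a ->] := lift_mx x; exists (mn a), a.
  by exists 0 => _ [u _ <-]; exact: mnorm_ge0.
by exists v; rewrite ?vx//; move: vd; rewrite addrC subrK.
Qed.

Lemma quotient_normD n (x y : 'M[W]_n) : nu (x + y) <= nu x + nu y.
Proof.
apply/ler_addgt0Pr => d d0; have d20 : 0 < d / 2 by rewrite divr_gt0.
have [u -> ud] : exists2 u, x = map_mx pi u & mn u < nu x + d / 2.
  by apply: quotient_norm_lift; rewrite ltrDl.
have [v -> vd] : exists2 v, y = map_mx pi v & mn v < nu y + d / 2.
  by apply: quotient_norm_lift; rewrite ltrDl.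
rewrite -map_mxD; apply: le_trans (quotient_norm_le _) _; apply: le_trans (mnormD _ _) _.
apply: ltW; apply: lt_le_trans (ltrD ud vd) _.
by rewrite addrACA -splitr.
Qed.

Lemma quotient_norm_ge0 n (x : 'M[W]_n) : 0 <= nu x.
Proof.
apply: lb_le_inf; first by have [a ->] := lift_mx x; exists (mn a), a.
by move=> _ [u _ <-]; exact: mnorm_ge0.
Qed.

Lemma quotient_normZ n (c : C) (x : 'M[W]_n) : nu (mscale c x) = normc c * nu x.
Proof.
have le (b : C) (y : 'M[W]_n) : nu (mscale b y) <= normc b * nu y.
  apply/ler_addgt0Pr => d d0.
  have b1 : 0 < normc b + 1 by rewrite ltr_wpDl ?normc_ge0.
  have [u -> ud] : exists2 u, y = map_mx pi u & mn u < nu y + d / (normc b + 1).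
    by apply: quotient_norm_lift; rewrite ltrDl divr_gt0.
  rewrite -map_mscale; apply: le_trans (quotient_norm_le _) _; rewrite mnormZ.
  apply: le_trans (ler_wpM2l (normc_ge0 b) (ltW ud)) _; rewrite mulrDr lerD2l.
  by rewrite mulrCA ger_pMr// ler_pdivrMr// mul1r lerDl.
have [->|c0] := eqVneq c 0.
  apply/eqP; rewrite Normc.normc0 mul0r eq_le quotient_norm_ge0 andbT.
  by have := le 0 x; rewrite Normc.normc0 mul0r.
apply/eqP; rewrite eq_le le/=.
have n0 : 0 < normc c.
  by rewrite lt_neqAle normc_ge0 andbT eq_sym; apply: contra_neq c0; exact: Normc.eq0_normc.
have := le c^-1 (mscale c x); rewrite Normc.normcV => H.
rewrite -ler_pdivlMl//; apply: le_trans H.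
suff -> : mscale c^-1 (mscale c x) = x by [].
by apply/matrixP => i j; rewrite !mxE scalerA mulVf// scale1r.
Qed.

Lemma quotient_norm_star (x : 'M[W]_1) : nu (mxstar (qstar star) x) = nu x.
Proof.
have le (y : 'M[W]_1) : nu (mxstar (qstar star) y) <= nu y.
  apply/ler_addgt0Pr => d d0.
  have [u -> ud] : exists2 u, y = map_mx pi u & mn u < nu y + d.
    by apply: quotient_norm_lift; rewrite ltrDl.
  have -> : mxstar (qstar star) (map_mx pi u) = map_mx pi (mxstar star u).
    by apply/matrixP => i j; rewrite !mxE qstar_pi.
  by apply: le_trans (quotient_norm_le _) _; rewrite mnorm_star ltW.
apply/eqP; rewrite eq_le le -{1}[x](mxstarK qstar_involution) le.
by [].
Qed.

(** The lift normalised to vanish at one state is linear, and [finite_diameter]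
    bounds it on the ball at every state. Without any state [V] is trivial. *)
Lemma lipschitz_lift : exists s : W -> V,
  [/\ forall x, pi (s x) = x, forall (x y : W), s (x - y) = s x - s y &
      forall f, scalar_state e pos f -> exists K : R,
        forall x, N (const_mx x : 'M[W]_1) <= 1 -> normc (f (s x)) <= K].
Proof.
have [[f0 f0S]|nS] := pselect (exists f, scalar_state e pos f); last first.
  have V0 (v : V) : v = 0.
    by apply: (states_separate M) => f fS; exfalso; apply: nS; exists f.
  exists (@qrepr R V e); split=> [x|x y|f fS]; first exact: qreprK.
    by rewrite [LHS]V0 [RHS]V0.
  by exfalso; apply: nS; exists f.
pose s (x : W) := qrepr x - f0 (qrepr x) *: e.
have sE v : s (pi v) = v - f0 v *: e.
  have /qpiP[c cE] := qreprK (pi v).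
  have E : qrepr (pi v) = v + c *: e by rewrite -cE addrCA subrr addr0.
  have [_ fe _] := f0S; rewrite /s E (stateD f0S) (stateZ f0S) fe mulr1 scalerDl.
  by rewrite opprD addrACA subrr addr0.
have piS x : pi (s x) = x.
  rewrite -[x]qreprK sE; apply/qpiP; exists (- f0 (qrepr x)).
  by rewrite addrAC subrr add0r scaleNr.
exists s; split=> // [x y|f fS].
  rewrite -[x]qreprK -[y]qreprK -linearB !sE (stateD f0S) (stateN f0S).
  by rewrite scalerBl !opprD !opprK addrACA.
have [K HK] := finite_diameter M HL fS f0S.
exists K => x xN; have := HK (s x).
have -> : f0 (s x) = 0.
  have [_ fe _] := f0S.
  by rewrite (stateD f0S) (stateN f0S) (stateZ f0S) fe mulr1 subrr.
rewrite subr0; apply.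
rewrite -qnormE (_ : map_mx pi _ = const_mx x)//.
by apply/matrixP => i j; rewrite !mxE piS.
Qed.

(** Total boundedness: by [finite_net], finitely many states control the norm
    on the ball up to a prescribed error, and an ultrafilter stabilises finitely
    many bounded functions. *)
Lemma ultra_totally_bounded n (U : set_system 'M[W]_n) (s : W -> V) : UltraFilter U ->
  U [set x | N x <= 1] ->
  (forall x, pi (s x) = x) -> (forall (x y : W), s (x - y) = s x - s y) ->
  (forall f, scalar_state e pos f -> exists K : R,
    forall x, N (const_mx x : 'M[W]_1) <= 1 -> normc (f (s x)) <= K) ->
  forall eps : R, 0 < eps -> exists2 A, U A & forall x y, A x -> A y ->
    forall i j, mn (const_mx (s (x i j) - s (y i j)) : 'M[V]_1) <= eps.
Proof.
move=> UU UK piS sB sbd eps e0.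
pose d := eps / 8; have d0 : 0 < d by rewrite divr_gt0.
have [m [st [stS net]]] := finite_net M HL d0.
have osW := qnorm_osn.
have ent (x : 'M[W]_n) i j : N x <= 1 -> N (const_mx (x i j) : 'M[W]_1) <= 1.
  by move=> xN; apply: le_trans xN; exact: osn_entry.
have /choice[c cP] : forall p : 'I_m * ('I_n * 'I_n), exists c : C,
    U [set x | normc (st p.1 (s (x p.2.1 p.2.2)) 0 0 - c) < d].
  move=> [l [i j]] /=; have [K HK] := sbd _ (CS_scalar_state (stS l (ltn_ord l))).
  have [|c Hc] := @ultra_lim _ _ U (fun x : 'M[W]_n => st l (s (x i j)) 0 0) K UU.
    by apply: filterS UK => x xN; apply: HK; exact: ent.
  by exists c; exact: Hc.
pose A := [set x : 'M[W]_n | N x <= 1 /\ forall p : 'I_m * ('I_n * 'I_n),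
  normc (st p.1 (s (x p.2.1 p.2.2)) 0 0 - c p) < d].
exists A.
  apply: filterI => //; exact: filter_forall.
move=> x y [xN xA] [yN yA] i j; set w := s _ - s _.
have wE : w = s (x i j - y i j) by rewrite sB.
have wL : L (const_mx ((2^-1)%:C *: w) : 'M[V]_1) <= 1.
  rewrite -mscale_const (mls_scale LS) normcR ger0_norm ?invr_ge0//.
  rewrite -qnormE (_ : map_mx pi (const_mx w) = const_mx (x i j) - const_mx (y i j)).
    rewrite mulrC ler_pdivrMr// mul1r (le_trans (osn_triangle osW _ _))// (osnN osW).
    by have := ent x i j xN; have := ent y i j yN; move: (N _) (N _) => a b; lra.
  by apply/matrixP => k l; rewrite !mxE wE piS.
have -> : eps = 2 * (4 * d) by rewrite /d; field.
apply: (mnorm_le_states M) => [|f fS]; first by rewrite mulr_gt0.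
have [l lm near] := net _ (scalar_state_CS M fS).
have := near _ wL; rewrite !mxE.
have stl := CS_scalar_state (stS l lm).
rewrite (stateZ stl) (stateZ fS) -mulrBr Normc.normcM normcR ger0_norm ?invr_ge0//.
rewrite mulrC ler_pdivrMr// => n1.
have n2 : normc (st l w 0 0) <= 2 * d.
  have xl := xA (Ordinal lm, (i, j)); have yl := yA (Ordinal lm, (i, j)).
  rewrite /= in xl yl.
  have -> : st l w 0 0 = (st l (s (x i j)) 0 0 - c (Ordinal lm, (i, j))) +
      - (st l (s (y i j)) 0 0 - c (Ordinal lm, (i, j))).
    by rewrite /w (stateD stl) (stateN stl) opprB addrA subrK.
  apply: le_trans (le_normcD _ _) _; rewrite normcN.
  by move: xl yl; move: (normc _) (normc _) => a b; lra.
have -> : f w = st l w 0 0 + - (st l w 0 0 - f w) by rewrite opprB addrC subrK.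
apply: le_trans (le_normcD _ _) _; rewrite normcN.
by move: n1 n2; move: (normc _) (normc _) => a b; lra.
Qed.

(** Points chosen in smaller and smaller sets of the ultrafilter form a Cauchy
    sequence. Its limit in the completion lies in the closure of the Lipschitz
    ball, hence in the ball itself because the seminorm is closed. *)
Theorem Lip_ball_compact n (U : set_system 'M[W]_n) : UltraFilter U -> U [set x | N x <= 1] ->
  exists2 k : 'M[W]_n, N k <= 1 & forall eps : R, 0 < eps ->
    U [set x | forall i j, nu (const_mx (x i j - k i j) : 'M[W]_1) < eps].
Proof.
move=> UU UK.
have [s [piS sB sbd]] := lipschitz_lift.
pose ep (k : nat) : R := k.+1%:R^-1.
have ep0 k : 0 < ep k by rewrite invr_gt0.
have small := ultra_totally_bounded UU UK piS sB sbd.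
have /choice[A AP] : forall k : nat, exists A, U A /\ forall x y, A x -> A y ->
    forall i j, mn (const_mx (s (x i j) - s (y i j)) : 'M[V]_1) <= ep k.
  by move=> k; have [A UA HA] := small _ (ep0 k); exists A.
have /choice[u uP] : forall k : nat, exists x : 'M[W]_n, N x <= 1 /\
    forall l : 'I_k.+1, A l x.
  move=> k; have UA : U [set x | forall l : 'I_k.+1, A l x].
    by apply: filter_forall => l; have [] := AP l.
  by have [x [xN xA]] := filter_ex (filterI UK UA); exists x.
have uA k l : (l <= k)%N -> A l (u k).
  by move=> lk; have [_ /(_ (Ordinal (lk : (l < k.+1)%N)))] := uP k.
have io (v v' : V) : map_mx iota (const_mx v : 'M[V]_1) - map_mx iota (const_mx v') =
    map_mx iota (const_mx (v - v') : 'M[V]_1).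
  by apply/matrixP => i j; rewrite !mxE linearB.
have ep_lt (d : R) : 0 < d -> exists k, ep k < d.
  move=> d0; exists (Num.bound d^-1); rewrite invf_plt ?posrE//.
  have : d^-1 < (Num.bound d^-1)%:R by apply: archi_boundP; rewrite invr_ge0 ltW.
  by move=> H; apply: lt_le_trans H _; rewrite ler_nat.
have /choice[w wP] : forall p : 'I_n * 'I_n, exists w : 'M[Vbar]_1,
    forall d : R, 0 < d -> exists k0, forall k, (k0 <= k)%N ->
      Nbar (map_mx iota (const_mx (s (u k p.1 p.2)) : 'M[V]_1) - w) < d.
  move=> [i j] /=.
  apply: (cpl_complete cpl (u := fun k => map_mx iota (const_mx (s (u k i j)) : 'M[V]_1))).
  move=> d d0; have [k0 k0d] := ep_lt d d0; exists k0 => k l kk ll.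
  rewrite io -mnorm_iota; apply: le_lt_trans k0d.
  by have [_ H] := AP k0; apply: H; exact: uA.
pose wm : 'M[Vbar]_n := \matrix_(i, j) w (i, j) 0 0.
have wconst i j : const_mx (wm i j) = w (i, j).
  by apply/matrixP => k l; rewrite !mxE !ord1.
have unif (d : R) : 0 < d -> exists k0, forall k, (k0 <= k)%N -> forall i j,
    Nbar (map_mx iota (const_mx (s (u k i j)) : 'M[V]_1) - w (i, j)) < d.
  move=> d0; have /choice[k0 kP] : forall p : 'I_n * 'I_n, exists k0, forall k,
      (k0 <= k)%N -> Nbar (map_mx iota (const_mx (s (u k p.1 p.2)) : 'M[V]_1) - w p) < d.
    by move=> p; exact: wP.
  exists (\max_p k0 p)%N => k kk i j; apply: (kP (i, j)).
  by apply: leq_trans kk; exact: (leq_bigmax (i, j)).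
have wcl : Lball_closure Nbar iota L wm.
  move=> d d0; have n0 : 0 < (n * n)%:R + 1 :> R by rewrite ltr_wpDl.
  have [k0 kP] := unif _ (divr_gt0 d0 n0).
  exists (map_mx s (u k0)).
    rewrite -qnormE (_ : map_mx pi _ = u k0); first by have [] := uP k0.
    by apply/matrixP => i j; rewrite !mxE piS.
  apply: le_lt_trans (osn_le_sum osB _) _.
  apply: (@le_lt_trans _ _ (\sum_(i < n) \sum_(j < n) (d / ((n * n)%:R + 1)))).
    apply: ler_sum => i _; apply: ler_sum => j _; apply: ltW.
    have := kP k0 (leqnn _) i j; rewrite -(osnN osB) opprB.
    congr (Nbar _ < _); apply/matrixP => k l; rewrite !mxE !ord1.
    by [].
  rewrite big_const_ord iter_addr_0 big_const_ord iter_addr_0.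
  rewrite -mulrnA -[X in X < _]mulr_natl mulrA ltr_pdivrMr//.
  by rewrite mulrC ltr_pM2l// ltrDl.
have Lw : (Lminus Nbar iota L wm <= 1%:E)%E.
  apply: ereal_inf_lbound; exists 1 => //=; split=> //; exists wm => //.
  by apply/matrixP => i j; rewrite !mxE scale1r.
have [|a wa La] := Lcl (n := n) (w := wm).
  by apply: le_lt_trans Lw _; rewrite ltry.
exists (map_mx pi a).
  by rewrite qnormE -lee_fin -La.
move=> eps e0; have e20 : 0 < eps / 2 by rewrite divr_gt0.
have [k1 k1e] := ep_lt _ e20.
have [k2 k2P] := unif _ e20.
pose k := maxn k1 k2.
have [UA _] := AP k1.
apply: filterS (filterI UA UK) => x [xA xN] i j.
have -> : const_mx (x i j - (map_mx pi a) i j) = map_mx pi (const_mx (s (x i j) - a i j)) :> 'M[W]_1.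
  by apply/matrixP => p q; rewrite !mxE linearB /= piS.
apply: le_lt_trans (quotient_norm_le _) _; rewrite mnorm_iota -io.
have -> : map_mx iota (const_mx (a i j) : 'M[V]_1) = w (i, j).
  by rewrite -wconst wa; apply/matrixP => p q; rewrite !mxE.
have -> : map_mx iota (const_mx (s (x i j)) : 'M[V]_1) - w (i, j) =
  (map_mx iota (const_mx (s (x i j)) : 'M[V]_1) - map_mx iota (const_mx (s (u k i j)))) +
  (map_mx iota (const_mx (s (u k i j)) : 'M[V]_1) - w (i, j)) by rewrite addrA subrK.
apply: le_lt_trans (osn_triangle osB _ _) _; rewrite [eps]splitr.
apply: ler_ltD; last by apply: k2P; exact: leq_maxr.
rewrite io -mnorm_iota; apply: le_trans (ltW k1e).
by have [_ H] := AP k1; apply: H => //; apply: uA; exact: leq_maxl.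
Qed.

End QuotientSpace.

(** * Evaluation as a complete isometry onto the dual *)

Section OneByOne.
Variables (R : realType) (W : lmodType R[i]).
Local Notation C := R[i].

Lemma amul11 (a b : 'M[C]_1) (v : 'M[W]_1) :
  amul a v b 0 0 = (a 0 0 * b 0 0) *: v 0 0.
Proof. by rewrite mxE !big_ord1. Qed.

Lemma fro2_11 (a : 'M[C]_1) : fro2 a = normc (a 0 0) ^+ 2.
Proof. by rewrite fro2E !big_ord1. Qed.

Lemma pairing11 (f : 'I_1 -> 'I_1 -> W -> C) (w : 'M[W]_1) : pairing f w = f 0 0 (w 0 0).
Proof. by rewrite /pairing !big_ord1. Qed.

End OneByOne.

Section Duality.
Variables (R : realType) (W : lmodType R[i]).
Local Notation C := R[i].
Variables (N : forall n, 'M[W]_n -> R) (star : W -> W) (nu : forall n, 'M[W]_n -> R).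
Hypothesis osN : operator_space_norm N.
Hypothesis starI : involution star.
Hypothesis Nstar : forall n (v : 'M[W]_n), N (mxstar star v) = N v.
Hypothesis nuD : forall u v : 'M[W]_1, nu (u + v) <= nu u + nu v.
Hypothesis nuZ : forall (c : C) (u : 'M[W]_1), nu (mscale c u) = normc c * nu u.
Hypothesis nu_star : forall u : 'M[W]_1, nu (mxstar star u) = nu u.

Local Notation K := (fun n => [set a : 'M[W]_n | N a <= 1]).
Local Notation A := (A0K nu star K).
Local Notation An := (@A0K_norm R W nu star K).

Hypothesis Kcompact : forall n (F : set_system 'M[W]_n), UltraFilter F ->
  F [set x | N x <= 1] -> exists2 k : 'M[W]_n, N k <= 1 &
    forall eps : R, 0 < eps ->
      F [set x | forall i j, nu (const_mx (x i j - k i j) : 'M[W]_1) < eps].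
Hypothesis separated : forall x, (forall F : A, evA F x = 0) -> x = 0.

Local Notation evl := (evA_linl (N := N) (star := star) (nu := nu)).
Local Notation evr := (evA_linr osN starI Nstar).

Lemma A0K_norm_lb r (F : 'M[A]_r) (b : R) :
  (forall t, 0 < t -> formbound F t -> b <= t) -> b <= An F.
Proof.
move=> H; apply: lb_le_inf.
  have [t t0 Ft] := formbound_ex osN starI Nstar nuD nuZ nu_star Kcompact F.
  by exists t; split=> //; apply/(formboundP osN starI Nstar).
by move=> t [t0 /(formboundP osN starI Nstar)]; exact: H.
Qed.

Lemma A0K_norm_ge0 r (F : 'M[A]_r) : 0 <= An F.
Proof. by apply: A0K_norm_lb => t /ltW. Qed.

Lemma evA_le_norm (x : W) : exists M : R, forall F : A,
  normc (evA F x) <= M * An (const_mx F : 'M_1).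
Proof.
pose s := N (const_mx x : 'M[W]_1) + 1.
have s0 : 0 < s by rewrite ltr_wpDl// (osn_ge0 osN).
exists s => F; rewrite -ler_pdivrMl//; apply: A0K_norm_lb => t t0 Ft.
have vN : N (const_mx (s^-1%:C *: x) : 'M[W]_1) <= 1.
  by apply: N1_scale_le => //; rewrite lerDl.
have [u u1 uE] := phase (evA F (s^-1%:C *: x)).
have := Ft 1%N _ vN (const_mx u^*%R) 1%:M.
rewrite pairing11 amul11 !fro2_11 !mxE eqxx conjCK mulr1 (evAZ osN starI Nstar) uE.
rewrite (evAZ osN starI Nstar) Normc.normcM normcR gtr0_norm ?invr_gt0// cnormJ u1 Normc.normc1 expr1n.
by move: (s^-1 * _) => z /=; lra.
Qed.

Lemma evA_dual (x : W) : ((fun F : A => evA F x) : A -> C^o) \in dual_pred An.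
Proof.
apply/asboolP; split=> [c F G|]; first exact: evl.
exact: evA_le_norm.
Qed.

Definition evdual (x : W) : dual An := MkDual (evA_dual x).

Lemma evdual_linear : linear evdual.
Proof.
move=> c x y; apply: val_inj; apply/funext => F.
transitivity (c * evA F x + evA F y); first exact: evr.
by rewrite linearP.
Qed.

Lemma evdual_inj : injective evdual.
Proof.
move=> x y xy; apply/eqP; rewrite -subr_eq0; apply/eqP/separated => F.
rewrite (evAB osN starI Nstar); apply/eqP; rewrite subr_eq0; apply/eqP.
exact: (congr1 (fun d : dual An => d F) xy).
Qed.

(** The case [n = 1] of the bipolar theorem, for the functional divided by its
    bound. *)
Lemma evdual_surj (d : dual An) : exists x, evdual x = d.
Proof.
case: d => d dP; have /asboolP[dlin [M0 dM]] := dP.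
pose M := `|M0| + 1; have M1 : 0 < M by rewrite ltr_wpDl.
pose f (i j : 'I_1) (F : A) : C := M^-1%:C * d F.
have flin i j (c : C) F G : f i j (c *: F + G) = c * f i j F + f i j G.
  by rewrite /f dlin mulrDr mulrCA.
have fball (F : 'M[A]_1) : An F <= 1 -> forall X Y : 'M[C]_1,
    2 * Re (pairing f (amul X F Y)) <= fro2 X + fro2 Y.
  move=> F1 X Y; rewrite pairing11 amul11 !fro2_11.
  have dF : normc (d (F 0 0)) <= M.
    apply: le_trans (dM _) _; rewrite -mx11_const.
    have H : M0 <= M by rewrite /M (le_trans (ler_norm _))// lerDl.
    apply: le_trans (ler_wpM2r (A0K_norm_ge0 _) H) _.
    by rewrite ger_pMr.
  have fF : normc (f 0 0 ((X 0 0 * Y 0 0) *: F 0 0)) <= normc (X 0 0) * normc (Y 0 0).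
    rewrite (linZ (flin 0 0)) !Normc.normcM ler_piMr ?mulr_ge0 ?normc_ge0//.
    by rewrite normcR gtr0_norm ?invr_gt0// mulrC ler_pdivrMr// mul1r.
  have := le_trans (Re_le_normc _) fF.
  have := sqr_ge0 (normc (X 0 0) - normc (Y 0 0)); rewrite sqrrB.
  by move: (Re _) (_ ^+ 2) (_ ^+ 2) (_ * _) => z p q r; lra.
have [k _ kE] := bipolar osN starI Nstar nuD nuZ nu_star Kcompact flin fball.
exists (M%:C *: k 0 0); apply: val_inj; apply/funext => F.
rewrite /= (evAZ osN starI Nstar) -(kE 0 0) /f mulrA -rmorphM mulfV ?gt_eqF//.
by rewrite mul1r.
Qed.

Lemma map_evdual_bij n : bijective (fun a : 'M[W]_n => map_mx evdual a).
Proof.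
have /choice[g gP] := evdual_surj.
exists (map_mx g) => a; apply/matrixP => i j; rewrite !mxE ?gP//.
by apply: evdual_inj; rewrite gP.
Qed.

Definition evblock n (a : 'M[W]_n) r (G : 'M[A]_r) : 'M['M[C]_n]_r :=
  map_mx (fun F => \matrix_(i, j) evA F (a i j)) G.

Lemma blockform_evblock n (a : 'M[W]_n) r (G : 'M[A]_r) (X Y : 'M[C]_(r, n)) :
  blockform (evblock a G) X Y =
  pairing (fun k l => evA (G k l)) (amul (X^T^t* ) a Y^T).
Proof.
apply: eq_bigr => k _; apply: eq_bigr => l _; rewrite [amul _ _ _ _ _]mxE mxE.
rewrite (big_lin2 (f := evA (G k l)))//; last exact: evr.
by apply: eq_bigr => i _; apply: eq_bigr => j _; rewrite !mxE mulrAC.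
Qed.

Lemma evblock_le n (a : 'M[W]_n) r (G : 'M[A]_r) : An G <= 1 ->
  opnorm (flatmx (evblock a G)) <= N a.
Proof.
move=> G1; apply/ler_addgt0Pr => d d0; set s := N a + d.
have s0 : 0 < s by rewrite ltr_wpDl// (osn_ge0 osN).
apply/opnorm_flatP => [|X Y]; first exact: ltW.
have vN : N (mscale s^-1%:C a) <= 1.
  rewrite (osn_scale osN) normcR gtr0_norm ?invr_gt0// mulrC ler_pdivrMr// mul1r.
  by rewrite lerDl ltW.
have := formbound_unit osN starI Nstar nuD nuZ nu_star Kcompact G1 vN X^T Y^T.
rewrite amul_mscale.
rewrite (pairingZ (fun i j => evr (G i j))) creZ mul1r -blockform_evblock !fro2_tr mulrCA.
by rewrite -ler_pdivlMl ?invr_gt0// invrK.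
Qed.

(** The bipolar theorem, applied to the evaluations at [a] divided by [c],
    produces a point of the ball with the same evaluations as [a / c], and the
    two are equal by separation. *)
Lemma evblock_ge n (a : 'M[W]_n) (c : R) : 0 < c ->
  (forall G : 'M[A]_n, An G <= 1 -> opnorm (flatmx (evblock a G)) <= c) -> N a <= c.
Proof.
move=> c0 H; pose f (i j : 'I_n) (F : A) : C := c^-1%:C * evA F (a i j).
have flin i j (z : C) F G : f i j (z *: F + G) = z * f i j F + f i j G.
  by rewrite /f evl mulrDr mulrCA.
have fball (F : 'M[A]_n) : An F <= 1 -> forall X Y : 'M[C]_n,
    2 * Re (pairing f (amul X F Y)) <= fro2 X + fro2 Y.
  move=> F1 X Y.
  have -> : pairing f (amul X F Y) = c^-1%:C * blockform (evblock a F) (X^t* ) Y.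
    rewrite blockform_evblock (_ : (X^t* )^T^t* = X^T); last first.
      by apply/matrixP => i j; rewrite !mxE conjCK.
    have <- := pairing_transfer evl evr X F Y a.
    rewrite /pairing mulr_sumr; apply: eq_bigr => i _.
    by rewrite mulr_sumr.
  rewrite creZ mulrCA ler_pdivrMl//.
  have /opnorm_flatP := H F F1; move=> /(_ (ltW c0) (X^t* ) Y).
  by rewrite fro2_adj.
have [k k1 kE] := bipolar osN starI Nstar nuD nuZ nu_star Kcompact flin fball.
have -> : a = mscale c%:C k.
  apply/matrixP => i j; apply: evdual_inj; apply: val_inj; apply/funext => F /=.
  rewrite mxE (evAZ osN starI Nstar) -(kE i j) /f mulrA -rmorphM mulfV ?gt_eqF//.
  by rewrite mul1r.
by rewrite (osn_scale osN) normcR gtr0_norm// ger_pMr.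
Qed.

Lemma dual_norm_evdual n (a : 'M[W]_n) : dual_norm (map_mx evdual a) = (N a)%:E.
Proof.
rewrite /dual_norm /cb_norm; set E := [set _ | _].
have EE y : E y <-> exists r (G : 'M[A]_r), An G <= 1 /\
    y = (opnorm (flatmx (evblock a G)))%:E.
  have eq r (G : 'M[A]_r) : map_mx (fun F => \matrix_(k, l) (map_mx evdual a) k l F) G =
      evblock a G.
    by apply/matrixP => k l; rewrite !mxE; apply/matrixP => i j; rewrite !mxE.
  by split=> -[r [G [G1 ->]]]; exists r, G; rewrite eq.
apply/eqP; rewrite eq_le; apply/andP; split.
  apply: ge_ereal_sup => _ /EE[r [G [G1 ->]]]; rewrite lee_fin; exact: evblock_le.
have E0 (G : 'M[A]_n) : An G <= 1 -> ((opnorm (flatmx (evblock a G)))%:E <= ereal_sup E)%E.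
  by move=> G1; apply: ereal_sup_ubound; apply/EE; exists n, G.
have [G0 G01] : exists G : 'M[A]_n, An G <= 1.
  exists 0; apply: (A0K_norm_le osN starI Nstar) => // m v vN X Y.
  rewrite /pairing big1 => [|i _]; last first.
    by rewrite big1// => j _; rewrite mxE (lin0 (evl (amul (X^t* ) v Y i j))).
  by rewrite mulr0 mul1r addr_ge0// fro2_ge0.
move: (ereal_sup E) E0 => [d|//|] E0; last first.
- by have := E0 _ G01.
- by rewrite leey.
apply/lee_addgt0Pr => t t0; rewrite -EFinD lee_fin.
have d0 : 0 <= d by apply: le_trans (opnorm_ge0 _) _; rewrite -lee_fin; exact: (E0 G0).
apply: evblock_ge => [|G G1]; first by rewrite ltr_wpDl.
by have := E0 G G1; rewrite lee_fin => /le_trans -> //; rewrite lerDl ltW.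
Qed.

End Duality.

(** * Separation of points and conclusion *)

Section Separation.
Variables (R : realType) (V : lmodType R[i]).
Local Notation C := R[i].
Variables (star : V -> V) (e : V) (pos : forall n, set 'M[V]_n).
Variable L : forall n, 'M[V]_n -> R.
Variables (Vbar : lmodType C) (Nbar : forall n, 'M[Vbar]_n -> R) (iota : {linear V -> Vbar}).
Hypothesis M : matrix_order_unit_space star e pos.
Hypothesis HL : matrix_Lip_norm star e pos L.
Hypothesis cpl : is_completion (mnorm star e pos) Nbar iota.

Local Notation W := (quotV e).
Local Notation pi := (@qpi R V e).
Local Notation N := (qnorm (e := e) L).
Local Notation nu := (qnorm (e := e) (mnorm star e pos)).
Local Notation K := (fun n => [set a : 'M[W]_n | N a <= 1]).

(** The difference of two states descends to the quotient and is bounded there,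
    hence gives an element of the predual. So all states agree at a lift [v] of
    [x], and [v] is a multiple of the unit because states separate points. *)
Lemma A0_separates (x : W) : (forall F : A0K nu (qstar star) K, evA F x = 0) -> x = 0.
Proof.
have osW := qnorm_osn HL.
move=> x0; have [v vx] : exists v, x = pi v by exists (qrepr x); rewrite qreprK.
have [[f0 f0S]|nS] := pselect (exists f, scalar_state e pos f); last first.
  have v0 : v = 0 by apply: (states_separate M) => f fS; exfalso; apply: nS; exists f.
  by rewrite vx v0 linear0.
suff vE : v - f0 v *: e = 0.
  by rewrite vx -(linear0 pi); apply/qpiP; exists (f0 v); rewrite subr0 -[LHS]subr0 -vE subKr.
apply: (states_separate M) => f fS; have [flin fe _] := fS; have [f0lin f0e _] := f0S.
rewrite (stateD fS) (stateN fS) (stateZ fS) fe mulr1.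
pose h (w : W) := f (qrepr w) - f0 (qrepr w).
have hE u : h (pi u) = f u - f0 u.
  have /qpiP[c cE] := qreprK (pi u).
  have uE : qrepr (pi u) = c *: e + u by rewrite -cE subrK.
  by rewrite /h uE flin f0lin fe f0e opprD addrACA subrr add0r.
have hlin (c : C) w z : h (c *: w + z) = c * h w + h z.
  rewrite -[w]qreprK -[z]qreprK -linearP !hE flin f0lin mulrBr opprD.
  by rewrite addrACA.
have hnu w : normc (h w) <= 2 * nu (const_mx w : 'M[W]_1).
  apply/ler_addgt0Pr => d d0.
  have [u wu ud] : exists2 u : 'M[V]_1, const_mx w = map_mx pi u &
      mnorm star e pos u < nu (const_mx w : 'M[W]_1) + d / 2.
    by apply: (quotient_norm_lift cpl); rewrite ltrDl divr_gt0.
  have -> : w = pi (u 0 0) by have /matrixP/(_ 0 0) := wu; rewrite !mxE.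
  have {}wu : const_mx (pi (u 0 0)) = const_mx w :> 'M[W]_1.
    by rewrite wu; apply/matrixP => i j; rewrite !mxE !ord1.
  rewrite wu hE; rewrite [u]mx11_const in ud.
  apply: le_trans (le_normcD _ _) _; rewrite normcN.
  have s1 := state_le_mnorm M (u 0 0) fS; have s2 := state_le_mnorm M (u 0 0) f0S.
  by move: s1 s2 ud; move: (normc _) (normc _) (mnorm _ _ _ _) (nu _) => a b p q; lra.
have [Ft FtA FtE] := functional_isA0 osW (qstar_involution M)
  (@quotient_normD _ _ _ e _ _ _ _ cpl 1) (@quotient_normZ _ _ _ e _ _ _ _ cpl 1) hlin hnu.
have FtP : Ft \in A0K_pred nu (qstar star) K by apply/asboolP.
have s0 : 0 < N (const_mx x : 'M[W]_1) + 1 by rewrite ltr_wpDl// (osn_ge0 osW).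
have := x0 (MkA0K FtP); rewrite /evA /ev /= FtE; last first.
  by apply: (N1_scale_le osW) => //; rewrite lerDl.
by rewrite (linZ hlin) mulrA -rmorphM mulfV ?gt_eqF// mul1r vx hE.
Qed.

End Separation.

Theorem theorem7p8 (R : realType) (V : lmodType R[i])
    (star : V -> V) (e : V) (pos : forall n, set 'M[V]_n)
    (L : forall n, 'M[V]_n -> R)
    (Vbar : lmodType R[i]) (Nbar : forall n, 'M[Vbar]_n -> R)
    (iota : {linear V -> Vbar}) :
  matrix_order_unit_space star e pos ->
  matrix_Lip_norm star e pos L ->
  is_completion (mnorm star e pos) Nbar iota ->
  Lip_closed Nbar iota L ->
  exists2 Phi : {linear quotV e -> dual (@A0_norm R V star e pos L)},
    natural_map Phi &
    complete_isometric_isomorphism (qnorm L)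
      (@dual_norm R _ (@A0_norm R V star e pos L)) Phi.
Proof.
move=> M HL cpl Lcl.
have osW := qnorm_osn HL.
have sI := qstar_involution M.
have Ns := qnorm_star M HL.
have nD := @quotient_normD _ _ _ e _ _ _ _ cpl 1.
have nZ := @quotient_normZ _ _ _ e _ _ _ _ cpl 1.
have nS := quotient_norm_star M cpl.
have Kc := Lip_ball_compact M HL cpl Lcl.
have sep := A0_separates M HL cpl.
pose Phi := evdual osW sI Ns nD nZ nS Kc.
pose PhiL : {linear quotV e -> dual (@A0_norm R V star e pos L)} :=
  HB.pack Phi (GRing.isLinear.Build _ _ _ _ Phi (evdual_linear osW sI Ns nD nZ nS Kc)).
exists PhiL.
  move=> F lam k l0 kK.
  rewrite (mx11_const k) [const_mx _ _ _]mxE.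
  apply: (evE osW sI Ns (A0K_isA0 F) l0).
  by rewrite -mx11_const.
move=> n; split; first exact: (map_evdual_bij osW sI Ns nD nZ nS Kc sep).
exact: (dual_norm_evdual osW sI Ns nD nZ nS Kc sep).
Qed.
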